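(* Let $K$ be the operator with finitely many bounded separated interactions described in the context, with $(\mu\times\nu)(X\times Y)>0$, and let $u=\theta-\theta_0$, $M$, $H$, $C$, $\zeta$ and $d_N$ be as defined there. Define the finite positive measure $\sigma$ on $[-M,M]$ by $$\sigma(B):=\int_{X\times Y}\mathbf 1_B(u(x,y))\,|H(x,y)|^2\,d\mu(x)\,d\nu(y),$$ so $\sigma([-M,M])=C^2$. For $N\ge1$ put $$\mathcal E_N^{\rm best}:=\min_{P\in\mathbb C[t],\ \deg P<N}\left(\int_{-M}^{M}|e^{it}-P(t)|^2\,d\sigma(t)\right)^{1/2},\qquad\mathcal E_0^{\rm best}:=C.$$ Then the minimum is attained. For every $N\ge0$ there is an operator $K_N^{\rm best}$ such that $$\operatorname{rank}K_N^{\rm best}\le d_N,\qquad\|K-K_N^{\rm best}\|\le\|K-K_N^{\rm best}\|_{\rm HS}=\mathcal E_N^{\rm best}.$$ Consequently, $$s_{d_N+1}(K)\le\mathcal E_N^{\rm best}\le C\frac{M^N}{N!}\le C\frac{\zeta^N}{N!},\qquad N\ge1.$$ For every $N\in\mathbb N_0$, if $K$ is a contraction and $0<\epsilon<1/2$, then $$\mathcal E_N^{\rm best}\le\sqrt\epsilon\quad\Longrightarrow\quad\Lambda_\epsilon(K^*K)\le d_N.$$ For $N\ge1$, let $$G^{(N)}_{jk}:=\int_{-M}^{M}t^{j+k}\,d\sigma(t),\qquad b^{(N)}_j:=\int_{-M}^{M}t^je^{it}\,d\sigma(t),\qquad0\le j,k<N,$$ and let $G^{(N)\dagger}$ denote the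 Moore--Penrose inverse of $G^{(N)}$. One minimizing coefficient vector (for $P(t)=\sum_{k=0}^{N-1}c_kt^k$) is $c=G^{(N)\dagger}b^{(N)}$, and $$(\mathcal E_N^{\rm best})^2=C^2-(b^{(N)})^*G^{(N)\dagger}b^{(N)}.$$ This formula remains valid when $G^{(N)}$ is singular.
   Context: Let $(X,\mu)$ and $(Y,\nu)$ be $\sigma$-finite measure spaces and $p,r\ge1$ integers. Let $w_X,a_1,\dots,a_p$ be measurable on $X$ and $w_Y,b_1,\dots,b_p$ measurable on $Y$ with $w_Xa_q\in L^2(X)$, $w_Yb_q\in L^2(Y)$, and $\mathfrak a(x,y):=\sum_{q=1}^pa_q(x)b_q(y)$. Let $\phi,X_1,\dots,X_r:X\to\mathbb R$ and $\psi,Y_1,\dots,Y_r:Y\to\mathbb R$ be measurable, and $$(Kf)(y)=w_Y(y)\int_Xw_X(x)\,\mathfrak a(x,y)\exp\!\left(i\Bigl[\phi(x)+\psi(y)+\sum_{\ell=1}^rX_\ell(x)Y_\ell(y)\Bigr]\right)f(x)\,d\mu(x),\quad f\in L^2(X).$$ Fix real centers $\xi_\ell,\eta_\ell$; put $\widetilde X_\ell:=X_\ell-\xi_\ell$, $\widetilde Y_\ell:=Y_\ell-\eta_\ell$, $R_\ell:=\operatorname{ess\,sup}_X|\widetilde X_\ell|$, $S_\ell:=\operatorname{ess\,sup}_Y|\widetilde Y_\ell|$ (assumed finite), $\zeta:=\sum_{\ell=1}^rR_\ell S_\ell$, $H(x,y):=w_X(x)w_Y(y)\mathfrak a(x,y)$,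 $C:=\|H\|_{L^2(X\times Y)}<\infty$. Set $$\phi_0:=\phi+\sum_\ell\eta_\ell X_\ell-\sum_\ell\xi_\ell\eta_\ell,\quad\psi_0:=\psi+\sum_\ell\xi_\ell Y_\ell,\quad\theta(x,y):=\sum_{\ell=1}^r\widetilde X_\ell(x)\widetilde Y_\ell(y),$$ $$\theta_-:=\operatorname{ess\,inf}_{X\times Y}\theta,\quad\theta_+:=\operatorname{ess\,sup}_{X\times Y}\theta,\quad\theta_0:=\frac{\theta_++\theta_-}2,\quad M:=\frac{\theta_+-\theta_-}2.$$ For $N\ge1$, with multi-indices $\boldsymbol\nu\in\mathbb N_0^r$, $|\boldsymbol\nu|=\nu_1+\dots+\nu_r$, $$\mathcal U_N:=\operatorname{span}\Bigl\{w_Xa_qe^{i\phi_0}\prod_\ell\widetilde X_\ell^{\nu_\ell}:1\le q\le p,\ |\boldsymbol\nu|<N\Bigr\}\subset L^2(X),$$ $$\mathcal V_N:=\operatorname{span}\Bigl\{w_Yb_qe^{i\psi_0}\prod_\ell\widetilde Y_\ell^{\nu_\ell}:1\le q\le p,\ |\boldsymbol\nu|<N\Bigr\}\subset L^2(Y),$$ $d_N:=\min\{\dim\mathcal U_N,\dim\mathcal V_N\}$, $d_0:=0$. $s_1\ge s_2\ge\cdots$ are singular values; $\Lambda_\epsilon(S):=\operatorname{rank}\mathbf 1_{(\epsilon,1-\epsilon)}(S)$ for a positive contraction $S$. *)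

(* Defs.v *)
From HB Require Import structures.
From mathcomp Require Import all_boot all_order all_algebra.
From mathcomp Require Import spectral.
From mathcomp Require Import complex.
From mathcomp Require Import all_classical all_reals all_analysis.
From mathcomp Require Import ess_sup_inf.

Set Implicit Arguments.
Unset Strict Implicit.
Unset Printing Implicit Defensive.

Import Order.TTheory GRing.Theory Num.Theory.
Import numFieldNormedType.Exports.

Local Open Scope classical_set_scope.
Local Open Scope complex_scope.
Local Open Scope ring_scope.

(** * Complex-valued functions *)

Definition cabs {R : realType} (z : R[i]) : R := complex.Re `|z|.

(* [expi t] is exp(i t) *)
Definition expi {R : realType} (t : R) : R[i] := cos t +i* sin t.

(* R[i] carries no sigma-algebra in the library: measurability and integration
   are taken componentwise. *)
Definition cmeasurable d (T : measurableType d) (R : realType) (f : T -> R[i]) :=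
  measurable_fun setT (fun x => complex.Re (f x)) /\
  measurable_fun setT (fun x => complex.Im (f x)).

Definition cintegral d (T : measurableType d) (R : realType)
    (mu : {measure set T -> \bar R}) (D : set T) (f : T -> R[i]) : R[i] :=
  (\int[mu]_(x in D) complex.Re (f x)) +i* (\int[mu]_(x in D) complex.Im (f x)).

(** * The Hilbert space L^2(T, mu; C)
    Its elements are represented by square-integrable functions, two of them
    being identified when they are equal mu-a.e. *)

Section L2.
Context d (T : measurableType d) (R : realType).
Variable mu : {measure set T -> \bar R}.
Implicit Types (f g : T -> R[i]) (U : set (T -> R[i])).

Definition L2norm f : \bar R := Lnorm mu 2%:E (fun x => (cabs (f x))%:E).

Definition L2 f := cmeasurable f /\ (L2norm f < +oo)%E.

Definition L2inner f g : R[i] := cintegral mu setT (fun x => f x * conjc (g x)).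

Definition ae_free n (e : 'I_n -> T -> R[i]) :=
  forall c : 'I_n -> R[i],
    (fun x => \sum_(i < n) c i * e i x) = cst 0 %[ae mu] -> forall i, c i = 0.

(* dimension (possibly +oo) of the subspace of L^2 represented by U *)
Definition L2dim U : \bar R :=
  ereal_sup [set n%:R%:E | n in [set n : nat |
    exists e : 'I_n -> T -> R[i], (forall i, U (e i)) /\ ae_free e]].

Definition orthonormal_fam n (e : 'I_n -> T -> R[i]) :=
  (forall i, L2 (e i)) /\ (forall i j, L2inner (e i) (e j) = (i == j)%:R).

Definition orthonormal_basis (B : set (T -> R[i])) :=
  [/\ (forall e, B e -> L2 e),
      (forall e e', B e -> B e' -> L2inner e e' = (e == e')%:R) &
      (forall f, L2 f -> (forall e, B e -> L2inner f e = 0) ->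
        f = cst 0 %[ae mu])].

End L2.

Definition lin_span (T : Type) (R : realType) (G : set (T -> R[i])) :
    set (T -> R[i]) :=
  [set f | exists (n : nat) (c : 'I_n -> R[i]) (g : 'I_n -> T -> R[i]),
    (forall i, G (g i)) /\ f = (fun x => \sum_(i < n) c i * g i x)].

(** * Operators between L^2 spaces
    An operator is a map on functions; only its values on L^2 matter, and only
    up to a.e. equality (linearity and boundedness make a bounded operator
    compatible with a.e. equality). *)

Section operators.
Context d1 (X : measurableType d1) d2 (Y : measurableType d2) (R : realType).
Variables (mu : {measure set X -> \bar R}) (nu : {measure set Y -> \bar R}).
Implicit Types A : (X -> R[i]) -> (Y -> R[i]).

Definition bounded_op A :=
  [/\ (forall f, L2 mu f -> L2 nu (A f)),
      (forall (c : R[i]) f g, L2 mu f -> L2 mu g ->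
        A (fun x => c * f x + g x) = (fun y => c * A f y + A g y) %[ae nu]) &
      (exists k : R, forall f, L2 mu f ->
        (L2norm nu (A f) <= k%:E * L2norm mu f)%E)].

Definition opnorm A : \bar R :=
  ereal_sup [set L2norm nu (A f) | f in
    [set f | L2 mu f /\ (L2norm mu f <= 1)%E]].

(* (\sum_e ||A e||^2)^(1/2) over an orthonormal basis (e); the sum does not
   depend on the basis, so the supremum over all bases is its common value. *)
Definition hs_norm A : \bar R :=
  ereal_sup [set ((\esum_(e in B) (L2norm nu (A e) ^+ 2)%E) `^ 2^-1)%E | B in
    orthonormal_basis mu].

Definition op_rank A : \bar R :=
  L2dim nu [set g | exists2 f, L2 mu f & g = A f].

End operators.

Definition is_adjoint d1 (X : measurableType d1) d2 (Y : measurableType d2)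
    (R : realType) (mu : {measure set X -> \bar R})
    (nu : {measure set Y -> \bar R})
    (A : (X -> R[i]) -> (Y -> R[i])) (B : (Y -> R[i]) -> (X -> R[i])) :=
  bounded_op nu mu B /\
  (forall f g, L2 mu f -> L2 nu g -> L2inner nu (A f) g = L2inner mu f (B g)).

(* for a bounded A the adjoint exists and is unique up to a.e. equality on L^2 *)
Definition adjoint d1 (X : measurableType d1) d2 (Y : measurableType d2)
    (R : realType) (mu : {measure set X -> \bar R})
    (nu : {measure set Y -> \bar R})
    (A : (X -> R[i]) -> (Y -> R[i])) : (Y -> R[i]) -> (X -> R[i]) :=
  xget (fun _ _ => 0) [set B | is_adjoint mu nu A B].

(* The n-th singular value (n >= 1) of a compact operator A: the square root of
   the n-th largest eigenvalue of A^*A counted with multiplicity (0 if there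
   are fewer than n positive ones), i.e. the largest s >= 0 such that A^*A has
   n orthonormal eigenvectors with eigenvalues >= s^2. *)
Definition singular_value d1 (X : measurableType d1) d2 (Y : measurableType d2)
    (R : realType) (mu : {measure set X -> \bar R})
    (nu : {measure set Y -> \bar R}) (A : (X -> R[i]) -> (Y -> R[i]))
    (n : nat) : \bar R :=
  ereal_sup [set s%:E | s in [set s : R | s = 0 \/ 0 <= s /\
    exists (e : 'I_n -> X -> R[i]) (l : 'I_n -> R),
      orthonormal_fam mu e /\
      forall i, s ^+ 2 <= l i /\
        adjoint mu nu A (A (e i)) = (fun x => (l i)%:C * e i x) %[ae mu]]].

(** * Spectral projections of a self-adjoint operator *)

Section spectral_projections.
Context d (T : measurableType d) (R : realType).
Variable mu : {measure set T -> \bar R}.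
Implicit Types S P : (T -> R[i]) -> (T -> R[i]).

Definition orth_projection P :=
  [/\ bounded_op mu mu P,
      (forall f, L2 mu f -> P (P f) = P f %[ae mu]) &
      (forall f g, L2 mu f -> L2 mu g ->
        L2inner mu (P f) g = L2inner mu f (P g))].

(* E is the projection-valued measure with S = \int t dE(t) *)
Definition spectral_measure S (E : set R -> (T -> R[i]) -> (T -> R[i])) :=
  [/\ (forall B : set (measurableTypeR R), measurable B ->
        orth_projection (E B)),
      (forall f, L2 mu f -> E setT f = f %[ae mu]) &
      (forall f, L2 mu f ->
        exists m : {finite_measure set (measurableTypeR R) -> \bar R},
        [/\ (forall B : set (measurableTypeR R), measurable B ->
              L2inner mu (E B f) f = (fine (m B))%:C),
            m.-integrable setT (fun t : measurableTypeR R => (t : R)%:E) &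
            L2inner mu (S f) f =
              (\int[m]_(t in setT) (t : R))%:C])].

(* B |-> 1_B(S); by the spectral theorem a bounded self-adjoint S has a spectral
   measure, unique up to a.e. equality on L^2 *)
Definition spectral_projection S : set R -> (T -> R[i]) -> (T -> R[i]) :=
  xget (fun _ _ _ => 0) [set E | spectral_measure S E].

Definition Lambda (eps : R) S : \bar R :=
  op_rank mu mu (spectral_projection S `]eps, 1 - eps[).

End spectral_projections.

(** * Moore-Penrose inverse *)

Section moore_penrose.
Local Open Scope sesquilinear_scope.

Definition is_mpinv (C : numClosedFieldType) m n (A : 'M[C]_(m, n))
    (B : 'M[C]_(n, m)) :=
  [/\ A *m B *m A = A, B *m A *m B = B,
      (A *m B) ^t* = A *m B & (B *m A) ^t* = B *m A].

Definition mpinv (C : numClosedFieldType) m n (A : 'M[C]_(m, n)) :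
    'M[C]_(n, m) := xget 0 [set B | is_mpinv A B].

End moore_penrose.

(** * The operator with separated interactions *)

(* [aX q], [bY q] are the amplitude factors a_q, b_q; [phiX], [psiY] the phases
   phi, psi; [coordX l], [coordY l] the functions X_l, Y_l; [xiX], [etaY] the
   centers xi_l, eta_l. *)
Record interaction (R : realType) (X Y : Type) (p r : nat) := Interaction {
  wX : X -> R[i];
  wY : Y -> R[i];
  aX : 'I_p -> X -> R[i];
  bY : 'I_p -> Y -> R[i];
  phiX : X -> R;
  psiY : Y -> R;
  coordX : 'I_r -> X -> R;
  coordY : 'I_r -> Y -> R;
  xiX : 'I_r -> R;
  etaY : 'I_r -> R }.

Section interaction_data.
Context d1 (X : measurableType d1) d2 (Y : measurableType d2) (R : realType).
Variables (mu : {sigma_finite_measure set X -> \bar R})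
          (nu : {sigma_finite_measure set Y -> \bar R}).
Variables (p r : nat) (D : interaction R X Y p r).

Definition amplitude (x : X) (y : Y) : R[i] :=
  \sum_(q < p) aX D q x * bY D q y.

Definition Kop (f : X -> R[i]) (y : Y) : R[i] :=
  wY D y * cintegral mu setT (fun x =>
    wX D x * amplitude x y *
    expi (phiX D x + psiY D y + \sum_(l < r) coordX D l x * coordY D l y) * f x).

Definition tX (l : 'I_r) (x : X) : R := coordX D l x - xiX D l.
Definition tY (l : 'I_r) (y : Y) : R := coordY D l y - etaY D l.

Definition radX (l : 'I_r) : R := fine (ess_sup mu (fun x => `|tX l x|%:E)).
Definition radY (l : 'I_r) : R := fine (ess_sup nu (fun y => `|tY l y|%:E)).

Definition zeta : R := \sum_(l < r) radX l * radY l.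

Definition Hfun (z : X * Y) : R[i] := wX D z.1 * wY D z.2 * amplitude z.1 z.2.

Definition Hnorm : R := fine (L2norm (mu \x nu)%E Hfun).

Definition phi0 (x : X) : R :=
  phiX D x + \sum_(l < r) etaY D l * coordX D l x - \sum_(l < r) xiX D l * etaY D l.
Definition psi0 (y : Y) : R := psiY D y + \sum_(l < r) xiX D l * coordY D l y.

Definition theta (z : X * Y) : R := \sum_(l < r) tX l z.1 * tY l z.2.

Definition theta_minus : R := fine (ess_inf (mu \x nu)%E (fun z => (theta z)%:E)).
Definition theta_plus : R := fine (ess_sup (mu \x nu)%E (fun z => (theta z)%:E)).
Definition theta0 : R := (theta_plus + theta_minus) / 2.
Definition halfwidth : R := (theta_plus - theta_minus) / 2.
Definition ucent (z : X * Y) : R := theta z - theta0.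

Definition Uspace (N : nat) : set (X -> R[i]) :=
  lin_span [set g | exists (q : 'I_p) (k : 'I_r -> nat),
    (\sum_(l < r) k l < N)%N /\
    g = (fun x => wX D x * aX D q x * expi (phi0 x) *
                  (\prod_(l < r) tX l x ^+ k l)%:C)].

Definition Vspace (N : nat) : set (Y -> R[i]) :=
  lin_span [set g | exists (q : 'I_p) (k : 'I_r -> nat),
    (\sum_(l < r) k l < N)%N /\
    g = (fun y => wY D y * bY D q y * expi (psi0 y) *
                  (\prod_(l < r) tY l y ^+ k l)%:C)].

(* both dimensions are finite natural numbers, so [fine] and [truncn] lose
   nothing *)
Definition dN (N : nat) : nat :=
  if N is 0 then 0%N
  else Num.truncn (fine (Order.min (L2dim mu (Uspace N)) (L2dim nu (Vspace N)))).

End interaction_data.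

(** * Best polynomial approximation of exp(i t) on [-M, M] *)

Section best_approximation.
Context (R : realType).
Variables (sigma : {measure set (measurableTypeR R) -> \bar R}) (M C : R).

Definition approx_error (P : {poly R[i]}) : R :=
  Num.sqrt (\int[sigma]_(t in `[- M, M]%classic) cabs (expi t - P.[t%:C]) ^+ 2).

(* deg P < N is [size P <= N] *)
Definition Ebest (N : nat) : R :=
  if N is 0 then C
  else inf [set approx_error P | P in [set P : {poly R[i]} | (size P <= N)%N]].

Definition moment_mx (N : nat) : 'M[R[i]]_N :=
  \matrix_(j < N, k < N) (\int[sigma]_(t in `[- M, M]%classic) ((t : R) ^+ (j + k)))%:C.

Definition moment_vec (N : nat) : 'cV[R[i]]_N :=
  \col_(j < N)
    cintegral sigma `[- M, M]%classic (fun t => ((t : R) ^+ j)%:C * expi (t : R)).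

End best_approximation.

(* Main.v *)
(** Write [exp (i (phi + psi + \sum_l X_l Y_l)) = exp (i (phi0 + psi0 + theta0)) * exp (i u)]
    with [u = theta - theta0].  Replacing [exp (i u)] by [P u] with [deg P < N] produces a
    kernel which, after multinomial expansion of the powers of [theta], is a sum of products of
    elements of U_N and V_N, so the resulting operator has rank at most [d_N].  The error is an
    integral operator, its Hilbert-Schmidt norm is the L^2 norm of its kernel, and since
    [|kernel of K| = |H|] the latter is the L^2(sigma) distance from exp(it) to [P]; Taylor's
    polynomial gives the explicit bound.  The optimal [P] solves a finite least squares problem
    whose normal equations have Gram matrix [G].

    The singular value and [Lambda] bounds use one principle: among [d_N + 1] functions some
    nontrivial combination [f] satisfies [K_N f = 0], hence [|K f| <= E_N |f|].  Taking singular
    vectors gives the first bound.  Taking [f] in the range of the spectral projection gives the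
    second without any spectral theorem: [|K f|^2 = \int t dm(t)], where [m] has mass [|f|^2]
    carried by [t > eps], would exceed [eps |f|^2]. *)

Require Import Defs.
From HB Require Import structures.
From mathcomp Require Import all_boot all_order all_algebra.
From mathcomp Require Import spectral.
From mathcomp Require Import complex.
From mathcomp Require Import all_classical all_reals all_analysis.
From mathcomp Require Import ess_sup_inf.
From mathcomp Require Import measurable_realfun.
From mathcomp Require Import ring lra.

Set Implicit Arguments.
Unset Strict Implicit.
Unset Printing Implicit Defensive.

Import Order.TTheory GRing.Theory Num.Theory.
Import numFieldNormedType.Exports.

Local Open Scope classical_set_scope.
Local Open Scope complex_scope.
Local Open Scope ring_scope.

(** * Complex-valued functions and square-integrable functions *)

(** No separability is assumed, so orthonormal bases may be uncountable: they come from Zorn's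
    lemma, and Parseval's identity is approached through finite subfamilies and the completeness of
    L^2. In the equality of Hilbert-Schmidt norm and kernel norm, Bessel's inequality gives one
    half. The other half needs one finite subfamily that serves all sections of the kernel at once.
    It exists as soon as the kernel is L^2-close to a finite sum of products g(x)h(y), because only
    the finitely many factors g have to be projected. Such sums are at hand: putting a Taylor
    polynomial in place of exp(iu) makes the error kernel separated. The sections of the kernels in
    use are square integrable at every point, not just almost everywhere, so linearity, kernel
    identities and Fubini can be used pointwise. In the rank bound, dim V_N comes from the range;
    dim U_N comes from row rank = column rank for a matrix of pairings. Adjoints and spectral
    projections are defined by choice. The adjoint is exhibited through its kernel; the case of no
    spectral measure is treated separately, the projection then being 0. *)

Section modulus.
Context {R : realType}.
Implicit Types (z w : R[i]) (t : R).

Lemma ReD z w : complex.Re (z + w) = complex.Re z + complex.Re w.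
Proof. by case: z w => [? ?] [? ?]. Qed.

Lemma ImD z w : complex.Im (z + w) = complex.Im z + complex.Im w.
Proof. by case: z w => [? ?] [? ?]. Qed.

Lemma ReM z w :
  complex.Re (z * w) = complex.Re z * complex.Re w - complex.Im z * complex.Im w.
Proof. by case: z w => [? ?] [? ?]. Qed.

Lemma ImM z w :
  complex.Im (z * w) = complex.Re z * complex.Im w + complex.Im z * complex.Re w.
Proof. by case: z w => [? ?] [? ?]. Qed.

Lemma Re_conjc z : complex.Re (conjc z) = complex.Re z.
Proof. by case: z. Qed.

Lemma Im_conjc z : complex.Im (conjc z) = - complex.Im z.
Proof. by case: z. Qed.

Lemma cabsE z : cabs z = Num.sqrt (complex.Re z ^+ 2 + complex.Im z ^+ 2).
Proof. by rewrite /cabs normc_def. Qed.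

Lemma cabs_sqr z : cabs z ^+ 2 = complex.Re z ^+ 2 + complex.Im z ^+ 2.
Proof. by rewrite cabsE sqr_sqrtr// addr_ge0 ?sqr_ge0. Qed.

Lemma cabs_ge0 z : 0 <= cabs z.
Proof. by rewrite cabsE sqrtr_ge0. Qed.

Lemma cabsM z w : cabs (z * w) = cabs z * cabs w.
Proof.
apply/eqP; rewrite -(@eqrXn2 _ 2)// ?cabs_ge0 ?mulr_ge0 ?cabs_ge0//.
by rewrite exprMn !cabs_sqr ReM ImM; apply/eqP; ring.
Qed.

Lemma cabs_conjc z : cabs (conjc z) = cabs z.
Proof. by rewrite !cabsE Re_conjc Im_conjc sqrrN. Qed.

Lemma cabs0 : cabs (0 : R[i]) = 0.
Proof. by rewrite cabsE/= expr0n/= addr0 sqrtr0. Qed.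

Lemma cabs_real t : cabs t%:C = `|t|.
Proof. by rewrite cabsE/= expr0n/= addr0 sqrtr_sqr. Qed.

Lemma cabs_eq0 z : (cabs z == 0) = (z == 0).
Proof.
rewrite -sqrf_eq0 cabs_sqr paddr_eq0 ?sqr_ge0// !sqrf_eq0.
by rewrite eq_complex.
Qed.

Lemma cabs_expi t : cabs (expi t) = 1.
Proof. by rewrite cabsE/= cos2Dsin2 sqrtr1. Qed.

Lemma expiD s t : expi (s + t) = expi s * expi t.
Proof.
by apply/eqP; rewrite eq_complex ReM ImM/= cosD sinD; apply/andP; split;
  apply/eqP; ring.
Qed.

Lemma mulc_conjc z : z * conjc z = (cabs z ^+ 2)%:C.
Proof.
rewrite cabs_sqr; apply/eqP; rewrite eq_complex ReM ImM Re_conjc Im_conjc/=.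
by apply/andP; split; apply/eqP; ring.
Qed.

Lemma cabsN z : cabs (- z) = cabs z.
Proof. by rewrite -mulN1r cabsM !cabsE/= oppr0 expr0n addr0 sqrrN expr1n sqrtr1 mul1r. Qed.

Lemma cabs_sqr_le2 z w : cabs (z + w) ^+ 2 <= 2 * cabs z ^+ 2 + 2 * cabs w ^+ 2.
Proof.
rewrite !cabs_sqr ReD ImD.
have := sqr_ge0 (complex.Re z - complex.Re w).
have := sqr_ge0 (complex.Im z - complex.Im w); nra.
Qed.

Lemma cabsM_le z w : cabs (z * w) <= cabs z ^+ 2 + cabs w ^+ 2.
Proof. rewrite cabsM; have := cabs_ge0 z; have := cabs_ge0 w; nra. Qed.

Lemma Re_le_cabs z : `|complex.Re z| <= cabs z.
Proof.
rewrite -(@ler_pXn2r _ 2)// ?nnegrE ?cabs_ge0//.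
by rewrite cabs_sqr -normrX ger0_norm ?sqr_ge0// lerDl sqr_ge0.
Qed.

Lemma Im_le_cabs z : `|complex.Im z| <= cabs z.
Proof.
rewrite -(@ler_pXn2r _ 2)// ?nnegrE ?cabs_ge0//.
by rewrite cabs_sqr -normrX ger0_norm ?sqr_ge0// lerDr sqr_ge0.
Qed.

Lemma cabsD z w : cabs (z + w) <= cabs z + cabs w.
Proof.
by have := ler_normD z w; rewrite !normc_def -!cabsE -raddfD/= lecR.
Qed.

Lemma cabs_sum I (s : seq I) (P : pred I) (F : I -> R[i]) :
  cabs (\sum_(i <- s | P i) F i) <= \sum_(i <- s | P i) cabs (F i).
Proof.
elim/big_ind2 : _ => [|z a w b za wb|//]; first by rewrite cabs0.
by rewrite (le_trans (cabsD _ _))// lerD.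
Qed.

Lemma Re_sum I (s : seq I) (P : pred I) (F : I -> R[i]) :
  complex.Re (\sum_(i <- s | P i) F i) = \sum_(i <- s | P i) complex.Re (F i).
Proof. by apply: (big_morph _ ReD). Qed.

End modulus.

(** * Measurability and integration of complex functions *)

Section cintegration.
Context d (T : measurableType d) (R : realType).
Implicit Types (f g : T -> R[i]) (D : set T) (c : R[i]).

Lemma cmeasurableD f g : cmeasurable f -> cmeasurable g ->
  cmeasurable (fun x => f x + g x).
Proof.
move=> [rf jf] [rg jg]; split.
  by under eq_fun do rewrite ReD; exact: measurable_funD.
by under eq_fun do rewrite ImD; exact: measurable_funD.
Qed.

Lemma cmeasurableM f g : cmeasurable f -> cmeasurable g ->
  cmeasurable (fun x => f x * g x).
Proof.
move=> [rf jf] [rg jg]; split.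
  under eq_fun do rewrite ReM.
  by apply: measurable_funB; exact: measurable_funM.
under eq_fun do rewrite ImM.
by apply: measurable_funD; exact: measurable_funM.
Qed.

Lemma cmeasurable_cst c : cmeasurable (fun _ : T => c).
Proof. by split; exact: measurable_cst. Qed.

Lemma cmeasurable_real (f : T -> R) : measurable_fun setT f ->
  cmeasurable (fun x => (f x)%:C).
Proof. by move=> mf; split => //=; exact: measurable_cst. Qed.

Lemma cmeasurable_conjc f : cmeasurable f -> cmeasurable (fun x => conjc (f x)).
Proof.
move=> [rf jf]; split; first by under eq_fun do rewrite Re_conjc.
by under eq_fun do rewrite Im_conjc; exact: measurableT_comp.
Qed.

Lemma cmeasurable_expi (f : T -> R) : measurable_fun setT f ->
  cmeasurable (fun x => expi (f x)).
Proof.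
move=> mf; split => /=; (apply: measurableT_comp => //);
  apply: continuous_measurable_fun; [exact: continuous_cos|exact: continuous_sin].
Qed.

Lemma cmeasurable_sum I (s : seq I) (F : I -> T -> R[i]) :
  (forall i, cmeasurable (F i)) -> cmeasurable (fun x => \sum_(i <- s) F i x).
Proof.
move=> mF; elim: s => [|i s ih].
  by under eq_fun do rewrite big_nil; exact: cmeasurable_cst.
by under eq_fun do rewrite big_cons; exact: cmeasurableD.
Qed.

Lemma cmeasurable_comp d' (T' : measurableType d') (h : T' -> T) f :
  measurable_fun setT h -> cmeasurable f -> cmeasurable (fun x => f (h x)).
Proof. by move=> mh [rf jf]; split; [exact: (measurableT_comp rf mh)|exact: (measurableT_comp jf mh)]. Qed.

Lemma measurable_cabs_sqr f : cmeasurable f ->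
  measurable_fun setT (fun x => cabs (f x) ^+ 2).
Proof.
move=> [rf jf]; under eq_fun do rewrite cabs_sqr.
by apply: measurable_funD; apply: measurable_funX.
Qed.

Definition cintegrable (mu : {measure set T -> \bar R}) D f :=
  mu.-integrable D (fun x => (complex.Re (f x))%:E) /\
  mu.-integrable D (fun x => (complex.Im (f x))%:E).

Variable mu : {measure set T -> \bar R}.

Lemma cintegrableD D f g : measurable D -> cintegrable mu D f ->
  cintegrable mu D g -> cintegrable mu D (fun x => f x + g x).
Proof.
move=> mD [rf jf] [rg jg]; split.
  by under eq_fun do rewrite ReD EFinD; exact: integrableD.
by under eq_fun do rewrite ImD EFinD; exact: integrableD.
Qed.

Lemma cintegrableZ D c f : measurable D -> cintegrable mu D f ->
  cintegrable mu D (fun x => c * f x).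
Proof.
move=> mD [rf jf]; split.
  under eq_fun do rewrite ReM EFinB !EFinM.
  by apply: integrableB => //; exact: integrableZl.
under eq_fun do rewrite ImM EFinD !EFinM.
by apply: integrableD => //; exact: integrableZl.
Qed.

Lemma cintegrable_conjc D f : measurable D -> cintegrable mu D f ->
  cintegrable mu D (fun x => conjc (f x)).
Proof.
move=> mD [rf jf]; split; first by under eq_fun do rewrite Re_conjc.
under eq_fun do rewrite Im_conjc EFinN.
exact: integrableN.
Qed.

Lemma cintegrable_sum D I (s : seq I) (F : I -> T -> R[i]) : measurable D ->
  (forall i, cintegrable mu D (F i)) ->
  cintegrable mu D (fun x => \sum_(i <- s) F i x).
Proof.
move=> mD iF; elim: s => [|i s ih].
  under eq_fun do rewrite big_nil.
  by split; exact: integrable0.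
by under eq_fun do rewrite big_cons; exact: cintegrableD.
Qed.

Lemma cintegralD D f g : measurable D -> cintegrable mu D f ->
  cintegrable mu D g ->
  cintegral mu D (fun x => f x + g x) = cintegral mu D f + cintegral mu D g.
Proof.
move=> mD [rf jf] [rg jg]; rewrite /cintegral; apply/eqP.
rewrite eq_complex/= -!RintegralD//; apply/andP; split; apply/eqP;
  apply: eq_Rintegral => x _; [exact: ReD|exact: ImD].
Qed.

Lemma cintegralZ D c f : measurable D -> cintegrable mu D f ->
  cintegral mu D (fun x => c * f x) = c * cintegral mu D f.
Proof.
move=> mD [rf jf]; rewrite /cintegral; apply/eqP.
have rZ k : mu.-integrable D (EFin \o (fun x => k * complex.Re (f x))).
  exact: (integrableZl mD k rf).
have jZ k : mu.-integrable D (EFin \o (fun x => k * complex.Im (f x))).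
  exact: (integrableZl mD k jf).
rewrite eq_complex ReM ImM/= -!RintegralZl// -RintegralB// -RintegralD//.
apply/andP; split; apply/eqP; apply: eq_Rintegral => x _.
  exact: ReM.
exact: ImM.
Qed.

Lemma cintegral_conjc D f : measurable D -> cintegrable mu D f ->
  cintegral mu D (fun x => conjc (f x)) = conjc (cintegral mu D f).
Proof.
move=> mD [rf jf]; rewrite /cintegral; apply/eqP; rewrite eq_complex/=.
apply/andP; split; apply/eqP.
  by apply: eq_Rintegral => x _; exact: Re_conjc.
rewrite -mulN1r -RintegralZl//; apply: eq_Rintegral => x _.
by rewrite Im_conjc mulN1r.
Qed.

Lemma cintegral0 D : cintegral mu D (fun _ => 0) = 0.
Proof. by rewrite /cintegral /Rintegral/= integral0. Qed.

Lemma cintegral_sum D I (s : seq I) (F : I -> T -> R[i]) : measurable D ->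
  (forall i, cintegrable mu D (F i)) ->
  cintegral mu D (fun x => \sum_(i <- s) F i x) =
  \sum_(i <- s) cintegral mu D (F i).
Proof.
move=> mD iF; elim: s => [|i s ih].
  by rewrite big_nil; under eq_fun do rewrite big_nil; exact: cintegral0.
rewrite big_cons -ih -cintegralD//; last exact: cintegrable_sum.
by under eq_fun do rewrite big_cons.
Qed.

Lemma eq_cintegral D f g : (forall x, D x -> f x = g x) ->
  cintegral mu D f = cintegral mu D g.
Proof.
move=> fg; rewrite /cintegral; congr (_ +i* _);
  by apply: eq_Rintegral => x /set_mem Dx; rewrite fg.
Qed.

Lemma ae_eq_cintegral f g : cmeasurable f -> cmeasurable g ->
  f = g %[ae mu] -> cintegral mu setT f = cintegral mu setT g.
Proof.
move=> [rf jf] [rg jg] fg; rewrite /cintegral /Rintegral.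
congr (fine _ +i* fine _); apply: ae_eq_integral => //;
  try exact/measurable_EFinP; by apply: filterS fg => x /= fgx _; rewrite fgx.
Qed.

Lemma cintegrable_le D f (g : T -> R) : measurable D -> cmeasurable f ->
  mu.-integrable D (EFin \o g) -> (forall x, D x -> cabs (f x) <= g x) ->
  cintegrable mu D f.
Proof.
move=> mD [rf jf] ig fg.
split; (apply: (le_integrable mD _ _ ig);
  [by apply/measurable_EFinP; exact: measurable_funS (measurableT) _ _|]) => x Dx;
  rewrite /= lee_fin (le_trans _ (ler_norm _))// (le_trans _ (fg _ Dx))//.
  exact: Re_le_cabs.
exact: Im_le_cabs.
Qed.

Lemma cintegral_real D (f : T -> R) :
  cintegral mu D (fun x => (f x)%:C) = (\int[mu]_(x in D) f x)%:C.
Proof. by rewrite /cintegral/=; congr (_ +i* _); rewrite /Rintegral integral0. Qed.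

End cintegration.
Lemma conjcD (R : realType) (z w : R[i]) : conjc (z + w) = conjc z + conjc w.
Proof. by rewrite rmorphD. Qed.

Lemma conjcM (R : realType) (z w : R[i]) : conjc (z * w) = conjc z * conjc w.
Proof. by rewrite rmorphM. Qed.

Lemma conjcN (R : realType) (z : R[i]) : conjc (- z) = - conjc z.
Proof. by rewrite rmorphN. Qed.

(** * Inner product, Bessel and Cauchy-Schwarz *)

Section L2_inner.
Context d (T : measurableType d) (R : realType) (mu : {measure set T -> \bar R}).
Implicit Types (f g h : T -> R[i]) (c : R[i]).

Lemma ge0_integralZ_EFin (k : R) (f : T -> R) : 0 <= k ->
  measurable_fun setT f -> (forall x, 0 <= f x) ->
  (\int[mu]_x (k * f x)%:E = k%:E * \int[mu]_x (f x)%:E)%E.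
Proof.
move=> k0 mf f0; under eq_integral do rewrite EFinM.
by rewrite ge0_integralZl//; [exact/measurable_EFinP|move=> x _; rewrite lee_fin].
Qed.

Lemma ge0_integralD_EFin (f g : T -> R) :
  measurable_fun setT f -> (forall x, 0 <= f x) ->
  measurable_fun setT g -> (forall x, 0 <= g x) ->
  (\int[mu]_x (f x + g x)%:E = \int[mu]_x (f x)%:E + \int[mu]_x (g x)%:E)%E.
Proof.
move=> mf f0 mg g0; under eq_integral do rewrite EFinD.
rewrite ge0_integralD//; try exact/measurable_EFinP;
  by move=> x _; rewrite lee_fin.
Qed.

Lemma ge0_integral_sum_EFin I (s : seq I) (F : I -> T -> R) :
  (forall i, measurable_fun setT (F i)) -> (forall i x, 0 <= F i x) ->
  (\int[mu]_x (\sum_(i <- s) F i x)%:E = \sum_(i <- s) \int[mu]_x (F i x)%:E)%E.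
Proof.
move=> mF F0; under eq_integral do rewrite -sumEFin.
rewrite ge0_integral_sum//; first by move=> i; exact/measurable_EFinP.
by move=> i x _; rewrite lee_fin.
Qed.

(** The squared norm comes in two forms: [nsq] is meaningful for every measurable function and suits
    Tonelli, while [rsq] is its finite part, a real number to which [ring] and [lra] apply. They
    agree on [L2]; where [nsq] is infinite, [rsq] takes the default value 0. *)
Definition nsq f : \bar R := (\int[mu]_x (cabs (f x) ^+ 2)%:E)%E.
Definition rsq f : R := fine (nsq f).

Lemma nsq_ge0 f : (0 <= nsq f)%E.
Proof. by apply: integral_ge0 => x _; rewrite lee_fin sqr_ge0. Qed.

Lemma rsq_ge0 f : 0 <= rsq f.
Proof. by rewrite fine_ge0 ?nsq_ge0. Qed.

Lemma L2normE f : L2norm mu f = (nsq f `^ 2^-1)%E.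
Proof.
rewrite /L2norm unlock; congr (_ `^ _)%E; apply: eq_integral => x _.
by rewrite gee0_abs ?lee_fin ?cabs_ge0// poweR_EFin powR_mulrn ?cabs_ge0.
Qed.

Lemma L2norm_lty f : (L2norm mu f < +oo)%E = (nsq f < +oo)%E.
Proof.
rewrite L2normE; have := nsq_ge0 f; case: (nsq f) => [r| |]//= r0.
  by rewrite !ltry.
by rewrite invr_eq0 pnatr_eq0.
Qed.

Lemma L2P f : L2 mu f <-> cmeasurable f /\ (nsq f < +oo)%E.
Proof. by rewrite /L2 L2norm_lty. Qed.

Lemma L2_meas f : L2 mu f -> cmeasurable f.
Proof. by case. Qed.

Lemma L2_nsq f : L2 mu f -> nsq f = (rsq f)%:E.
Proof. by move=> /L2P[_ fy]; rewrite fineK// ge0_fin_numE// nsq_ge0. Qed.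

Lemma measurable_nsq f : cmeasurable f ->
  measurable_fun setT (fun x => (cabs (f x) ^+ 2)%:E).
Proof. by move=> mf; apply/measurable_EFinP; exact: measurable_cabs_sqr. Qed.

Lemma integrable_nsq f : L2 mu f ->
  mu.-integrable setT (fun x => (cabs (f x) ^+ 2)%:E).
Proof.
move=> /L2P[mf fy]; apply/integrableP; split; first exact: measurable_nsq.
by under eq_integral do rewrite gee0_abs ?lee_fin ?sqr_ge0//.
Qed.

Lemma le_nsq f g : cmeasurable f -> cmeasurable g ->
  {ae mu, forall x, cabs (f x) <= cabs (g x)} -> (nsq f <= nsq g)%E.
Proof.
move=> mf mg fg; apply: ae_ge0_le_integral => //.
- by move=> x _; rewrite lee_fin sqr_ge0.
- exact: measurable_nsq.
- by move=> x _; rewrite lee_fin sqr_ge0.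
- exact: measurable_nsq.
- by apply: filterS fg => x /= fgx _; rewrite lee_fin lerXn2r ?nnegrE ?cabs_ge0.
Qed.

Lemma L2_le f g : cmeasurable f -> L2 mu g ->
  {ae mu, forall x, cabs (f x) <= cabs (g x)} -> L2 mu f.
Proof.
move=> mf /L2P[mg gy] fg; apply/L2P; split=> //.
exact: le_lt_trans (le_nsq mf mg fg) gy.
Qed.

Lemma ae_eq_nsq f g : cmeasurable f -> cmeasurable g -> f = g %[ae mu] ->
  nsq f = nsq g.
Proof.
move=> mf mg fg; apply/eqP; rewrite eq_le; apply/andP; split;
  by apply: le_nsq => //; apply: filterS fg => x /= ->.
Qed.

Lemma nsqZ c f : cmeasurable f ->
  nsq (fun x => c * f x) = ((cabs c ^+ 2)%:E * nsq f)%E.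
Proof.
move=> mf; rewrite /nsq -ge0_integralZ_EFin ?sqr_ge0//.
- by apply: eq_integral => x _; rewrite cabsM exprMn.
- exact: measurable_cabs_sqr.
- by move=> x; exact: sqr_ge0.
Qed.

Lemma rsqZ c f : cmeasurable f -> rsq (fun x => c * f x) = cabs c ^+ 2 * rsq f.
Proof.
move=> mf; rewrite /rsq nsqZ//; have := nsq_ge0 f.
case: (nsq f) => [r| |]//= _; have [->|c0] := eqVneq (cabs c ^+ 2) 0.
  by rewrite mul0e/= mulr0.
by rewrite gt0_muley ?mulr0// lte_fin lt_def c0 sqr_ge0.
Qed.

Lemma nsq_conjc f : nsq (fun x => conjc (f x)) = nsq f.
Proof. by apply: eq_integral => x _; rewrite cabs_conjc. Qed.

Lemma nsqD_le f g : cmeasurable f -> cmeasurable g ->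
  (nsq (fun x => f x + g x)%R <= 2%:E * nsq f + 2%:E * nsq g)%E.
Proof.
move=> mf mg; have mf2 := measurable_cabs_sqr mf.
have mg2 := measurable_cabs_sqr mg.
have c0 h x : 0 <= 2 * cabs (h x) ^+ 2 :> R by rewrite mulr_ge0 ?sqr_ge0.
have mc h : measurable_fun setT (fun x : T => cabs (h x) ^+ 2) ->
    measurable_fun setT (fun x : T => 2 * cabs (h x) ^+ 2 : R).
  by move=> mh; exact: measurable_funM.
rewrite /nsq -!ge0_integralZ_EFin//; try by move=> x; exact: sqr_ge0.
rewrite -ge0_integralD_EFin//; try exact: mc; try exact: c0.
apply: ge0_le_integral => //.
- by move=> x _; rewrite lee_fin sqr_ge0.
- by apply: measurable_nsq; exact: cmeasurableD.
- by apply/measurable_EFinP; apply: measurable_funD; exact: mc.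
- by move=> x _; rewrite lee_fin cabs_sqr_le2.
Qed.

Lemma L20 : L2 mu (fun _ => 0).
Proof.
apply/L2P; split; first exact: cmeasurable_cst.
by rewrite /nsq; under eq_integral do rewrite cabs0 expr0n/=; rewrite integral0.
Qed.

Lemma L2Z c f : L2 mu f -> L2 mu (fun x => c * f x).
Proof.
move=> /[dup] L2f /L2P[mf fy]; apply/L2P; split.
  by apply: cmeasurableM => //; exact: cmeasurable_cst.
by rewrite nsqZ// L2_nsq// -EFinM ltry.
Qed.

Lemma L2D f g : L2 mu f -> L2 mu g -> L2 mu (fun x => f x + g x).
Proof.
move=> /[dup] L2f /L2P[mf fy] /[dup] L2g /L2P[mg gy].
apply/L2P; split; first exact: cmeasurableD.
apply: (le_lt_trans (nsqD_le mf mg)).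
by rewrite !L2_nsq// -!EFinM -EFinD ltry.
Qed.

Lemma L2B f g : L2 mu f -> L2 mu g -> L2 mu (fun x => f x - g x).
Proof.
move=> L2f L2g; have := L2D L2f (L2Z (-1) L2g).
by under eq_fun do rewrite mulN1r.
Qed.

Lemma L2_conjc f : L2 mu f -> L2 mu (fun x => conjc (f x)).
Proof.
move=> /L2P[mf fy]; apply/L2P; split; first exact: cmeasurable_conjc.
by rewrite nsq_conjc.
Qed.

Lemma L2_sum I (s : seq I) (F : I -> T -> R[i]) : (forall i, L2 mu (F i)) ->
  L2 mu (fun x => \sum_(i <- s) F i x).
Proof.
move=> L2F; elim: s => [|i s ih].
  by under eq_fun do rewrite big_nil; exact: L20.
by under eq_fun do rewrite big_cons; exact: L2D.
Qed.

Lemma L2M_integrable f g : L2 mu f -> L2 mu g ->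
  cintegrable mu setT (fun x => f x * g x).
Proof.
move=> L2f L2g.
apply: (@cintegrable_le _ _ _ mu setT _ (fun x => cabs (f x) ^+ 2 + cabs (g x) ^+ 2)) => //.
- exact: cmeasurableM (L2_meas _) (L2_meas _).
- exact: (integrableD measurableT (integrable_nsq L2f) (integrable_nsq L2g)).
- by move=> x _; exact: cabsM_le.
Qed.

Lemma L2inner_integrable f g : L2 mu f -> L2 mu g ->
  cintegrable mu setT (fun x => f x * conjc (g x)).
Proof. by move=> L2f L2g; apply: L2M_integrable => //; exact: L2_conjc. Qed.

Lemma inner_conj f g : L2 mu f -> L2 mu g ->
  L2inner mu g f = conjc (L2inner mu f g).
Proof.
move=> L2f L2g; rewrite /L2inner -cintegral_conjc//; last exact: L2inner_integrable.
by apply: eq_cintegral => x _; rewrite rmorphM/= conjcK mulrC.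
Qed.

Lemma innerDl f g h : L2 mu f -> L2 mu g -> L2 mu h ->
  L2inner mu (fun x => f x + g x) h = L2inner mu f h + L2inner mu g h.
Proof.
move=> L2f L2g L2h; rewrite /L2inner -cintegralD//; try exact: L2inner_integrable.
by apply: eq_cintegral => x _; rewrite mulrDl.
Qed.

Lemma innerZl c f h : L2 mu f -> L2 mu h ->
  L2inner mu (fun x => c * f x) h = c * L2inner mu f h.
Proof.
move=> L2f L2h; rewrite /L2inner -cintegralZ//; last exact: L2inner_integrable.
by apply: eq_cintegral => x _; rewrite mulrA.
Qed.

Lemma innerDr f g h : L2 mu f -> L2 mu g -> L2 mu h ->
  L2inner mu h (fun x => f x + g x) = L2inner mu h f + L2inner mu h g.
Proof.
move=> L2f L2g L2h; rewrite inner_conj//; last exact: L2D.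
by rewrite innerDl// conjcD -!inner_conj.
Qed.

Lemma innerZr c f h : L2 mu f -> L2 mu h ->
  L2inner mu h (fun x => c * f x) = conjc c * L2inner mu h f.
Proof.
move=> L2f L2h; rewrite inner_conj//; last exact: L2Z.
by rewrite innerZl// conjcM -inner_conj.
Qed.

Lemma innerBl f g h : L2 mu f -> L2 mu g -> L2 mu h ->
  L2inner mu (fun x => f x - g x) h = L2inner mu f h - L2inner mu g h.
Proof.
move=> L2f L2g L2h; under eq_fun do rewrite -[g _]mul1r -mulNr.
by rewrite innerDl ?innerZl ?mulN1r//; exact: L2Z.
Qed.

Lemma inner_suml I (s : seq I) (F : I -> T -> R[i]) h :
  (forall i, L2 mu (F i)) -> L2 mu h ->
  L2inner mu (fun x => \sum_(i <- s) F i x) h = \sum_(i <- s) L2inner mu (F i) h.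
Proof.
move=> L2F L2h; rewrite /L2inner -cintegral_sum//; last first.
  by move=> i; exact: L2inner_integrable.
by apply: eq_cintegral => x _; rewrite mulr_suml.
Qed.

Lemma inner_self f : L2inner mu f f = (rsq f)%:C.
Proof.
rewrite /L2inner /rsq /nsq -[fine _]/(Rintegral _ _ _) -cintegral_real.
by apply: eq_cintegral => x _; rewrite mulc_conjc.
Qed.

Lemma rsqE f : rsq f = complex.Re (L2inner mu f f).
Proof. by rewrite inner_self. Qed.

Lemma ae_eq_innerl f g h : cmeasurable f -> cmeasurable g -> cmeasurable h ->
  f = g %[ae mu] -> L2inner mu f h = L2inner mu g h.
Proof.
move=> mf mg mh fg; apply: ae_eq_cintegral.
- by apply: cmeasurableM => //; exact: cmeasurable_conjc.
- by apply: cmeasurableM => //; exact: cmeasurable_conjc.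
- by apply: filterS fg => x /= ->.
Qed.

Lemma nsq_eq0 f : cmeasurable f -> nsq f = 0%E <-> f = cst 0 %[ae mu].
Proof.
move=> mf; split=> [f0|f0]; last first.
  rewrite (@ae_eq_nsq f (cst 0) mf _ f0); last exact: cmeasurable_cst.
  by rewrite /nsq; under eq_integral do rewrite cabs0 expr0n/=; rewrite integral0.
have : (\int[mu]_x `|(cabs (f x) ^+ 2)%:E| = 0)%E.
  by under eq_integral do rewrite gee0_abs ?lee_fin ?sqr_ge0//.
move/ae_eq_integral_abs => /(_ measurableT (measurable_nsq mf)).
apply: filterS => x /= /(_ I) /eqP; rewrite eqe sqrf_eq0 cabs_eq0.
by move=> /eqP ->.
Qed.

(** Completing the square: along the line spanned by a unit vector the distance to [f] is least at
    the Fourier coefficient. Bessel and Cauchy-Schwarz both follow from it. *)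
Lemma rsq_sub_unit f e c : L2 mu f -> L2 mu e -> L2inner mu e e = 1 ->
  rsq (fun x => f x - c * e x) =
  rsq f - cabs (L2inner mu f e) ^+ 2 + cabs (c - L2inner mu f e) ^+ 2.
Proof.
move=> L2f L2e e1; apply: complexI; rewrite -inner_self.
under eq_fun do rewrite -mulNr.
have L2ce := L2Z (- c) L2e.
rewrite innerDl// ?innerDr// ?innerZl ?innerZr//; try exact: L2D.
rewrite (inner_conj L2f L2e) e1 inner_self; set a := L2inner mu f e.
have RD (s t : R) : (s + t)%:C = s%:C + t%:C by rewrite rmorphD.
have RB (s t : R) : (s - t)%:C = s%:C - t%:C by rewrite rmorphB.
by rewrite RD RB -!mulc_conjc conjcD !conjcN; ring.
Qed.

(** The coefficients [c] are arbitrary, so this also says that the Fourier projection is the best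
    approximation, with the exact price of any other choice. The induction removes one vector at a
    time: subtracting a multiple of [e i] leaves the other Fourier coefficients unchanged. *)
Lemma bessel_identity (I : eqType) (s : seq I) (e : I -> T -> R[i])
    (c : I -> R[i]) f :
  uniq s -> L2 mu f -> (forall i, i \in s -> L2 mu (e i)) ->
  (forall i j, i \in s -> j \in s -> L2inner mu (e i) (e j) = (i == j)%:R) ->
  rsq (fun x => f x - \sum_(i <- s) c i * e i x) =
  rsq f - \sum_(i <- s) cabs (L2inner mu f (e i)) ^+ 2 +
  \sum_(i <- s) cabs (c i - L2inner mu f (e i)) ^+ 2.
Proof.
elim: s f => [f _ L2f _ _|i s ih f /= /andP[si us] L2f L2e oe].
  rewrite !big_nil subr0 addr0; congr rsq; apply/funext => x.
  by rewrite big_nil subr0.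
have L2ei : L2 mu (e i) by apply: L2e; rewrite inE eqxx.
have se j : j \in s -> j \in i :: s by rewrite inE orbC => ->.
have -> : (fun x => f x - \sum_(j <- i :: s) c j * e j x) =
    (fun x => (f x - c i * e i x) - \sum_(j <- s) c j * e j x).
  by apply/funext => x; rewrite big_cons opprD addrA.
have L2fi : L2 mu (fun x => f x - c i * e i x) by apply: L2B => //; exact: L2Z.
rewrite ih//; last 2 first.
- by move=> j js; exact: L2e (se _ js).
- by move=> j k js ks; apply: oe; exact: se.
rewrite rsq_sub_unit//; last by rewrite oe ?inE ?eqxx.
have inE' j : j \in s ->
    L2inner mu (fun x => f x - c i * e i x) (e j) = L2inner mu f (e j).
  move=> js; rewrite innerBl ?innerZl//; try exact: L2Z; try exact: L2e (se _ js).
  rewrite oe ?inE ?eqxx//; last by rewrite js orbT.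
  by rewrite (_ : i == j = false) ?mulr0 ?subr0//; apply: contraNF si => /eqP ->.
rewrite !big_cons.
under [X in _ - X + _]eq_big_seq => j js do rewrite (inE' _ js).
under [X in _ + X = _]eq_big_seq => j js do rewrite (inE' _ js).
by ring.
Qed.

Lemma bessel_projection (I : eqType) (s : seq I) (e : I -> T -> R[i]) f :
  uniq s -> L2 mu f -> (forall i, i \in s -> L2 mu (e i)) ->
  (forall i j, i \in s -> j \in s -> L2inner mu (e i) (e j) = (i == j)%:R) ->
  rsq (fun x => f x - \sum_(i <- s) L2inner mu f (e i) * e i x) =
  rsq f - \sum_(i <- s) cabs (L2inner mu f (e i)) ^+ 2.
Proof.
move=> us L2f L2e oe; rewrite bessel_identity//.
rewrite [X in _ + X]big1 ?addr0// => i _.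
by rewrite subrr cabs0 expr0n.
Qed.

Lemma bessel_inequality (I : eqType) (s : seq I) (e : I -> T -> R[i]) f :
  uniq s -> L2 mu f -> (forall i, i \in s -> L2 mu (e i)) ->
  (forall i j, i \in s -> j \in s -> L2inner mu (e i) (e j) = (i == j)%:R) ->
  \sum_(i <- s) cabs (L2inner mu f (e i)) ^+ 2 <= rsq f.
Proof.
by move=> us L2f L2e oe; rewrite -subr_ge0 -bessel_projection// rsq_ge0.
Qed.

(** After normalising [g], the inequality is the nonnegativity of the residual in [rsq_sub_unit]. A
    [g] of norm 0 cannot be normalised, but it is null and its inner products vanish. *)
Lemma cauchy_schwarz f g : L2 mu f -> L2 mu g ->
  cabs (L2inner mu f g) ^+ 2 <= rsq f * rsq g.
Proof.
move=> L2f L2g; have [g0|g0] := eqVneq (rsq g) 0.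
  have : g = cst 0 %[ae mu].
    by apply/nsq_eq0; [exact: L2_meas|rewrite L2_nsq// g0].
  move=> gz; rewrite inner_conj// (ae_eq_innerl _ _ _ gz) ?cabs_conjc//;
    try exact: L2_meas; try exact: cmeasurable_cst.
  rewrite /L2inner; under eq_fun do rewrite mul0r.
  by rewrite cintegral0 cabs0 expr0n/= mulr_ge0 ?rsq_ge0.
have gp : 0 < rsq g by rewrite lt_def g0 rsq_ge0.
pose s := Num.sqrt (rsq g); have sp : 0 < s by rewrite sqrtr_gt0.
have s2 : s ^+ 2 = rsq g by rewrite sqr_sqrtr// ltW.
have L2e : L2 mu (fun x => (s^-1)%:C * g x) by exact: L2Z.
have := rsq_sub_unit (L2inner mu f (fun x => (s^-1)%:C * g x)) L2f L2e.
rewrite subrr cabs0 expr0n/= addr0 => H.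
have := rsq_ge0 (fun x => f x - L2inner mu f (fun x => (s^-1)%:C * g x) *
  ((s^-1)%:C * g x)).
rewrite H ?subr_ge0; last first.
  rewrite innerZl// innerZr// inner_self conjc_real -!rmorphM/= -s2.
  by rewrite expr2 mulKf ?gt_eqF// mulVf ?gt_eqF.
rewrite innerZr// cabsM cabs_conjc cabs_real ger0_norm ?invr_ge0 ?(ltW sp)//.
by rewrite exprMn exprVn s2 mulrC ler_pdivrMr.
Qed.

End L2_inner.

(** * Completeness and orthonormal bases *)

Lemma ReB (R : realType) (z w : R[i]) :
  complex.Re (z - w) = complex.Re z - complex.Re w.
Proof. by case: z w => [? ?] [? ?]. Qed.

Lemma ImB (R : realType) (z w : R[i]) :
  complex.Im (z - w) = complex.Im z - complex.Im w.
Proof. by case: z w => [? ?] [? ?]. Qed.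

Lemma cmeasurableB d (T : measurableType d) (R : realType) (f g : T -> R[i]) :
  cmeasurable f -> cmeasurable g -> cmeasurable (fun x => f x - g x).
Proof.
move=> mf mg; under eq_fun do rewrite -mulN1r.
by apply: cmeasurableD => //; apply: cmeasurableM => //; exact: cmeasurable_cst.
Qed.

Section riesz_fischer.
Context d (T : measurableType d) (R : realType) (mu : {measure set T -> \bar R}).

Lemma cvg_half_pow (c : R) : (fun n => c * 2^-1 ^+ n) @ \oo --> (0 : R).
Proof.
rewrite -[X in _ --> X](mulr0 c); apply: cvgMr.
by apply: cvg_expr; rewrite ger0_norm ?invf_lt1 ?ltr1n// invr_ge0.
Qed.

Lemma fast_cauchy_cvg (u : nat -> R) (s : R) :
  (forall n m, (n <= m)%N -> (u m - u n) ^+ 2 <= s * 2^-1 ^+ n) ->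
  exists2 l, u @ \oo --> l & forall n, (l - u n) ^+ 2 <= s * 2^-1 ^+ n.
Proof.
move=> us.
have s2 := cvg_half_pow s.
have cu : cvgn u.
  apply/cauchy_cvgP/cauchy_exP => e e0.
  have e20 : 0 < e ^+ 2 by rewrite exprn_gt0.
  have [n _ /(_ n (leqnn n))/= sn] := cvgr_lt _ s2 _ e20.
  exists (u n); exists n => // m /= nm.
  rewrite /ball/= -(@ltr_pXn2r _ 2)// ?nnegrE ?ltW// -normrX ger0_norm ?sqr_ge0//.
  by rewrite -sqrrN opprB (le_lt_trans (us _ _ nm)).
exists (limn u) => // n.
have cd : (fun m => (u m - u n) ^+ 2) @ \oo --> (limn u - u n) ^+ 2.
  apply: (@cvgM _ _ (\oo) _ (fun m => u m - u n) (fun m => u m - u n));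
  by apply: cvgB => //; exact: cvg_cst.
by apply: (cvgr_to_le cd); exists n => // m /= nm; exact: us.
Qed.

(** Each step applies [cabs_sqr_le2] and costs a factor 2; the weights 2^k and the factor 2^(1-n)
    are exactly what absorbs these factors. *)
Lemma telescoping_sqr (z : nat -> R[i]) n m : (n <= m)%N ->
  cabs (z m - z n) ^+ 2 <=
  (\sum_(n <= k < m) 2 ^+ k * cabs (z k.+1 - z k) ^+ 2) * (2 * 2^-1 ^+ n).
Proof.
move=> nm; rewrite -(subnK nm); move: (m - n)%N => {nm m} m.
elim: m n => [n|m ih n].
  by rewrite add0n subrr cabs0 expr0n/= mulr_ge0 ?mulr_ge0 ?exprn_ge0 ?invr_ge0 ?sumr_ge0// =>
    k _; rewrite mulr_ge0 ?sqr_ge0 ?exprn_ge0.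
have -> : z (m.+1 + n)%N - z n = (z n.+1 - z n) + (z (m + n.+1)%N - z n.+1).
  by rewrite addSnnS [RHS]addrC addrA subrK.
rewrite (le_trans (cabs_sqr_le2 _ _))// big_ltn ?addSn ?ltnS ?leq_addl// -addnS [leRHS]mulrDl.
rewrite lerD//.
  rewrite [leRHS](_ : _ = (2 * 2^-1) ^+ n * (2 * cabs (z n.+1 - z n) ^+ 2)).
    by rewrite divff// expr1n mul1r.
  by rewrite exprMn; ring.
rewrite (le_trans (ler_wpM2l _ (ih n.+1)))// exprS.
set s := \sum_(_ <= k < _) _.
rewrite [leLHS](_ : _ = (2 * 2^-1) * (s * (2 * 2^-1 ^+ n))); last by ring.
by rewrite divff// mul1r.
Qed.

(* The pointwise bound [|h - g_n|^2 <= 2^(1-n) S] with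
   [S = sum_k 2^k |g_(k+1) - g_k|^2] replaces the usual appeal to Fatou. *)
Lemma riesz_fischer (g : nat -> T -> R[i]) :
  (forall n, L2 mu (g n)) ->
  (forall n, rsq mu (fun x => g n.+1 x - g n x) <= 4^-1 ^+ n) ->
  exists2 h, L2 mu h &
    forall n, rsq mu (fun x => h x - g n x) <= 8 * 2^-1 ^+ n.
Proof.
move=> L2g gn.
pose D k x : R := 2 ^+ k * cabs (g k.+1 x - g k x) ^+ 2.
have D0 k x : 0 <= D k x by rewrite mulr_ge0 ?sqr_ge0 ?exprn_ge0.
have L2d k : L2 mu (fun x => g k.+1 x - g k x) by exact: L2B.
have mD k : measurable_fun setT (D k).
  by apply: measurable_funM => //; exact/measurable_cabs_sqr/L2_meas/L2d.
pose S x : \bar R := (\sum_(0 <= k <oo) (D k x)%:E)%E.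
have S0 x : (0 <= S x)%E by apply: nneseries_ge0 => k _ _; rewrite lee_fin.
have mS : measurable_fun setT S.
  apply: ge0_emeasurable_sum => //; first by move=> k x _ _; rewrite lee_fin.
  by move=> k _; exact/measurable_EFinP.
(* The k-th term integrates to at most 2^k 4^-k = 2^-k, and these sum to 2. *)
have iS : (\int[mu]_x S x <= 2%:E)%E.
  rewrite /S integral_nneseries//; last 2 first.
  - by move=> k; exact/measurable_EFinP.
  - by move=> k x _; rewrite lee_fin.
  apply: lime_le.
    by apply: is_cvg_nneseries => k _ _; apply: integral_ge0 => x _; rewrite lee_fin.
  apply: nearW => n.
  rewrite (@le_trans _ _ (\sum_(0 <= k < n) ((2^-1 : R) ^+ k)%:E)%E)//.
    apply: lee_sum => k _.
    rewrite ge0_integralZ_EFin ?exprn_ge0//; last 2 first.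
    - exact/measurable_cabs_sqr/L2_meas/L2d.
    - by move=> x; exact: sqr_ge0.
    rewrite -/(nsq mu _) (L2_nsq (L2d k)) -EFinM lee_fin.
    rewrite (le_trans (ler_wpM2l _ (gn k)))// ?exprn_ge0// -exprMn.
    by rewrite (_ : 2 / 4 = 2^-1)//; field.
  rewrite sumEFin lee_fin.
  suff -> : \sum_(0 <= k < n) (2^-1 : R) ^+ k = 2 - 2 * 2^-1 ^+ n.
    by rewrite gerBl mulr_ge0// exprn_ge0// invr_ge0.
  elim: n => [|n ih]; first by rewrite big_geq// expr0 mulr1 subrr.
  by rewrite big_nat_recr//= ih exprS; field.
have Sfin : {ae mu, forall x, S x \is a fin_num}.
  have : mu.-integrable setT S.
    apply/integrableP; split => //.
    under eq_integral do rewrite gee0_abs//.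
    by rewrite (le_lt_trans iS)// ltry.
  by move=> /(integrable_ae measurableT); apply: filterS => x /(_ I).
have key x n m : S x \is a fin_num -> (n <= m)%N ->
    cabs (g m x - g n x) ^+ 2 <= 2 * fine (S x) * 2^-1 ^+ n.
  move=> Sx nm; rewrite (le_trans (@telescoping_sqr (fun k => g k x) n m nm))//.
  rewrite [leRHS](_ : _ = fine (S x) * (2 * 2^-1 ^+ n)); last by ring.
  rewrite ler_wpM2r ?mulr_ge0 ?exprn_ge0 ?invr_ge0//.
  rewrite -lee_fin fineK// -sumEFin (@le_trans _ _ (\sum_(0 <= k < m) (D k x)%:E)%E)//.
    rewrite (@big_cat_nat _ _ _ n 0%N m)//= leeDr//.
    by apply: sume_ge0 => k _; rewrite lee_fin.
  by apply: nneseries_lim_ge => k _ _; rewrite lee_fin.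
(* Upper limits are measurable without any convergence; wherever [S] is finite they are the limits
   of the real and imaginary parts. *)
pose h x : R[i] :=
  fine (limn_esup (fun n => (complex.Re (g n x))%:E)) +i*
  fine (limn_esup (fun n => (complex.Im (g n x))%:E)).
have mh : cmeasurable h.
  split => /=; apply: measurableT_comp => //;
    apply: measurable_fun_limn_esup => n; apply/measurable_EFinP;
    by have [] := L2_meas (L2g n).
(* The real and imaginary parts each contribute a factor 2, whence 4; with the integral of [S] at
   most 2 this becomes the 8 of the statement. *)
have hE x n : S x \is a fin_num -> cabs (h x - g n x) ^+ 2 <= 4 * fine (S x) * 2^-1 ^+ n.
  move=> Sx.
  have [|a ua an] := @fast_cauchy_cvg (fun k => complex.Re (g k x)) (2 * fine (S x)).
    move=> k m /(key x _ _ Sx); apply: le_trans.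
    by rewrite cabs_sqr ReB ImB lerDl sqr_ge0.
  have [|b ub bn] := @fast_cauchy_cvg (fun k => complex.Im (g k x)) (2 * fine (S x)).
    move=> k m /(key x _ _ Sx); apply: le_trans.
    by rewrite cabs_sqr ReB ImB lerDr sqr_ge0.
  have hx : h x = a +i* b.
    rewrite /h; congr (_ +i* _).
      have /cvg_limn_einf_sup[_ ->]// : (complex.Re (g k x))%:E @[k --> \oo] --> a%:E.
      by apply: cvg_EFin => //; exact: nearW.
    have /cvg_limn_einf_sup[_ ->]// : (complex.Im (g k x))%:E @[k --> \oo] --> b%:E.
    by apply: cvg_EFin => //; exact: nearW.
  rewrite cabs_sqr hx ReB ImB/=.
  have := an n; have := bn n; lra.
have mhg n : cmeasurable (fun x => h x - g n x).
  exact: cmeasurableB (L2_meas _).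
have nhg n : (nsq mu (fun x => h x - g n x)%R <= (8 * 2^-1 ^+ n)%:E)%E.
  rewrite (@le_trans _ _ (\int[mu]_x ((4 * 2^-1 ^+ n)%:E * S x))%E)//.
    apply: ae_ge0_le_integral => //.
    - by move=> x _; rewrite lee_fin sqr_ge0.
    - exact: measurable_nsq.
    - by move=> x _; rewrite mule_ge0// lee_fin mulr_ge0// exprn_ge0// invr_ge0.
    - exact: measurable_funeM.
    - apply: filterS Sfin => x Sx _; rewrite -[S x]fineK// -EFinM lee_fin.
      by rewrite (le_trans (hE x n Sx))// mulrAC.
  rewrite ge0_integralZl// ?lee_fin ?mulr_ge0 ?exprn_ge0 ?invr_ge0//.
  rewrite (le_trans (lee_wpmul2l _ iS))// ?lee_fin ?mulr_ge0 ?exprn_ge0 ?invr_ge0//.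
  by rewrite mulrAC -natrM.
have L2hg n : L2 mu (fun x => h x - g n x).
  by apply/L2P; split => //; rewrite (le_lt_trans (nhg n))// ltry.
exists h.
  have := L2D (L2hg 0%N) (L2g 0%N).
  by under eq_fun do rewrite subrK.
by move=> n; rewrite -lee_fin -(L2_nsq (L2hg n)).
Qed.

End riesz_fischer.

(** * Orthonormal bases: Parseval and existence *)

Section orthonormal_bases.
Context d (T : measurableType d) (R : realType) (mu : {measure set T -> \bar R}).
Implicit Types (B : set (T -> R[i])) (s t : seq (T -> R[i])) (e f : T -> R[i]).

(** A basis without the completeness clause: the property that is stable under unions of chains, as
    Zorn's lemma requires. *)
Definition orthonormal_set B :=
  (forall e, B e -> L2 mu e) /\
  (forall e e', B e -> B e' -> L2inner mu e e' = (e == e')%:R).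

Lemma orthonormal_basis_set B : orthonormal_basis mu B -> orthonormal_set B.
Proof. by case. Qed.

Definition fourier f s : R := \sum_(e <- s) cabs (L2inner mu f e) ^+ 2.

Definition fourier_proj f s : T -> R[i] := fun x => \sum_(e <- s) L2inner mu f e * e x.

Section finite_subfamily.
Variables (B : set (T -> R[i])) (oB : orthonormal_set B).

Let L2B s e : {in s, forall e, B e} -> e \in s -> L2 mu e.
Proof. by move=> sB es; apply: (oB.1); exact: sB. Qed.

Lemma L2_proj f s : {in s, forall e, B e} -> L2 mu (fourier_proj f s).
Proof.
elim: s => [_|e s ih sB].
  by rewrite /fourier_proj; under eq_fun do rewrite big_nil; exact: L20.
rewrite /fourier_proj; under eq_fun do rewrite big_cons.
apply: L2D; first by apply: L2Z; apply: L2B sB _; rewrite inE eqxx.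
by apply: ih => e' e's; apply: sB; rewrite inE e's orbT.
Qed.

Lemma inner_proj f s e : uniq s -> {in s, forall e, B e} -> L2 mu f -> B e ->
  L2inner mu (fourier_proj f s) e = if e \in s then L2inner mu f e else 0.
Proof.
move=> us sB L2f Be; have L2e := oB.1 _ Be; elim: s us sB => [_ _|e' s ih /= /andP[e's us] sB].
  by rewrite /fourier_proj; under eq_fun do rewrite big_nil -[0](mul0r 0);
    rewrite innerZl ?mul0r//; exact: L20.
have Be' : B e' by apply: sB; rewrite inE eqxx.
have sB' : {in s, forall e, B e} by move=> h hs; apply: sB; rewrite inE hs orbT.
rewrite /fourier_proj; under eq_fun do rewrite big_cons.
rewrite innerDl//; last 2 first.
- by apply: L2Z; exact: oB.1.
- exact: L2_proj.
rewrite innerZl//; last exact: oB.1.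
rewrite -/(fourier_proj f s) ih// (oB.2 _ _ Be' Be) in_cons [e == e']eq_sym.
have [e'e|ne]/= := eqVneq e' e; last by rewrite mulr0 add0r.
by move: e's; rewrite e'e => /negbTE ->; rewrite mulr1 addr0.
Qed.

Lemma fourier_le f s : uniq s -> {in s, forall e, B e} -> L2 mu f ->
  fourier f s <= rsq mu f.
Proof.
move=> us sB L2f; apply: bessel_inequality => // [e|e e' es e's].
  exact: L2B.
by apply: oB.2; exact: sB.
Qed.

Lemma rsq_residual f s : uniq s -> {in s, forall e, B e} -> L2 mu f ->
  rsq mu (fun x => f x - fourier_proj f s x) = rsq mu f - fourier f s.
Proof.
move=> us sB L2f; apply: bessel_projection => // [e|e e' es e's].
  exact: L2B.
by apply: oB.2; exact: sB.
Qed.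

Lemma rsq_projB f s t : uniq s -> uniq t -> {in s, forall e, B e} ->
  {subset t <= s} -> L2 mu f ->
  rsq mu (fun x => fourier_proj f s x - fourier_proj f t x) = fourier f s - fourier f t.
Proof.
move=> us ut sB ts L2f.
have pt : perm_eq [seq e <- s | e \in t] t.
  apply: uniq_perm => //; first exact: filter_uniq.
  by move=> e; rewrite mem_filter andb_idr//; exact: ts.
(* With these coefficients the difference of the two projections is the error of approximating 0, so
   [bessel_identity] computes its norm. *)
pose c e := if e \in t then 0 else - L2inner mu f e.
have -> : (fun x => fourier_proj f s x - fourier_proj f t x) =
    (fun x => 0 - \sum_(e <- s) c e * e x).
  apply/funext => x; rewrite sub0r /fourier_proj (bigID (fun e => e \in t))/= -big_filter.
  rewrite (perm_big _ pt)/= addrAC subrr add0r [in RHS](bigID (fun e => e \in t))/=.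
  rewrite [X in - (X + _)]big1 ?add0r; last first.
    by move=> e et; rewrite /c et mul0r.
  rewrite -sumrN; apply: eq_bigr => e et.
  by rewrite /c (negbTE et) mulNr opprK.
rewrite bessel_identity//; last 3 first.
- exact: L20.
- by move=> e; exact: L2B.
- by move=> e e' es e's; apply: oB.2; exact: sB.
have i0 e : e \in s -> L2inner mu (fun=> 0) e = 0.
  move=> es; under eq_fun do rewrite -[0](mul0r 0).
  by rewrite innerZl ?mul0r//; [exact: L20|exact: L2B es].
have -> : rsq mu (fun=> 0) = 0 :> R.
  by rewrite /rsq /nsq; under eq_integral do rewrite cabs0 expr0n/=; rewrite integral0.
rewrite big1_seq ?subrr ?add0r; last by move=> e /=/i0 ->; rewrite cabs0 expr0n.
have -> : fourier f s - fourier f t =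
    \sum_(e <- s | e \notin t) cabs (L2inner mu f e) ^+ 2.
  rewrite /fourier (bigID (fun e => e \in t))/= -big_filter (perm_big _ pt)/=.
  by rewrite addrAC subrr add0r.
rewrite (bigID (fun e => e \in t))/= big1_seq ?add0r; last first.
  by move=> e /andP[et /i0 ->]; rewrite /c et subr0 cabs0 expr0n.
rewrite big_seq_cond [RHS]big_seq_cond; apply: eq_bigr => e /andP[/i0 -> et].
by rewrite /c (negbTE et) subr0 cabsN.
Qed.

End finite_subfamily.

(** Nested finite families whose Fourier sums approach the supremum [S] have fast Cauchy
    projections. Their limit [h] has the same coefficients as [f] with respect to all of [B], so
    [f - h] is null by completeness. The family [B] itself is never enumerated. *)
Lemma parseval B f (eps : R) : orthonormal_basis mu B -> L2 mu f -> 0 < eps ->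
  exists s, [/\ uniq s, {in s, forall e, B e} & rsq mu f - fourier f s < eps].
Proof.
move=> bB L2f eps0; have oB := orthonormal_basis_set bB.
pose V := [set fourier f s | s in [set s | uniq s /\ {in s, forall e, B e}]].
have V0 : V !=set0 by exists (fourier f [::]), [::].
have supV : has_sup V.
  by split => //; exists (rsq mu f) => _ [s [us sB] <-]; exact: (fourier_le oB).
pose S := sup V.
have leS s : uniq s -> {in s, forall e, B e} -> fourier f s <= S.
  by move=> us sB; apply: ub_le_sup; [case: supV|exists s].
have close (n : nat) : exists s,
    [/\ uniq s, {in s, forall e, B e} & S - 4^-1 ^+ n < fourier f s].
  have e0 : 0 < (4^-1 : R) ^+ n by rewrite exprn_gt0.
  by have [_ [s [us sB] <-] ?] := sup_adherent e0 supV; exists s.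
have [a aP] := choice close.
(* Taking unions makes the families nested, which turns the norm of a difference of projections into
   a difference of Fourier sums. *)
pose u := fix u n := if n is m.+1 then undup (u m ++ a m.+1) else a 0%N.
have uu n : uniq (u n) by case: n => [|n]; rewrite /= ?undup_uniq//; have [] := aP 0%N.
have uB n : {in u n, forall e, B e}.
  elim: n => [|n ih]; first by have [] := aP 0%N.
  move=> e /=; rewrite mem_undup mem_cat => /orP[/ih//|].
  by have [_ + _] := aP n.+1; exact.
have fourier_mono s t : uniq s -> uniq t -> {in s, forall e, B e} ->
    {subset t <= s} -> fourier f t <= fourier f s.
  by move=> *; rewrite -subr_ge0 -(rsq_projB oB)// rsq_ge0.
have au n : {subset a n <= u n}.
  by case: n => [|n] e //= ea; rewrite mem_undup mem_cat ea orbT.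
have Su n : S - 4^-1 ^+ n <= fourier f (u n).
  have [ua _ /ltW/le_trans] := aP n; apply.
  by apply: fourier_mono => //; exact: au.
have uS n : {subset u n <= u n.+1}.
  by move=> e eu /=; rewrite mem_undup mem_cat eu.
have L2p n : L2 mu (fourier_proj f (u n)) by apply: (L2_proj oB); exact: uB.
have [|h L2h hp] := @riesz_fischer _ _ _ mu (fun n => fourier_proj f (u n)) L2p.
  move=> n; rewrite (rsq_projB oB)//.
  have := leS (u n.+1) (uu _) (uB _); have := Su n; lra.
have fh0 : (fun x => f x - h x) = cst 0 %[ae mu].
  have [_ _ bB3] := bB; apply: bB3 => [|e Be]; first exact: L2B.
  have L2e := oB.1 _ Be.
  (* 18 = 2 * 8 + 2 * 1: the distance of [h] from the n-th projection gives 8, the coefficient of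
     [f] minus that projection gives 1, and [cabs_sqr_le2] doubles both. *)
  suff le18 n : cabs (L2inner mu (fun x => f x - h x) e) ^+ 2 <= 18 * 2^-1 ^+ n.
    apply/eqP; rewrite -cabs_eq0 -sqrf_eq0 eq_le sqr_ge0 andbT.
    by apply: (cvgr_to_ge (cvg_half_pow 18)); exact: nearW.
  have -> : L2inner mu (fun x => f x - h x) e =
      L2inner mu (fun x => f x - fourier_proj f (u n) x) e +
      - L2inner mu (fun x => h x - fourier_proj f (u n) x) e.
    by rewrite !innerBl//; ring.
  rewrite (le_trans (cabs_sqr_le2 _ _))// cabsN.
  have hpe : cabs (L2inner mu (fun x => h x - fourier_proj f (u n) x) e) ^+ 2 <= 8 * 2^-1 ^+ n.
    rewrite (le_trans (cauchy_schwarz (L2B L2h (L2p n)) L2e))//.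
    have -> : rsq mu e = 1 by rewrite rsqE oB.2// eqxx.
    by rewrite mulr1.
  have fpe : cabs (L2inner mu (fun x => f x - fourier_proj f (u n) x) e) ^+ 2 <= 2^-1 ^+ n.
    rewrite (@le_trans _ _ (4^-1 ^+ n))//; last first.
      by rewrite lerXn2r ?nnegrE ?invr_ge0// lef_pV2 ?posrE// ler_nat.
    rewrite innerBl// (inner_proj oB (uu n) (@uB n) L2f Be).
    case: ifPn => [_|eu]; first by rewrite subrr cabs0 expr0n/= exprn_ge0// invr_ge0.
    (* An [e] outside [u n] can be added to the family without the Fourier sum exceeding [S], so its
       squared coefficient is at most 4^-n. *)
    have := leS (e :: u n); rewrite /= eu uu => /(_ isT).
    rewrite subr0 /fourier big_cons => /(_ _)H; have := Su n; rewrite /fourier.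
    have : forall x, x \in e :: u n -> B x.
      by move=> x; rewrite in_cons => /orP[/eqP->//|]; exact: uB.
    by move=> /H; lra.
  by lra.
have [n hn] : exists n, 8 * (2^-1 : R) ^+ n < eps / 2.
  have e2 : 0 < eps / 2 by rewrite divr_gt0.
  by have [n _ /(_ n (leqnn n))] := cvgr_lt _ (cvg_half_pow 8) _ e2; exists n.
exists (u n); split => //.
rewrite -(rsq_residual oB)//.
have L2fh := L2B L2f L2h; have L2hn := L2B L2h (L2p n).
have -> : (fun x => f x - fourier_proj f (u n) x) =
    (fun x => (f x - h x) + (h x - fourier_proj f (u n) x)).
  by apply/funext => x; rewrite addrA subrK.
rewrite -lte_fin -L2_nsq; last exact: L2D.
rewrite (le_lt_trans (nsqD_le mu (L2_meas L2fh) (L2_meas L2hn)))//.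
rewrite ((@nsq_eq0 _ _ _ mu _ (L2_meas L2fh)).2 fh0).
rewrite mule0 add0e (L2_nsq L2hn) -EFinM lte_fin.
have := hp n; lra.
Qed.

(** A nonzero vector orthogonal to a maximal orthonormal set could be normalised and added to it.
    Existence matters for [hs_norm]: a supremum over no basis at all would be -oo. *)
Lemma orthonormal_basis_exists : exists B, orthonormal_basis mu B.
Proof.
have [|B [oB maxB]] := @Zorn_bigcup _ orthonormal_set.
  move=> F FO Ftot; split=> [e [A FA Ae]|e e' [A FA Ae] [A' FA' Ae']].
    exact: (FO _ FA).1.
  have [AA'|A'A] := Ftot _ _ FA FA'.
    by apply: (FO _ FA').2 => //; exact: AA'.
  by apply: (FO _ FA).2 => //; exact: A'A.
exists B; split; [exact: oB.1|exact: oB.2|] => f L2f fB.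
apply: (@nsq_eq0 _ _ _ mu _ (L2_meas L2f)).1.
rewrite L2_nsq//; apply: contrapT => /eqP; rewrite eqe => f0.
have fp : 0 < rsq mu f by rewrite lt_def f0 rsq_ge0.
pose s := Num.sqrt (rsq mu f); have sp : 0 < s by rewrite sqrtr_gt0.
have s2 : s ^+ 2 = rsq mu f by rewrite sqr_sqrtr// ltW.
pose g x := (s^-1)%:C * f x.
have L2g : L2 mu g by exact: L2Z.
have g1 : L2inner mu g g = 1.
  rewrite innerZl// innerZr// inner_self conjc_real -!rmorphM/= -s2.
  by rewrite expr2 mulKf ?gt_eqF// mulVf ?gt_eqF.
have gB e : B e -> L2inner mu g e = 0.
  by move=> Be; rewrite innerZl ?fB ?mulr0//; exact: oB.1.
have Bg : ~ B g by move=> /gB; rewrite g1 => /eqP; rewrite oner_eq0.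
apply: (maxB (B `|` [set g])).
  split; first by move=> e Be; left.
  by move=> /(_ g)H; apply/Bg/H; right.
split=> [e [/oB.1//|->//]|e e' [Be|->] [Be'|->]].
- exact: oB.2.
- rewrite inner_conj//; last exact: oB.1.
  rewrite gB// (_ : e == g = false) ?conjc0//.
  by apply/negP => /eqP eg; apply: Bg; rewrite -eg.
- rewrite gB// (_ : g == e' = false)//.
  by apply/negP => /eqP eg; apply: Bg; rewrite eg.
- by rewrite eqxx.
Qed.

End orthonormal_bases.

(** * Integral operators with square-integrable kernels *)

Lemma le_poweR_half (R : realType) (x y : \bar R) : (0 <= x)%E -> (x <= y)%E ->
  (x `^ 2^-1 <= y `^ 2^-1)%E.
Proof.
move=> x0 xy; apply: gt0_ler_poweR => //.
  by rewrite in_itv/= x0 leey.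
by rewrite in_itv/= (le_trans x0 xy) leey.
Qed.

Lemma sqr_L2norm d (T : measurableType d) (R : realType)
    (mu : {measure set T -> \bar R}) (f : T -> R[i]) :
  (L2norm mu f ^+ 2 = nsq mu f)%E.
Proof.
rewrite L2normE; have := nsq_ge0 mu f; case: (nsq mu f) => [r r0| _|//].
  by rewrite poweR_EFin -EFin_expe powR12_sqrt ?lee_fin// sqr_sqrtr ?lee_fin.
by rewrite poweRyr ?invr_eq0// expeS expe1 mulyy.
Qed.

Section L2_sums.
Context d (T : measurableType d) (R : realType) (mu : {measure set T -> \bar R}).

Lemma rsqD_le (f g : T -> R[i]) : L2 mu f -> L2 mu g ->
  rsq mu (fun x => f x + g x) <= 2 * rsq mu f + 2 * rsq mu g.
Proof.
move=> L2f L2g; have := nsqD_le mu (L2_meas L2f) (L2_meas L2g).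
by rewrite (L2_nsq L2f) (L2_nsq L2g) (L2_nsq (L2D L2f L2g)) -!EFinM -EFinD lee_fin.
Qed.

Lemma L2_sum_seq (I : eqType) (s : seq I) (F : I -> T -> R[i]) :
  (forall i, i \in s -> L2 mu (F i)) -> L2 mu (fun x => \sum_(i <- s) F i x).
Proof.
elim: s => [_|i s ih L2F]; first by under eq_fun do rewrite big_nil; exact: L20.
under eq_fun do rewrite big_cons; apply: L2D; first exact: L2F (mem_head _ _).
by apply: ih => j js; apply: L2F; rewrite in_cons js orbT.
Qed.

Lemma measurable_sum_seq (I : eqType) (s : seq I) (F : I -> T -> R) :
  (forall i, i \in s -> measurable_fun setT (F i)) ->
  measurable_fun setT (fun x => \sum_(i <- s) F i x).
Proof.
elim: s => [_|i s ih mF]; first by under eq_fun do rewrite big_nil; exact: measurable_cst.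
under eq_fun do rewrite big_cons; apply: measurable_funD; first exact: mF (mem_head _ _).
by apply: ih => j js; apply: mF; rewrite in_cons js orbT.
Qed.

Lemma ge0_integral_sum_seq (I : eqType) (s : seq I) (F : I -> T -> R) :
  (forall i, i \in s -> measurable_fun setT (F i)) -> (forall i x, 0 <= F i x) ->
  (\int[mu]_x (\sum_(i <- s) F i x)%:E = \sum_(i <- s) \int[mu]_x (F i x)%:E)%E.
Proof.
move=> + F0; elim: s => [_|i s ih mF].
  by under eq_integral do rewrite big_nil; rewrite integral0 big_nil.
have ms j : j \in s -> measurable_fun setT (F j).
  by move=> js; apply: mF; rewrite in_cons js orbT.
under eq_integral do rewrite big_cons.
rewrite ge0_integralD_EFin//; last 3 first.
- exact: mF (mem_head _ _).
- exact: measurable_sum_seq.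
- by move=> x; exact: sumr_ge0.
by rewrite big_cons ih.
Qed.

(** The constant 2^size is crude but harmless: the length of the list is fixed before the summands
    are made small. *)
Lemma rsq_sum_le (I : eqType) (s : seq I) (F : I -> T -> R[i]) :
  (forall i, i \in s -> L2 mu (F i)) ->
  rsq mu (fun x => \sum_(i <- s) F i x) <= 2 ^+ size s * \sum_(i <- s) rsq mu (F i).
Proof.
elim: s => [_|i s ih L2F].
  under eq_fun do rewrite big_nil.
  rewrite big_nil mulr0 /rsq /nsq; under eq_integral do rewrite cabs0 expr0n/=.
  by rewrite integral0.
under eq_fun do rewrite big_cons.
have L2s j : j \in s -> L2 mu (F j) by move=> js; apply: L2F; rewrite in_cons js orbT.
rewrite (le_trans (rsqD_le (L2F _ (mem_head _ _)) (L2_sum_seq L2s)))//.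
rewrite big_cons mulrDr lerD//=.
  by rewrite ler_wpM2r ?rsq_ge0// exprS ler_peMr// exprn_ege1// ler1n.
by rewrite exprS -mulrA ler_wpM2l// ih.
Qed.

End L2_sums.

(** * Tonelli and Fubini for complex functions *)

Section product_integrals.
Context d1 (X : measurableType d1) d2 (Y : measurableType d2) (R : realType).
Variables (mu : {sigma_finite_measure set X -> \bar R})
          (nu : {sigma_finite_measure set Y -> \bar R}).

(** Tonelli applied to the positive and negative parts gives measurability with no integrability
    assumption on the sections. *)
Lemma measurable_Rintegral_fst (F : X * Y -> R) : measurable_fun setT F ->
  measurable_fun setT (fun y => \int[mu]_x F (x, y) : R).
Proof.
move=> mF; have mEF : measurable_fun setT (EFin \o F) by exact/measurable_EFinP.
apply: measurableT_comp => //.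
have -> : (fun y => \int[mu]_x (F (x, y))%:E)%E =
    ((fun y => \int[mu]_x (EFin \o F)^\+ (x, y)) \-
     (fun y => \int[mu]_x (EFin \o F)^\- (x, y)))%E.
  apply/funext => y; rewrite [LHS]integralE.
  by congr (_ - _)%E; apply: eq_integral => x _; rewrite !(funeposE, funenegE).
apply: emeasurable_funB; apply: measurable_fun_fubini_tonelli_G => //.
  exact: measurable_funepos.
exact: measurable_funeneg.
Qed.

Lemma cmeasurable_cintegral_fst (F : X * Y -> R[i]) : cmeasurable F ->
  cmeasurable (fun y => cintegral mu setT (fun x => F (x, y))).
Proof. by move=> [rF jF]; split => /=; apply: (measurable_Rintegral_fst (F := _ \o F)). Qed.

Lemma nsq_tonelli_fst (F : X * Y -> R[i]) : cmeasurable F ->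
  nsq (mu \x nu)%E F = (\int[nu]_y nsq mu (fun x => F (x, y)))%E.
Proof.
move=> mF; rewrite /nsq fubini_tonelli1; last 2 first.
- exact: measurable_nsq.
- by move=> z; rewrite lee_fin sqr_ge0.
rewrite /fubini_F (fubini_tonelli (fun z => (cabs (F z) ^+ 2)%:E))//.
  exact: measurable_nsq.
by move=> z; rewrite lee_fin sqr_ge0.
Qed.

Lemma nsq_tonelli_snd (F : X * Y -> R[i]) : cmeasurable F ->
  nsq (mu \x nu)%E F = (\int[mu]_x nsq nu (fun y => F (x, y)))%E.
Proof.
move=> mF; rewrite /nsq fubini_tonelli1//; first exact: measurable_nsq.
by move=> z; rewrite lee_fin sqr_ge0.
Qed.

Lemma measurable_nsq_fst (F : X * Y -> R[i]) : cmeasurable F ->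
  measurable_fun setT (fun y => nsq mu (fun x => F (x, y))).
Proof.
move=> mF; apply: (measurable_fun_fubini_tonelli_G (fun z => (cabs (F z) ^+ 2)%:E)).
  exact: measurable_nsq.
by move=> z; rewrite lee_fin sqr_ge0.
Qed.

(** Integrability of every section lets [fine] be removed from the inner integrals at each point. *)
Lemma cfubini (F : X * Y -> R[i]) : cintegrable (mu \x nu)%E setT F ->
  (forall y, cintegrable mu setT (fun x => F (x, y))) ->
  (forall x, cintegrable nu setT (fun y => F (x, y))) ->
  cintegral nu setT (fun y => cintegral mu setT (fun x => F (x, y))) =
  cintegral mu setT (fun x => cintegral nu setT (fun y => F (x, y))).
Proof.
move=> [rF jF] Fy Fx; rewrite /cintegral /Rintegral/=.
congr (fine _ +i* fine _).
  under eq_integral => y _ do rewrite fineK ?(integrable_fin_num _ (Fy y).1)//.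
  rewrite -(Fubini rF); apply: eq_integral => x _.
  by rewrite fineK// (integrable_fin_num _ (Fx x).1).
under eq_integral => y _ do rewrite fineK ?(integrable_fin_num _ (Fy y).2)//.
rewrite -(Fubini jF); apply: eq_integral => x _.
by rewrite fineK// (integrable_fin_num _ (Fx x).2).
Qed.

End product_integrals.

(** * Boundedness of operators given by a kernel *)

Section kernel_operators.
Context d1 (X : measurableType d1) d2 (Y : measurableType d2) (R : realType).
Variables (mu : {sigma_finite_measure set X -> \bar R})
          (nu : {sigma_finite_measure set Y -> \bar R}).

Definition kop (k : X * Y -> R[i]) (f : X -> R[i]) (y : Y) : R[i] :=
  cintegral mu setT (fun x => k (x, y) * f x).

Section one_kernel.
Variable k : X * Y -> R[i].
Hypothesis L2k : L2 (mu \x nu)%E k.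
(** Required at every [y]: the operator is then linear as an exact equality of functions, and
    Cauchy-Schwarz bounds its value at each point. *)
Hypothesis L2ky : forall y, L2 mu (fun x => k (x, y)).

Let mk : cmeasurable k := L2_meas L2k.

Lemma cmeasurable_kop f : L2 mu f -> cmeasurable (kop k f).
Proof.
move=> L2f; pose F (z : X * Y) := k z * f z.1.
have -> : kop k f = (fun y => cintegral mu setT (fun x => F (x, y))) by [].
apply: cmeasurable_cintegral_fst.
by apply: cmeasurableM => //; exact: (cmeasurable_comp measurable_fst (L2_meas L2f)).
Qed.

Lemma kop_inner f y : kop k f y = L2inner mu (fun x => k (x, y)) (fun x => conjc (f x)).
Proof. by apply: eq_cintegral => x _; rewrite conjcK. Qed.

Lemma kop_inner_conj f y : L2 mu f ->
  kop k f y = conjc (L2inner mu (fun x => conjc (k (x, y))) f).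
Proof.
move=> L2f; rewrite /kop /L2inner -cintegral_conjc//; last first.
  by apply: L2inner_integrable => //; exact: L2_conjc.
by apply: eq_cintegral => x _; rewrite conjcM !conjcK.
Qed.

Lemma cabs_kop_le f y : L2 mu f ->
  cabs (kop k f y) ^+ 2 <= rsq mu (fun x => k (x, y)) * rsq mu f.
Proof.
move=> L2f; rewrite kop_inner.
rewrite (le_trans (cauchy_schwarz (L2ky y) (L2_conjc L2f)))//.
by rewrite [rsq mu (fun x => conjc _)]/rsq nsq_conjc.
Qed.

Lemma nsq_kop_le f : L2 mu f ->
  (nsq nu (kop k f) <= nsq (mu \x nu)%E k * nsq mu f)%E.
Proof.
move=> L2f; rewrite (L2_nsq L2f) nsq_tonelli_fst//.
rewrite -ge0_integralZr//; last 3 first.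
- exact: measurable_nsq_fst.
- by move=> y _; exact: nsq_ge0.
- by rewrite lee_fin rsq_ge0.
apply: ge0_le_integral => //.
- by move=> y _; rewrite lee_fin sqr_ge0.
- by apply: measurable_nsq; exact: cmeasurable_kop.
- apply: emeasurable_funM => //; exact: measurable_nsq_fst.
- by move=> y _; rewrite (L2_nsq (L2ky y)) -EFinM lee_fin cabs_kop_le.
Qed.

Lemma L2_kop f : L2 mu f -> L2 nu (kop k f).
Proof.
move=> L2f; apply/L2P; split; first exact: cmeasurable_kop.
rewrite (le_lt_trans (nsq_kop_le L2f))// (L2_nsq L2f) (L2_nsq L2k).
by rewrite -EFinM ltry.
Qed.

Lemma kop_linear (c : R[i]) f g : L2 mu f -> L2 mu g ->
  kop k (fun x => c * f x + g x) = (fun y => c * kop k f y + kop k g y).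
Proof.
move=> L2f L2g; apply/funext => y; rewrite /kop.
rewrite -cintegralZ//; last exact: L2M_integrable.
rewrite -cintegralD//; last 2 first.
- by apply: cintegrableZ => //; exact: L2M_integrable.
- exact: L2M_integrable.
by apply: eq_cintegral => x _; ring.
Qed.

Lemma kop_sum n (c : 'I_n -> R[i]) (f : 'I_n -> X -> R[i]) :
  (forall i, L2 mu (f i)) ->
  kop k (fun x => \sum_i c i * f i x) = (fun y => \sum_i c i * kop k (f i) y).
Proof.
move=> L2f; apply/funext => y; rewrite /kop.
transitivity (\sum_i cintegral mu setT (fun x => c i * (k (x, y) * f i x))).
  rewrite -cintegral_sum//; last first.
    by move=> i; apply: cintegrableZ => //; exact: L2M_integrable.
  apply: eq_cintegral => x _; rewrite mulr_sumr; apply: eq_bigr => i _; ring.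
by apply: eq_bigr => i _; rewrite cintegralZ//; exact: L2M_integrable.
Qed.

Lemma L2norm_kop_le f : L2 mu f ->
  (L2norm nu (kop k f) <= L2norm (mu \x nu)%E k * L2norm mu f)%E.
Proof.
move=> L2f; rewrite !L2normE -poweRM ?nsq_ge0//.
by apply: le_poweR_half; rewrite ?nsq_ge0 ?nsq_kop_le.
Qed.

Lemma bounded_kop : bounded_op mu nu (kop k).
Proof.
split; [exact: L2_kop| |].
  by move=> c f g L2f L2g; rewrite kop_linear//; exact: ae_eq_refl.
exists (fine (L2norm (mu \x nu)%E k)) => f L2f; rewrite fineK.
  exact: L2norm_kop_le.
by rewrite ge0_fin_numE ?L2norm_lty ?L2_nsq ?ltry// L2normE poweR_ge0.
Qed.

Lemma opnorm_kop_le : (opnorm mu nu (kop k) <= L2norm (mu \x nu)%E k)%E.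
Proof.
apply: ub_ereal_sup => _ [f [L2f f1] <-].
rewrite (le_trans (L2norm_kop_le L2f))//.
rewrite -[leRHS]mule1 lee_wpmul2l// L2normE poweR_ge0//.
Qed.

End one_kernel.
End kernel_operators.

(** * The adjoint of a kernel operator *)

Section kernel_adjoint.
Context d1 (X : measurableType d1) d2 (Y : measurableType d2) (R : realType).
Variables (mu : {sigma_finite_measure set X -> \bar R})
          (nu : {sigma_finite_measure set Y -> \bar R}).
Variable k : X * Y -> R[i].
Hypothesis L2k : L2 (mu \x nu)%E k.
Hypothesis L2ky : forall y, L2 mu (fun x => k (x, y)).
Hypothesis L2kx : forall x, L2 nu (fun y => k (x, y)).

Definition adj_kernel (z : Y * X) : R[i] := conjc (k (z.2, z.1)).

Lemma cmeasurable_adj_kernel : cmeasurable adj_kernel.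
Proof.
apply: cmeasurable_conjc; apply: (cmeasurable_comp _ (L2_meas L2k)).
exact: measurable_swap.
Qed.

Lemma L2_adj_kernel : L2 (nu \x mu)%E adj_kernel.
Proof.
apply/L2P; split; first exact: cmeasurable_adj_kernel.
rewrite nsq_tonelli_fst; last exact: cmeasurable_adj_kernel.
have [_] := (L2P _ _).1 L2k; rewrite nsq_tonelli_snd; last exact: L2_meas L2k.
by under [X in _ -> (X < _)%E]eq_integral do rewrite nsq_conjc.
Qed.

(** Fubini applies because the integrand is a product of two square-integrable functions on the
    product space, [k] and the tensor of [f] with the conjugate of [g]. *)
Lemma kop_adjoint f g : L2 mu f -> L2 nu g ->
  L2inner nu (kop mu k f) g = L2inner mu f (kop nu adj_kernel g).
Proof.
move=> L2f L2g; pose F z := k z * (f z.1 * conjc (g z.2)).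
have L2fg : L2 (mu \x nu)%E (fun z => f z.1 * conjc (g z.2)).
  apply/L2P; split.
    apply: cmeasurableM; first exact: (cmeasurable_comp measurable_fst (L2_meas L2f)).
    exact/cmeasurable_conjc/(cmeasurable_comp measurable_snd (L2_meas L2g)).
  rewrite nsq_tonelli_snd; last first.
    apply: cmeasurableM; first exact: (cmeasurable_comp measurable_fst (L2_meas L2f)).
    exact/cmeasurable_conjc/(cmeasurable_comp measurable_snd (L2_meas L2g)).
  under eq_integral => x _.
    rewrite (nsqZ _ (f x) (L2_meas (L2_conjc L2g))) nsq_conjc (L2_nsq L2g).
    over.
  rewrite ge0_integralZr//; last 3 first.
  - by apply: measurable_nsq; exact: L2_meas L2f.
  - by move=> x _; rewrite lee_fin sqr_ge0.
  - by rewrite lee_fin rsq_ge0.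
  by rewrite -/(nsq mu f) (L2_nsq L2f) -EFinM ltry.
have Fy y : cintegrable mu setT (fun x => F (x, y)).
  have -> : (fun x => F (x, y)) = (fun x => conjc (g y) * (k (x, y) * f x)).
    by apply/funext => x; rewrite /F; ring.
  by apply: cintegrableZ => //; exact: L2M_integrable.
have Fx x : cintegrable nu setT (fun y => F (x, y)).
  have -> : (fun y => F (x, y)) = (fun y => f x * (k (x, y) * conjc (g y))).
    by apply/funext => y; rewrite /F; ring.
  by apply: cintegrableZ => //; apply: L2M_integrable => //; exact: L2_conjc.
have := cfubini (L2M_integrable L2k L2fg) Fy Fx.
have -> : L2inner nu (kop mu k f) g =
    cintegral nu setT (fun y => cintegral mu setT (fun x => F (x, y))).
  apply: eq_cintegral => y _; rewrite mulrC /kop -cintegralZ//.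
    by apply: eq_cintegral => x _; rewrite /F; ring.
  exact: L2M_integrable.
move=> ->; apply: eq_cintegral => x _; rewrite /kop -cintegral_conjc//.
  rewrite -cintegralZ//; last first.
    apply: cintegrable_conjc => //; apply: L2M_integrable => //.
    exact: L2_conjc (L2kx x).
  by apply: eq_cintegral => y _; rewrite /F conjcM conjcK/=; ring.
apply: L2M_integrable => //; exact: L2_conjc (L2kx x).
Qed.

Lemma kop_is_adjoint : is_adjoint mu nu (kop mu k) (kop nu adj_kernel).
Proof.
split; last exact: kop_adjoint.
by apply: bounded_kop; [exact: L2_adj_kernel|move=> x; exact: L2_conjc (L2kx x)].
Qed.

End kernel_adjoint.

(** * Hilbert-Schmidt norm of a kernel operator *)

Section hilbert_schmidt.
Context d1 (X : measurableType d1) d2 (Y : measurableType d2) (R : realType).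
Variables (mu : {sigma_finite_measure set X -> \bar R})
          (nu : {sigma_finite_measure set Y -> \bar R}).

Lemma simultaneous_parseval (B : set (X -> R[i])) (t : seq (X -> R[i])) (eps : R) :
  orthonormal_basis mu B -> {in t, forall g, L2 mu g} -> 0 < eps ->
  exists s, [/\ uniq s, {in s, forall e, B e} &
    {in t, forall g, rsq mu g - fourier mu g s < eps}].
Proof.
move=> bB + eps0; have oB := orthonormal_basis_set bB.
have mono f s s' : uniq s' -> {in s', forall e, B e} -> uniq s ->
    {subset s <= s'} -> L2 mu f -> fourier mu f s <= fourier mu f s'.
  by move=> *; rewrite -subr_ge0 -(rsq_projB oB)// rsq_ge0.
elim: t => [_|g t ih L2t]; first by exists [::].
have [s1 [us1 s1B h1]] : exists s, [/\ uniq s, {in s, forall e, B e} &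
    {in t, forall g, rsq mu g - fourier mu g s < eps}].
  by apply: ih => h ht; apply: L2t; rewrite in_cons ht orbT.
have [s2 [us2 s2B h2]] := parseval bB (L2t g (mem_head _ _)) eps0.
have uB : {in undup (s1 ++ s2), forall e, B e}.
  by move=> e; rewrite mem_undup mem_cat => /orP[/s1B|/s2B].
exists (undup (s1 ++ s2)); split; [exact: undup_uniq|exact: uB|].
move=> h; rewrite in_cons => /orP[/eqP ->|ht].
  apply: le_lt_trans h2; rewrite lerB// mono ?undup_uniq//.
  - by move=> e es; rewrite mem_undup mem_cat es orbT.
  - exact: L2t (mem_head _ _).
apply: le_lt_trans (h1 _ ht); rewrite lerB// mono ?undup_uniq//.
- by move=> e es; rewrite mem_undup mem_cat es.
- by apply: L2t; rewrite in_cons ht orbT.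
Qed.

Definition separated (t : seq ((X -> R[i]) * (Y -> R[i]))) (z : X * Y) : R[i] :=
  \sum_(gh <- t) gh.1 z.1 * gh.2 z.2.

Variable k : X * Y -> R[i].
Hypothesis L2k : L2 (mu \x nu)%E k.
Hypothesis L2ky : forall y, L2 mu (fun x => k (x, y)).

Let mk : cmeasurable k := L2_meas L2k.

Lemma cmeasurable_separated t :
  (forall gh, gh \in t -> L2 mu gh.1) -> (forall gh, gh \in t -> L2 nu gh.2) ->
  cmeasurable (separated t).
Proof.
elim: t => [_ _|gh t ih L1 L2]; rewrite /separated.
  by under eq_fun do rewrite big_nil; exact: cmeasurable_cst.
under eq_fun do rewrite big_cons; apply: cmeasurableD; last first.
  by apply: ih => gh' ht; [apply: L1|apply: L2]; rewrite in_cons ht orbT.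
have m1 := L2_meas (L1 _ (mem_head _ _)); have m2 := L2_meas (L2 _ (mem_head _ _)).
apply: cmeasurableM; first exact: (cmeasurable_comp measurable_fst m1).
exact: (cmeasurable_comp measurable_snd m2).
Qed.

Lemma L2_separated_fst t y : (forall gh, gh \in t -> L2 mu gh.1) ->
  L2 mu (fun x => separated t (x, y)).
Proof.
move=> L1; apply: L2_sum_seq => gh /L1 /(L2Z (gh.2 y)).
by under [in X in _ -> X]eq_fun do rewrite mulrC.
Qed.

Section basis.
Variables (B : set (X -> R[i])) (oB : orthonormal_set mu B).

(** Set to 0 outside [B] so that measurability holds for every function [e], which the lemmas on
    sums over a list of functions ask for. *)
Let term e y : R := if `[< B e >] then cabs (kop mu k e y) ^+ 2 else 0.

Let measurable_term e : measurable_fun setT (term e).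
Proof.
rewrite /term; case: asboolP => [Be|_]; last exact: measurable_cst.
by apply: measurable_cabs_sqr; apply: (cmeasurable_kop L2k); exact: (oB.1 _ Be).
Qed.

Let term_ge0 e y : 0 <= term e y.
Proof. by rewrite /term; case: ifP => // _; exact: sqr_ge0. Qed.

Let fourier_kop s y : {in s, forall e, B e} ->
  fourier mu (fun x => conjc (k (x, y))) s = \sum_(e <- s) term e y.
Proof.
move=> sB; apply: eq_big_seq => e es; rewrite /term asboolT; last exact: sB.
by rewrite kop_inner_conj ?cabs_conjc//; apply: (oB.1); exact: sB.
Qed.

Lemma measurable_fourier_kernel s : {in s, forall e, B e} ->
  measurable_fun setT (fun y => fourier mu (fun x => conjc (k (x, y))) s).
Proof.
move=> sB; under eq_fun do rewrite fourier_kop//.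
exact: measurable_sum.
Qed.

(** The value of the operator at [e] and [y] is, up to conjugation, the Fourier coefficient along
    [e] of the conjugate section of [k]. Sums over a basis thus become Fourier sums under the
    integral in [y]. *)
Lemma sum_nsq_kop s : {in s, forall e, B e} ->
  (\sum_(e <- s) nsq nu (kop mu k e) =
   \int[nu]_y (fourier mu (fun x => conjc (k (x, y))) s)%:E)%E.
Proof.
move=> sB; under [RHS]eq_integral do rewrite fourier_kop//.
rewrite ge0_integral_sum_EFin//; apply: eq_big_seq => e es.
by apply: eq_integral => y _; rewrite /term asboolT//; exact: sB.
Qed.

Lemma sum_nsq_kop_le s : uniq s -> {in s, forall e, B e} ->
  (\sum_(e <- s) nsq nu (kop mu k e) <= nsq (mu \x nu) k)%E.
Proof.
move=> us sB; rewrite sum_nsq_kop// nsq_tonelli_fst//.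
apply: ge0_le_integral => //.
- by move=> y _; rewrite lee_fin sumr_ge0// => e _; exact: sqr_ge0.
- by apply/measurable_EFinP; exact: measurable_fourier_kernel.
- exact: measurable_nsq_fst.
- move=> y _; rewrite -nsq_conjc (L2_nsq (L2_conjc (L2ky y))) lee_fin.
  by apply: (fourier_le oB) => //; exact: L2_conjc.
Qed.

(* Projecting the first factors of [t] onto [span s] exhibits an element of
   [span s] close to the conjugate section of [k], while the Fourier projection
   is the closest one. *)
Lemma fourier_defect_le s t y : uniq s -> {in s, forall e, B e} ->
  (forall gh, gh \in t -> L2 mu gh.1) ->
  rsq mu (fun x => k (x, y)) <= fourier mu (fun x => conjc (k (x, y))) s +
    (2 * rsq mu (fun x => k (x, y) - separated t (x, y)) +
     2 * (2 ^+ size t * \sum_(gh <- t) cabs (gh.2 y) ^+ 2 *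
       rsq mu (fun x => conjc (gh.1 x) - fourier_proj mu (fun x => conjc (gh.1 x)) s x))).
Proof.
move=> us sB L2t; rewrite -lerBlDl.
have L2cy := L2_conjc (L2ky y).
have -> : rsq mu (fun x => k (x, y)) = rsq mu (fun x => conjc (k (x, y))).
  by rewrite /rsq nsq_conjc.
(* The Fourier coefficient along [e] of the conjugate of the section at [y] of [separated t]. *)
pose c e := \sum_(gh <- t) conjc (gh.2 y) * L2inner mu (fun x => conjc (gh.1 x)) e.
have L2s e : e \in s -> L2 mu e by move=> /sB; exact: (oB.1).
have os e e' : e \in s -> e' \in s -> L2inner mu e e' = (e == e')%:R.
  by move=> /sB Be /sB; exact: (oB.2).
apply: (@le_trans _ _ (rsq mu (fun x => conjc (k (x, y)) - \sum_(e <- s) c e * e x))).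
  by rewrite (bessel_identity c us L2cy L2s os) lerDl sumr_ge0// => e _; exact: sqr_ge0.
pose P (gh : (X -> R[i]) * (Y -> R[i])) x := conjc (gh.1 x) - fourier_proj mu (fun x => conjc (gh.1 x)) s x.
have -> : (fun x => conjc (k (x, y)) - \sum_(e <- s) c e * e x) =
    (fun x => conjc (k (x, y) - separated t (x, y)) +
       \sum_(gh <- t) conjc (gh.2 y) * P gh x).
  apply/funext => x.
  have -> : \sum_(e <- s) c e * e x =
      \sum_(gh <- t) conjc (gh.2 y) * fourier_proj mu (fun x => conjc (gh.1 x)) s x.
    rewrite /fourier_proj; under eq_bigr do rewrite mulr_suml.
    rewrite exchange_big/=; apply: eq_bigr => gh _; rewrite mulr_sumr.
    by apply: eq_bigr => e _; rewrite mulrA.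
  have -> : \sum_(gh <- t) conjc (gh.2 y) * P gh x = conjc (separated t (x, y)) -
      \sum_(gh <- t) conjc (gh.2 y) * fourier_proj mu (fun x => conjc (gh.1 x)) s x.
    rewrite /separated (big_morph _ (@conjcD R) (conjc0 R)) -sumrB.
    by apply: eq_bigr => gh _; rewrite conjcM /P; ring.
  by rewrite conjcD conjcN; ring.
have L2P gh : gh \in t -> L2 mu (P gh).
  move=> /L2t L2g; apply: L2B; first exact: L2_conjc.
  exact: (L2_proj oB).
have L2hP gh : gh \in t -> L2 mu (fun x => conjc (gh.2 y) * P gh x).
  by move=> /L2P; exact: L2Z.
have L2sep : L2 mu (fun x => k (x, y) - separated t (x, y)).
  by apply: L2B => //; exact: L2_separated_fst.
rewrite (le_trans (rsqD_le (L2_conjc L2sep) (L2_sum_seq L2hP)))//.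
rewrite {1}/rsq nsq_conjc -/(rsq _ _) lerD2l ler_wpM2l//.
rewrite (le_trans (rsq_sum_le L2hP))// ler_wpM2l ?exprn_ge0//.
rewrite big_seq [leRHS]big_seq; apply: ler_sum => gh ght.
by rewrite rsqZ ?cabs_conjc//; exact: L2_meas (L2P _ ght).
Qed.

(** [fourier_defect_le] integrated over [y]. The point is uniformity: the hypothesis on [s] concerns
    only the finitely many first factors in [t], while the conclusion covers all sections of [k]
    together. *)
Lemma nsq_kernel_le s t (dlt eps : R) : uniq s -> {in s, forall e, B e} ->
  (forall gh, gh \in t -> L2 mu gh.1) -> (forall gh, gh \in t -> L2 nu gh.2) ->
  0 <= eps -> (nsq (mu \x nu)%E (fun z => k z - separated t z)%R <= dlt%:E)%E ->
  (forall gh, gh \in t ->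
    rsq mu (fun x => conjc (gh.1 x) - fourier_proj mu (fun x => conjc (gh.1 x)) s x) <= eps) ->
  (nsq (mu \x nu)%E k <= \sum_(e <- s) nsq nu (kop mu k e) +
    (2 * dlt + 2 * (2 ^+ size t * \sum_(gh <- t) rsq nu gh.2 * eps))%:E)%E.
Proof.
move=> us sB L2t1 L2t2 eps0 kdlt gheps.
have L2sep y : L2 mu (fun x => k (x, y) - separated t (x, y)).
  by apply: L2B => //; exact: L2_separated_fst.
have msep : cmeasurable (fun z => k z - separated t z).
  by apply: cmeasurableB => //; exact: cmeasurable_separated.
have mrsep : measurable_fun setT (fun y => rsq mu (fun x => k (x, y) - separated t (x, y))).
  by apply: measurableT_comp => //; exact: (measurable_nsq_fst mu msep).
have mh gh : gh \in t -> measurable_fun setT (fun y => cabs (gh.2 y) ^+ 2).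
  by move=> /L2t2/L2_meas/measurable_cabs_sqr.
have mhs : measurable_fun setT (fun y => \sum_(gh <- t) cabs (gh.2 y) ^+ 2 * eps).
  by apply: measurable_sum_seq => gh ght; apply: measurable_funM => //; exact: mh.
rewrite sum_nsq_kop// nsq_tonelli_fst//.
pose psi y := fourier mu (fun x => conjc (k (x, y))) s +
    (2 * rsq mu (fun x => k (x, y) - separated t (x, y)) +
     2 * (2 ^+ size t * \sum_(gh <- t) cabs (gh.2 y) ^+ 2 * eps)).
have kpsi y : rsq mu (fun x => k (x, y)) <= psi y.
  rewrite (le_trans (fourier_defect_le y us sB L2t1))// lerD2l lerD2l ler_wpM2l//.
  rewrite ler_wpM2l ?exprn_ge0// big_seq [leRHS]big_seq; apply: ler_sum => gh ght.
  by rewrite ler_wpM2l ?sqr_ge0// gheps.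
have mPhi := measurable_fourier_kernel sB.
have B0 y : 0 <= \sum_(gh <- t) cabs (gh.2 y) ^+ 2 * eps.
  by apply: sumr_ge0 => gh _; rewrite mulr_ge0// sqr_ge0.
rewrite (@le_trans _ _ (\int[nu]_y (psi y)%:E)%E)//.
  apply: ge0_le_integral => //.
  - by move=> y _; exact: nsq_ge0.
  - exact: measurable_nsq_fst.
  - apply/measurable_EFinP; apply: measurable_funD => //.
    by apply: measurable_funD; do ?[exact: measurable_funM];
      apply: measurable_funM => //; exact: measurable_funM.
  - by move=> y _; rewrite (L2_nsq (L2ky y)) lee_fin.
have Phi0 y : 0 <= fourier mu (fun x => conjc (k (x, y))) s.
  by apply: sumr_ge0 => e _; exact: sqr_ge0.
rewrite ge0_integralD_EFin//; last 2 first.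
- by apply: measurable_funD; apply: measurable_funM => //; exact: measurable_funM.
- by move=> y; rewrite addr_ge0// !mulr_ge0// ?exprn_ge0// rsq_ge0.
rewrite leeD2l// ge0_integralD_EFin//; last 4 first.
- exact: measurable_funM.
- by move=> y; rewrite mulr_ge0// rsq_ge0.
- by apply: measurable_funM => //; exact: measurable_funM.
- by move=> y; rewrite !mulr_ge0// ?exprn_ge0.
rewrite EFinD; apply: leeD.
  rewrite ge0_integralZ_EFin//; last by move=> y; exact: rsq_ge0.
  rewrite EFinM lee_wpmul2l//; apply: le_trans kdlt.
  rewrite nsq_tonelli_fst// le_eqVlt; apply/orP; left; apply/eqP; apply: eq_integral => y _.
  by rewrite (L2_nsq (L2sep y)).
rewrite ge0_integralZ_EFin//; last 2 first.
- exact: measurable_funM.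
- by move=> y; rewrite mulr_ge0// exprn_ge0.
rewrite EFinM lee_wpmul2l// ge0_integralZ_EFin ?exprn_ge0//.
rewrite EFinM lee_wpmul2l// ?lee_fin ?exprn_ge0//.
rewrite ge0_integral_sum_seq; last 2 first.
- by move=> gh ght; apply: measurable_funM => //; exact: mh.
- by move=> gh y; rewrite mulr_ge0// sqr_ge0.
rewrite -sumEFin big_seq [leRHS]big_seq; apply: lee_sum => gh ght.
under eq_integral do rewrite mulrC.
rewrite ge0_integralZ_EFin//; last 2 first.
- exact: mh.
- by move=> y; exact: sqr_ge0.
by rewrite -/(nsq _ _) (L2_nsq (L2t2 _ ght)) -EFinM mulrC.
Qed.

End basis.

(** For the error kernels below, Taylor polynomials provide these separated approximations
    explicitly. *)
Hypothesis approx : forall dlt : R, 0 < dlt -> exists t,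
  [/\ forall gh, gh \in t -> L2 mu gh.1, forall gh, gh \in t -> L2 nu gh.2 &
    (nsq (mu \x nu)%E (fun z => k z - separated t z)%R <= dlt%:E)%E].

(** Bessel on each section bounds every finite partial sum from above. For the reverse inequality,
    [t] is chosen close to [k] first, and then a finite subfamily nearly exhausting the first
    factors of [t]. *)
Lemma esum_kop (B : set (X -> R[i])) : orthonormal_basis mu B ->
  (\esum_(e in B) (L2norm nu (kop mu k e) ^+ 2) = nsq (mu \x nu) k)%E.
Proof.
move=> bB; have oB := orthonormal_basis_set bB.
under eq_esum do rewrite sqr_L2norm.
apply/eqP; rewrite eq_le; apply/andP; split.
  apply: ub_ereal_sup => _ [F [finF FB] <-].
  rewrite fsbig_finite//=; apply: (sum_nsq_kop_le oB); first exact: finmap.fset_uniq.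
  by move=> e; rewrite in_fset_set// => /set_mem /FB.
apply/lee_addgt0Pr => eps eps0.
have [|t [L2t1 L2t2 kt]] := approx (dlt := eps / 4); first by rewrite divr_gt0.
pose c := 2 * (2 ^+ size t * \sum_(gh <- t) rsq nu gh.2).
have c0 : 0 <= c.
  by rewrite !mulr_ge0 ?exprn_ge0// sumr_ge0// => gh _; exact: rsq_ge0.
(* The total defect is 2 (eps/4) + c dlt, at most eps; the [+ 1] avoids division by 0. *)
pose dlt := eps / 2 / (c + 1).
have c1 : 0 < c + 1 by rewrite ltr_pwDr.
have dlt0 : 0 < dlt by rewrite !divr_gt0.
have L2c : {in [seq (fun x => conjc (gh.1 x)) | gh <- t], forall g, L2 mu g}.
  by move=> _ /mapP[gh /L2t1 L2g ->]; exact: L2_conjc.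
have [s [us sB hs]] := simultaneous_parseval bB L2c dlt0.
have ghs gh : gh \in t ->
    rsq mu (fun x => conjc (gh.1 x) - fourier_proj mu (fun x => conjc (gh.1 x)) s x) <= dlt.
  move=> ght; rewrite (rsq_residual oB)//; last exact: L2_conjc (L2t1 _ ght).
  by apply/ltW/hs/mapP; exists gh.
have := nsq_kernel_le oB us sB L2t1 L2t2 (ltW dlt0) kt ghs.
move=> /le_trans; apply; apply: leeD.
  apply: esum_ge; exists [set` s].
    by split; [exact: finite_seq|move=> e /= /sB].
  by rewrite fsbig_seq.
rewrite lee_fin -mulr_suml.
have -> : 2 * (2 ^+ size t * ((\sum_(gh <- t) rsq nu gh.2) * dlt)) = c * dlt.
  by rewrite /c; ring.
have : c * dlt <= (c + 1) * dlt by rewrite ler_wpM2r ?(ltW dlt0)// lerDl.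
have -> : (c + 1) * dlt = eps / 2 by rewrite /dlt mulrC divfK// gt_eqF.
lra.
Qed.

Lemma hs_norm_kop : (hs_norm mu nu (kop mu k) = L2norm (mu \x nu) k)%E.
Proof.
rewrite /hs_norm; have [B bB] := orthonormal_basis_exists mu.
apply/eqP; rewrite eq_le; apply/andP; split.
  by apply: ub_ereal_sup => _ [B' bB' <-]; rewrite esum_kop// L2normE.
by apply: ereal_sup_ubound; exists B => //; rewrite esum_kop// L2normE.
Qed.

End hilbert_schmidt.

(** * Dimension and rank *)

Section dimension.
Context d (T : measurableType d) (R : realType) (mu : {measure set T -> \bar R}).
Implicit Types (U V : set (T -> R[i])).

Lemma ae_free_le_L2dim U n (e : 'I_n -> T -> R[i]) :
  (forall i, U (e i)) -> ae_free mu e -> (n%:R%:E <= L2dim mu U)%E.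
Proof. by move=> Ue fe; apply: ereal_sup_ubound; exists n => //; exists e. Qed.

Lemma L2dim_le U (b : \bar R) :
  (forall n (e : 'I_n -> T -> R[i]), (forall i, U (e i)) -> ae_free mu e ->
    (n%:R%:E <= b)%E) -> (L2dim mu U <= b)%E.
Proof. by move=> Ub; apply: ub_ereal_sup => _ [n [e [Ue fe]] <-]; exact: Ub fe. Qed.

Lemma L2dimS U V : U `<=` V -> (L2dim mu U <= L2dim mu V)%E.
Proof.
by move=> UV; apply: L2dim_le => n e Ue; apply: ae_free_le_L2dim => i; exact: UV.
Qed.

(** A bounded supremum of integers is attained; this is what makes [fine] and [truncn] in [dN]
    lossless. *)
Lemma L2dim_nat U (m : nat) : (L2dim mu U <= m%:R%:E)%E ->
  exists n : nat, L2dim mu U = n%:R%:E.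
Proof.
move=> Um; pose P n := `[< exists e : 'I_n -> T -> R[i],
  (forall i, U (e i)) /\ ae_free mu e >].
have P0 : exists n, P n.
  exists 0%N; apply/asboolP; exists (fun _ _ => 0).
  by split=> [[]//|c _ []].
have Pm n : P n -> (n <= m)%N.
  move=> /asboolP[e [Ue fe]]; have := le_trans (ae_free_le_L2dim Ue fe) Um.
  by rewrite lee_fin ler_nat.
have [n /asboolP[e [Ue fe]] nmax] := ex_maxnP P0 Pm.
exists n; apply/eqP; rewrite eq_le (ae_free_le_L2dim Ue fe) andbT.
apply: L2dim_le => k e' Ue' fe'; rewrite lee_fin ler_nat nmax//.
by apply/asboolP; exists e'.
Qed.

Lemma ae_free_span_le n m (e : 'I_n -> T -> R[i]) (g : 'I_m -> T -> R[i])
    (A : 'M[R[i]]_(n, m)) :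
  (forall i, e i = (fun x => \sum_j A i j * g j x)) -> ae_free mu e ->
  row_free A.
Proof.
move=> eA fe; apply/inj_row_free => v vA.
apply/rowP => i; rewrite mxE; move: i; apply: fe.
apply/nearW => x; rewrite /=.
under eq_bigr => i _ do rewrite eA mulr_sumr.
rewrite exchange_big big1//= => j _.
have /rowP/(_ j) := vA; rewrite !mxE => vAj.
under eq_bigr => i _ do rewrite mulrA.
by rewrite -mulr_suml vAj mul0r.
Qed.

Lemma lin_spanZ (G : set (T -> R[i])) (c : R[i]) f : lin_span G f ->
  lin_span G (fun x => c * f x).
Proof.
move=> [n [a [g [Gg ->]]]]; exists n, (fun i => c * a i), g; split=> //.
by apply/funext => x; rewrite mulr_sumr; apply: eq_bigr => i _; rewrite mulrA.
Qed.

Lemma lin_spanD (G : set (T -> R[i])) f h : lin_span G f -> lin_span G h ->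
  lin_span G (fun x => f x + h x).
Proof.
move=> [n [a [g [Gg ->]]]] [n' [a' [g' [Gg' ->]]]].
exists (n + n')%N, (fun i => match fintype.split i with inl j => a j | inr j => a' j end),
  (fun i => match fintype.split i with inl j => g j | inr j => g' j end).
split=> [i|]; first by case: (fintype.split i).
apply/funext => x; rewrite big_split_ord/=; congr (_ + _); apply: eq_bigr => i _.
  by rewrite (unsplitK (inl i)).
by rewrite (unsplitK (inr i)).
Qed.

Lemma lin_span0 (G : set (T -> R[i])) : lin_span G (fun _ => 0).
Proof.
exists 0%N, (fun _ => 0), (fun _ _ => 0); split; first by case.
by apply/funext => x; rewrite big_ord0.
Qed.

Lemma lin_span_gen (G : set (T -> R[i])) g : G g -> lin_span G g.
Proof.
move=> Gg; exists 1%N, (fun _ => 1), (fun _ => g); split=> //.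
by apply/funext => x; rewrite big_ord1 mul1r.
Qed.

Lemma lin_span_sum (G : set (T -> R[i])) (I : eqType) (s : seq I) (c : I -> R[i])
    (h : I -> T -> R[i]) : (forall i, i \in s -> lin_span G (h i)) ->
  lin_span G (fun x => \sum_(i <- s) c i * h i x).
Proof.
elim: s => [_|i s ih Gh].
  by under eq_fun do rewrite big_nil; exact: lin_span0.
under eq_fun do rewrite big_cons; apply: lin_spanD.
  exact: lin_spanZ (Gh _ (mem_head _ _)).
by apply: ih => j js; apply: Gh; rewrite in_cons js orbT.
Qed.

(** Merging repeated generators gives coordinates with respect to the fixed family [gam];
    independent elements then have a row-free coordinate matrix with [#|J|] columns. *)
Lemma L2dim_lin_span_le (J : finType) (gam : J -> T -> R[i]) (G : set (T -> R[i])) :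
  (forall g, G g -> exists j, g = gam j) ->
  (L2dim mu (lin_span G) <= #|J|%:R%:E)%E.
Proof.
move=> Gg; apply: L2dim_le => n e Ue fe; rewrite lee_fin ler_nat.
have coef f : lin_span G f -> exists a : J -> R[i], f = (fun x => \sum_j a j * gam j x).
  move=> [k [c [g [Ggi ->]]]].
  have /choice[h hP] i : exists j, g i = gam j by exact: Gg.
  exists (fun j => \sum_(i < k | h i == j) c i); apply/funext => x.
  rewrite (partition_big h xpredT)//=; apply: eq_bigr => j _.
  by rewrite mulr_suml; apply: eq_bigr => i /eqP <-; rewrite hP.
have /choice[a aP] i : exists a : J -> R[i], e i = (fun x => \sum_j a j * gam j x).
  exact: coef.
pose A := \matrix_(i < n, j < #|J|) a i (enum_val j).
have /eqP <- : row_free A.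
  apply: (@ae_free_span_le _ _ e (fun j => gam (enum_val j))) => // i.
  rewrite aP; apply/funext => x; rewrite (reindex (enum_val : 'I_#|J| -> J))/=; last first.
    by apply: onW_bij; exact: enum_val_bij.
  by apply: eq_bigr => j _; rewrite mxE.
exact: rank_leq_col.
Qed.

End dimension.

(** * Rank of operators with separated kernel *)

Section operator_rank.
Context d1 (X : measurableType d1) d2 (Y : measurableType d2) (R : realType).
Variables (mu : {measure set X -> \bar R}) (nu : {measure set Y -> \bar R}).

Definition separated_op m (g : 'I_m -> X -> R[i]) (h : 'I_m -> Y -> R[i])
    (f : X -> R[i]) (y : Y) : R[i] :=
  \sum_j cintegral mu setT (fun x => g j x * f x) * h j y.

Lemma op_rank_le_right m g h (G : set (Y -> R[i])) :
  (forall j : 'I_m, lin_span G (h j)) ->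
  (op_rank mu nu (separated_op g h) <= L2dim nu (lin_span G))%E.
Proof. by move=> Gh; apply: L2dimS => _ [f _ ->]; exact: lin_span_sum. Qed.

(** Independent values of the operator at [f i] make the matrix of pairings of [g j] with [f i] row
    free. Row rank being column rank, as many columns are independent, and then so are the
    corresponding functions [g j]. *)
Lemma op_rank_le_left m g h (U : set (X -> R[i])) :
  (forall j : 'I_m, U (g j)) -> (forall j, L2 mu (g j)) ->
  (op_rank mu nu (separated_op g h) <= L2dim mu U)%E.
Proof.
move=> Ug L2g; apply: L2dim_le => n e Ue fe.
have /choice[f fP] i : exists f, L2 mu f /\ e i = separated_op g h f.
  by have [f ? ?] := Ue i; exists f.
pose F := \matrix_(i < n, j < m) cintegral mu setT (fun x => g j x * f i x).
have rF : row_free F.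
  apply: (ae_free_span_le (g := h) _ fe) => i; rewrite (fP i).2.
  by apply/funext => y; apply: eq_bigr => j _; rewrite mxE.
have fF : row_full F^T by rewrite /row_full mxrank_tr.
(* [phi] selects the [g j] whose pairings form an invertible square matrix; a relation between these
   functions is a row vector killed by that matrix. *)
have Uphi := fullrowsub_unit fF; set phi := fullrankfun fF in Uphi.
apply: (@ae_free_le_L2dim _ _ _ _ _ _ (fun l => g (phi l))) => // c cg.
suff c0 : (\row_l c l) = 0 by move=> i; have /rowP/(_ i) := c0; rewrite !mxE.
apply: (can_inj (mulmxK Uphi)); rewrite mul0mx; apply/rowP => i; rewrite !mxE.
have L2cg : L2 mu (fun x => \sum_l c l * g (phi l) x).
  by apply: L2_sum => l; exact: L2Z.
transitivity (cintegral mu setT (fun x => (\sum_l c l * g (phi l) x) * f i x)).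
  transitivity (\sum_l cintegral mu setT (fun x => c l * (g (phi l) x * f i x))).
    apply: eq_bigr => l _; rewrite !mxE cintegralZ//.
    by apply: L2M_integrable => //; exact: (fP i).1.
  rewrite -cintegral_sum//; last first.
    move=> l; apply: cintegrableZ => //.
    by apply: L2M_integrable => //; exact: (fP i).1.
  by apply: eq_cintegral => x _; rewrite mulr_suml; apply: eq_bigr => l _; rewrite mulrA.
transitivity (cintegral mu setT (fun _ => 0)); last exact: cintegral0.
apply: ae_eq_cintegral.
- by apply: cmeasurableM; [exact: L2_meas L2cg|exact: L2_meas (fP i).1].
- exact: cmeasurable_cst.
- by apply: filterS cg => x /= xc xT; rewrite xc// mul0r.
Qed.

Lemma op_rank_kernel (A : (X -> R[i]) -> (Y -> R[i])) n (f : 'I_n.+1 -> X -> R[i]) :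
  (op_rank mu nu A <= n%:R%:E)%E -> (forall i, L2 mu (f i)) ->
  exists2 c : 'I_n.+1 -> R[i], exists i, c i != 0 &
    (fun y => \sum_i c i * A (f i) y) = cst 0 %[ae nu].
Proof.
move=> rA L2f; apply: contrapT => nc.
have : ae_free nu (fun i => A (f i)).
  move=> c c0 i; apply: contrapT => /eqP ci; apply: nc.
  by exists c => //; exists i.
move=> fr; have := rA; rewrite leNgt => /negP; apply.
apply: (@lt_le_trans _ _ n.+1%:R%:E); first by rewrite lte_fin ltr_nat.
by apply: (ae_free_le_L2dim _ fr) => i; exists (f i).
Qed.

End operator_rank.

(** * Taylor remainder of exp(it) *)

Section taylor.
Context {R : realType}.
Implicit Types (w z : R[i]) (s t : R).

Definition taylor_expi m : {poly R[i]} := \poly_(k < m) ('i%C ^+ k / k`!%:R).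

(* The remainder is estimated by induction on [m]: differentiating
   [s |-> Re (w * (exp (i s) - T_m s))] replaces [(m, w)] by [(m - 1, w * 'i)]. *)
Let re_taylor m w : {poly R} := \poly_(k < m) (complex.Re (w * 'i%C ^+ k) / k`!%:R).

Let deriv_re_taylor m w : (re_taylor m.+1 w)^`() = re_taylor m (w * 'i%C).
Proof.
apply/polyP => k; rewrite coef_deriv !coef_poly ltnS; case: ifP => _; last exact: mul0rn.
rewrite exprS mulrA factS natrM invfM -mulr_natr; field.
by rewrite nat1r !pnatr_eq0 -!lt0n fact_gt0.
Qed.

Let Re_remainder_le m w s : cabs w <= 1 -> 0 <= s ->
  complex.Re w * cos s - complex.Im w * sin s - (re_taylor m w).[s] <= s ^+ m / m`!%:R.
Proof.
elim: m w s => [w s w1 s0|m ih w s w1 s0].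
  rewrite /re_taylor poly_def big_ord0 horner0 subr0 expr0 divr1.
  have -> : complex.Re w * cos s - complex.Im w * sin s = complex.Re (w * expi s).
    by rewrite ReM.
  rewrite (le_trans (ler_norm _))// (le_trans (Re_le_cabs _))//.
  by rewrite cabsM cabs_expi mulr1.
(* [f] is s^(m+1)/(m+1)! minus the quantity to be bounded. It vanishes at 0, and its derivative is
   nonnegative by the induction hypothesis at [w * 'i]. *)
pose Q := (m.+1`!%:R^-1 *: 'X^(m.+1) + re_taylor m.+1 w : {poly R}).
pose f : R -> R := horner Q + ((- complex.Re w) \*: (cos : R -> R)) +
  (complex.Im w \*: (sin : R -> R)).
pose df (x : R) := Q^`().[x] + complex.Re w * sin x + complex.Im w * cos x.
have fE x : f x = Q.[x] - complex.Re w * cos x + complex.Im w * sin x.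
  by rewrite /f !fctE; congr (_ + _ + _); rewrite -mulNr.
have fd x : is_derive x (1 : R) f (df x).
  have H := is_deriveD (is_deriveD (is_derive_poly Q x)
    (is_deriveZ (- complex.Re w) (is_derive_cos x)))
    (is_deriveZ (complex.Im w) (is_derive_sin x)).
  apply: (is_derive_eq H); rewrite /df; congr (_ + _ + _).
  by rewrite [_ *: _]mulrNN.
have df0 x : 0 <= x -> 0 <= df x.
  move=> x0; have iw1 : cabs (w * 'i%C) <= 1.
    by rewrite cabsM (cabsE 'i%C)/= expr0n/= add0r expr1n sqrtr1 mulr1.
  have := ih _ x iw1 x0.
  have -> : complex.Re (w * 'i%C) = - complex.Im w by rewrite ReM/= mulr0 mulr1 sub0r.
  have -> : complex.Im (w * 'i%C) = complex.Re w by rewrite ImM/= mulr0 mulr1 addr0.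
  have -> : df x = x ^+ m / m`!%:R + (re_taylor m (w * 'i%C)).[x] +
      complex.Re w * sin x + complex.Im w * cos x.
    rewrite /df /Q derivD deriv_re_taylor derivZ derivXn hornerD hornerZ.
    rewrite hornerMn hornerXn/= factS natrM -[X in _ * X]mulr_natl; congr (_ + _ + _ + _).
    by rewrite invfM mulrACA mulVf ?mul1r ?pnatr_eq0// mulrC.
  lra.
have fc : continuous f.
  by move=> x; apply: differentiable_continuous; apply/derivable1_diffP; have [] := fd x.
suff : f 0 <= f s.
  rewrite !fE /Q !hornerD !hornerZ !hornerXn horner_coef0.
  rewrite coef_poly/= expr0 mulr1 fact0 divr1 expr0n/= cos0 sin0; lra.
have [->//|sn0] := eqVneq s 0.
have sp : 0 < s by rewrite lt_def sn0.
have [c] := MVT sp (fun x _ => fd x) (continuous_subspaceT fc).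
rewrite in_itv/= => /andP[c0 _] fs; rewrite -subr_ge0 fs.
by rewrite mulr_ge0 ?subr0 ?df0 ?(ltW c0).
Qed.

Let taylor_conjc m t :
  (taylor_expi m).[(- t)%:C] = conjc (taylor_expi m).[t%:C].
Proof.
rewrite !horner_poly (big_morph _ (@conjcD R) (conjc0 R)); apply: eq_bigr => k _.
have conjcX z n : conjc (z ^+ n) = conjc z ^+ n by rewrite rmorphXn.
rewrite !conjcM !conjcX conjc_real conjc_inv conjc_nat.
have -> : conjc 'i%C = - 'i%C :> R[i] by apply/eqP; rewrite eq_complex/= oppr0 !eqxx.
by rewrite rmorphN/= [(- 'i%C) ^+ k]exprNn [(- t%:C) ^+ k]exprNn; ring.
Qed.

(** Multiplying the remainder [z] by the unimodular number conj(z)/|z| makes it real, so the bound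
    on real parts gives the modulus with no loss of constant. Negative [t] is reached by complex
    conjugation. *)
Lemma taylor_expi_le m t :
  cabs (expi t - (taylor_expi m).[t%:C]) <= `|t| ^+ m / m`!%:R.
Proof.
wlog t0 : t / 0 <= t.
  move=> H; have [/H//|/ltW t0] := leP 0 t.
  have := H (- t); rewrite oppr_ge0 normrN => /(_ t0).
  rewrite taylor_conjc (_ : expi (- t) = conjc (expi t)); last by rewrite /expi cosN sinN.
  by rewrite -conjcN -conjcD cabs_conjc.
set z := _ - _; have [->|z0] := eqVneq z 0.
  by rewrite cabs0 divr_ge0// exprn_ge0.
have cz0 : cabs z != 0 by rewrite cabs_eq0.
pose w := conjc z * ((cabs z)^-1)%:C.
have w1 : cabs w <= 1.
  by rewrite cabsM cabs_conjc cabs_real ger0_norm ?invr_ge0 ?cabs_ge0// divff.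
have := Re_remainder_le m w1 t0; rewrite ger0_norm//; apply: le_trans.
have -> : cabs z = complex.Re (w * z).
  rewrite mulrAC [conjc z * z]mulrC mulc_conjc -rmorphM/=.
  by rewrite expr2 mulfK.
rewrite /z mulrBr ReB; apply: lerB; first by rewrite ReM.
rewrite !horner_poly mulr_sumr Re_sum; apply: ler_sum => k _.
rewrite (_ : w * ('i%C ^+ k / k`!%:R * t%:C ^+ k) =
    (w * 'i%C ^+ k) * (t ^+ k / k`!%:R)%:C); last first.
  by rewrite rmorphM/= rmorphXn/= fmorphV/= rmorph_nat; ring.
by rewrite [leRHS]ReM/= mulr0 subr0 mulrA mulrAC.
Qed.

End taylor.

(** * Weighted image measures *)

Section weighted_pushforward.
Context d (T : measurableType d) d' (U : measurableType d') (R : realType).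
Variables (mu : {measure set T -> \bar R}) (w : T -> R) (u : T -> U).
Hypotheses (mw : measurable_fun setT w) (w0 : forall x, 0 <= w x).
Hypothesis mu_u : measurable_fun setT u.

Let m (B : set U) : \bar R := (\int[mu]_x (\1_B (u x) * w x)%:E)%E.

Let mindic (B : set U) : measurable B -> measurable_fun setT (fun x => \1_B (u x) * w x : R).
Proof.
move=> mB; apply: measurable_funM => //.
by apply: (@measurableT_comp _ _ _ _ _ _ (\1_B : U -> R)) => //; exact: measurable_indic.
Qed.

Let windic0 (B : set U) x : 0 <= \1_B (u x) * w x.
Proof. by rewrite mulr_ge0. Qed.

Lemma weighted_pushforward_exists : (\int[mu]_x (w x)%:E < +oo)%E ->
  exists sigma : {finite_measure set U -> \bar R},
    forall B, measurable B -> sigma B = (\int[mu]_x (\1_B (u x) * w x)%:E)%E.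
Proof.
move=> wfin.
have m0 : m set0 = 0%E.
  by rewrite /m; under eq_integral do rewrite indicE in_set0 mul0r; rewrite integral0.
have mge0 B : (0 <= m B)%E by apply: integral_ge0 => x _; rewrite lee_fin.
have madd : semi_sigma_additive m.
  move=> F mF tF mUF.
  have mE B : m B = (\int[mu]_(x in u @^-1` B) (w x)%:E)%E.
    rewrite [RHS]integral_mkcond; apply: eq_integral => x _.
    rewrite patchE indicE (_ : (x \in u @^-1` B) = (u x \in B)); last first.
      by apply/idP/idP => /set_mem uxB; exact/mem_set.
    by case: ifP => _; rewrite ?mul1r ?mul0r.
  have mu1 B : measurable B -> measurable (u @^-1` B).
    by move=> mB; rewrite -[X in measurable X]setTI; exact: mu_u.
  rewrite mE preimage_bigcup ge0_integral_bigcup//; last 4 first.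
  - by move=> n; exact: mu1.
  - by apply/measurable_EFinP; exact: measurable_funS mw.
  - by move=> x _; rewrite lee_fin.
  - apply/trivIsetP => a b _ _ ab; rewrite -preimage_setI.
    by have /trivIsetP/(_ a b I I ab) -> := tF; rewrite preimage_set0.
  under [X in _ --> X]eq_eseriesr do rewrite -mE.
  by apply: is_cvg_nneseries => n _ _.
pose M : {measure set U -> \bar R} := HB.pack m (isMeasure.Build _ _ _ m m0 mge0 madd).
have Mfin : fin_num_fun M.
  move=> B mB; rewrite ge0_fin_numE//; apply: le_lt_trans wfin.
  apply: ge0_le_integral => //.
  - by move=> x _; rewrite lee_fin.
  - by apply/measurable_EFinP; exact: mindic.
  - exact/measurable_EFinP.
  - by move=> x _; rewrite lee_fin ler_piMl// indic_le1.
pose F : {finite_measure set U -> \bar R} :=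
  HB.pack m (isMeasure.Build _ _ _ m m0 mge0 madd) (Measure_isFinite.Build _ _ _ M Mfin).
by exists F.
Qed.

Import HBNNSimple.

Variable sigma : {measure set U -> \bar R}.
Hypothesis sigmaE : forall B, measurable B ->
  sigma B = (\int[mu]_x (\1_B (u x) * w x)%:E)%E.

(** Change of variables: true on indicators by the defining property of [sigma], then on simple
    functions by linearity, then in the limit by monotone convergence. *)
Lemma ge0_integral_weighted_pushforward (f : U -> R) :
  measurable_fun setT f -> (forall t, 0 <= f t) ->
  (\int[sigma]_t (f t)%:E = \int[mu]_x (f (u x) * w x)%:E)%E.
Proof.
move=> mf f0; have mEf : measurable_fun setT (EFin \o f) by exact/measurable_EFinP.
pose f_ := nnsfun_approx measurableT mEf.
have cf t : (EFin \o f_^~ t) @ \oo --> (f t)%:E.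
  by apply: (cvg_nnsfun_approx measurableT mEf) => //= x _; rewrite lee_fin.
transitivity (limn (fun n => \int[sigma]_t (f_ n t)%:E)%E).
  rewrite -monotone_convergence//.
  - by apply: eq_integral => t _; apply/esym/cvg_lim => //; exact: cf.
  - by move=> n; exact/measurable_EFinP/measurable_funP.
  - by move=> n t _; rewrite lee_fin.
  - by move=> t _ a b ab; rewrite lee_fin; exact/lefP/nd_nnsfun_approx.
rewrite [X in limn X](_ : _ = (fun n => \int[mu]_x (f_ n (u x) * w x)%:E)%E).
  rewrite -monotone_convergence//; last 3 first.
  - move=> n; apply/measurable_EFinP; apply: measurable_funM => //.
    by apply: measurableT_comp => //; exact: measurable_funP.
  - by move=> n x _; rewrite lee_fin mulr_ge0.
  - move=> x _ a b ab; rewrite lee_fin ler_wpM2r//.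
    exact/lefP/nd_nnsfun_approx.
  apply: eq_integral => x _; apply/cvg_lim => //.
  under eq_fun do rewrite EFinM muleC.
  by rewrite EFinM muleC; apply: cvgeZl => //; exact: cf.
apply/funext => n.
transitivity (\sum_(k \in range (f_ n)) \int[mu]_x (k * (\1_(f_ n @^-1` [set k]) (u x) * w x))%:E)%E.
  under eq_integral do rewrite fimfunE -fsumEFin//.
  rewrite ge0_integral_fsum//; last 2 first.
  - by move=> k; exact/measurable_EFinP/measurable_funM.
  - by move=> k t _; rewrite nnfun_muleindic_ge0.
  apply: eq_fsbigr => k /[!inE] -[t _ <-].
  rewrite integralZl_indic_nnsfun// integral_indic//= setIT sigmaE//.
  by rewrite ge0_integralZ_EFin//; exact: mindic.
rewrite -ge0_integral_fsum//.
- apply: eq_integral => x _; rewrite fsumEFin// [in RHS]fimfunE; congr EFin.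
  by rewrite !fsbig_finite//= mulr_suml; apply: eq_bigr => k _; rewrite mulrA.
- by move=> k; apply/measurable_EFinP; apply: measurable_funM => //; exact: mindic.
- move=> k x _; rewrite lee_fin; have [k0|k0] := leP 0 k.
    by rewrite mulr_ge0.
  rewrite preimage_nnfun0// indicE in_set0 mul0r mulr0//.
Qed.

End weighted_pushforward.

(** * Moore-Penrose inverse and polynomial least squares *)

Section moore_penrose_existence.
Local Open Scope sesquilinear_scope.
Context (C : numClosedFieldType).

Lemma trmxC_mul m n p (A : 'M[C]_(m, n)) (B : 'M[C]_(n, p)) :
  (A *m B) ^t* = B ^t* *m A ^t*.
Proof. by rewrite trmx_mul map_mxM. Qed.

(** [mpinv] is defined by choice, so an inverse has to be exhibited: diagonalise unitarily and
    invert the eigenvalues. *)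
Lemma normalmx_mpinv n (A : 'M[C]_n) : A \is normalmx -> is_mpinv A (mpinv A).
Proof.
move=> /orthomx_spectralP; set V := spectralmx A; set x := spectral_diag A => AE.
have uV : V \is unitarymx := spectral_unitarymx A.
have VE : invmx V = V ^t* := invmx_unitary uV.
have VV : V *m V ^t* = 1%:M by apply/unitarymxP.
rewrite VE in AE.
(* The convention 0^-1 = 0 makes this correct on zero eigenvalues, that is, for singular matrices
   too. *)
pose y := \row_j (x 0 j)^-1.
have xM (a b : 'rV[C]_n) : V ^t* *m diag_mx a *m V *m (V ^t* *m diag_mx b *m V) =
    V ^t* *m diag_mx (\row_j (a 0 j * b 0 j)) *m V.
  by rewrite !mulmxA -(mulmxA _ V) VV mulmx1 -(mulmxA _ (diag_mx a)) mulmx_diag.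
have xC (a : 'rV[C]_n) : (forall j, (a 0 j)^* = a 0 j) ->
    (V ^t* *m diag_mx a *m V) ^t* = V ^t* *m diag_mx a *m V.
  move=> aR; rewrite !trmxC_mul trmxCK mulmxA; congr (_ *m _ *m _).
  by rewrite tr_diag_mx map_diag_mx; congr diag_mx; apply/rowP => j; rewrite mxE; exact: aR.
have real01 (a : C) : (a / a)^* = a / a.
  by have [->|a0] := eqVneq a 0; rewrite ?mul0r ?rmorph0// divff// rmorph1.
suff : is_mpinv A (V ^t* *m diag_mx y *m V).
  by move=> AB; apply: (xgetPex 0); exists (V ^t* *m diag_mx y *m V).
have mulVxx (a : C) : a * a^-1 * a = a.
  by have [->|a0] := eqVneq a 0; rewrite ?mulr0// mulfVK.
have mulVyy (a : C) : a^-1 * a * a^-1 = a^-1.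
  by have [->|a0] := eqVneq a 0; rewrite ?invr0 ?mulr0// mulVf// mul1r.
split; rewrite AE ?xM.
- by congr (_ *m diag_mx _ *m _); apply/rowP => j; rewrite !mxE mulVxx.
- by congr (_ *m diag_mx _ *m _); apply/rowP => j; rewrite !mxE mulVyy.
- by rewrite xC// => j; rewrite !mxE real01.
- by rewrite xC// => j; rewrite !mxE mulrC real01.
Qed.

End moore_penrose_existence.

(** * Least squares with a possibly singular Gram matrix *)

Section least_squares.
Local Open Scope sesquilinear_scope.
Context (R : realType) (n : nat).
Implicit Types (G : 'M[R[i]]_n) (x y b d : 'cV[R[i]]_n).

Definition dotc x y : R[i] := (x ^t* *m y) 0 0.

Lemma dotcE x y : dotc x y = \sum_k conjc (x k 0) * y k 0.
Proof. by rewrite /dotc mxE; apply: eq_bigr => k _; rewrite !mxE. Qed.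

Lemma dotcDl x y z : dotc (x + y) z = dotc x z + dotc y z.
Proof. by rewrite !dotcE -big_split/=; apply: eq_bigr => k _; rewrite mxE conjcD mulrDl. Qed.

Lemma dotcDr x y z : dotc z (x + y) = dotc z x + dotc z y.
Proof. by rewrite /dotc mulmxDr mxE. Qed.

Lemma dotcZl (a : R[i]) x y : dotc (a *: x) y = conjc a * dotc x y.
Proof. by rewrite !dotcE mulr_sumr; apply: eq_bigr => k _; rewrite mxE conjcM mulrA. Qed.

Lemma dotcZr (a : R[i]) x y : dotc x (a *: y) = a * dotc x y.
Proof. by rewrite /dotc -scalemxAr mxE. Qed.

Lemma dotcBl x y z : dotc (x - y) z = dotc x z - dotc y z.
Proof.
by rewrite -scaleN1r dotcDl dotcZl conjcN conjc1 mulN1r.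
Qed.

Lemma dotcBr x y z : dotc z (x - y) = dotc z x - dotc z y.
Proof. by rewrite -scaleN1r dotcDr dotcZr mulN1r. Qed.

Lemma dotc_conj x y : dotc y x = conjc (dotc x y).
Proof.
rewrite !dotcE (big_morph _ (@conjcD R) (conjc0 R)); apply: eq_bigr => k _.
by rewrite conjcM conjcK mulrC.
Qed.

Lemma dotc0l x : dotc 0 x = 0.
Proof. by rewrite /dotc trmx0 map_mx0 mul0mx mxE. Qed.

Lemma dotc0r x : dotc x 0 = 0.
Proof. by rewrite /dotc mulmx0 mxE. Qed.

Lemma dotc_eq0 x : complex.Re (dotc x x) = 0 -> x = 0.
Proof.
rewrite dotcE Re_sum => /eqP.
have F0 (k : 'I_n) : true -> 0 <= complex.Re (conjc (x k 0) * x k 0).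
  by rewrite mulrC mulc_conjc sqr_ge0.
rewrite (psumr_eq0 _ F0) => /allP x0; apply/colP => k; rewrite mxE.
have /= := x0 k (mem_index_enum _).
by rewrite mulrC mulc_conjc/= sqrf_eq0 cabs_eq0 => /eqP.
Qed.

Lemma dotc_adj G x y : G ^t* = G -> dotc x (G *m y) = dotc (G *m x) y.
Proof. by move=> GG; rewrite /dotc trmxC_mul GG mulmxA. Qed.

(* Since the quadratic functional is bounded below, [b] is orthogonal to the
   kernel of [G], hence in its range: [G *m mpinv G] fixes [b]. *)
Lemma least_squares G b (a : R) (Q : 'cV[R[i]]_n -> R) :
  G ^t* = G -> (forall d, 0 <= Q d) ->
  (forall d, (Q d)%:C = a%:C - dotc d b - conjc (dotc d b) + dotc d (G *m d)) ->
  (forall d, Q (mpinv G *m b) <= Q d) /\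
  (Q (mpinv G *m b))%:C = a%:C - dotc b (mpinv G *m b).
Proof.
move=> GG Q0 QE; have nG : G \is normalmx by apply/normalmxP; rewrite GG.
have [mp1 mp2 mp3 mp4] := normalmx_mpinv nG.
set c := mpinv G *m b.
have QR d : Q d = a - 2 * complex.Re (dotc d b) + complex.Re (dotc d (G *m d)).
  have /(congr1 (@complex.Re R)) := QE d.
  by rewrite ReD !ReB/= Re_conjc => ->; ring.
have Qs d (s : R) :
    0 <= a - 2 * s * complex.Re (dotc d b) + s ^+ 2 * complex.Re (dotc d (G *m d)).
  have := Q0 (s%:C *: d); rewrite QR dotcZl -scalemxAr dotcZr dotcZl conjc_real.
  by rewrite !ReM/= !mul0r !subr0; congr (_ <= _); ring.
have a0 : 0 <= a by have := Qs 0 0; rewrite mulr0 mul0r subr0 expr0n mul0r addr0.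
(* Conjugate transpose of the first Penrose identity, as [G] and [G *m mpinv G] are Hermitian. *)
have GP : G *m (G *m mpinv G) = G.
  by rewrite -mp3 -[X in X *m _]GG -trmxC_mul mp1.
have Gc : G *m c = b.
  pose v := b - G *m c.
  have Gv : G *m v = 0 by rewrite mulmxBr /c !mulmxA -(mulmxA G) GP subrr.
  have vb : dotc v b = dotc v v.
    have -> : b = v + G *m c by rewrite /v subrK.
    by rewrite [in LHS]dotcDr (dotc_adj _ _ GG) Gv dotc0l addr0.
  suff : v = 0 by move=> /eqP; rewrite subr_eq0 => /eqP.
  apply: dotc_eq0; set beta := complex.Re _; apply: contrapT => /eqP beta0.
  (* The residual [v] lies in the kernel of [G], so [Q] is affine along it; this multiple of [v]
     would give [Q] the value -1. *)
  have := Qs v ((a + 1) / (2 * beta)); rewrite vb -/beta Gv.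
  rewrite dotc0r mulr0 addr0.
  have -> : 2 * ((a + 1) / (2 * beta)) * beta = a + 1 by field.
  by lra.
have psd d : 0 <= complex.Re (dotc d (G *m d)).
  set q := complex.Re _; rewrite leNgt; apply/negP => q0.
  (* Adding the inequalities at [s] and [- s] cancels the linear term and leaves 2a - 2(a + 1) >=
     0. *)
  pose s := Num.sqrt ((a + 1) / - q).
  have s2 : s ^+ 2 = (a + 1) / - q.
    by rewrite sqr_sqrtr// divr_ge0 ?oppr_ge0 ?(ltW q0)// addr_ge0.
  have := Qs d s; have := Qs d (- s); rewrite sqrrN s2 -/q.
  have -> : (a + 1) / - q * q = - (a + 1) by field; rewrite lt_eqF.
  by lra.
have cb : dotc c b = dotc b c by rewrite -Gc dotc_adj.
split=> [d|]; last by rewrite QE Gc -dotc_conj cb; ring.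
(* Since [G *m c = b], this quadratic form is exactly [Q d - Q c]. *)
have := psd (d - c); rewrite mulmxBr Gc.
have -> : dotc (d - c) (G *m d - b) =
    dotc d (G *m d) - dotc d b - conjc (dotc d b) + dotc c b.
  rewrite -dotc_conj dotcBl !dotcBr [dotc c (G *m d)]dotc_adj// Gc; ring.
rewrite ReD !ReB Re_conjc !QR Gc; lra.
Qed.

End least_squares.

(** * Polynomial approximation through the moments of sigma *)

Section moments.
Local Open Scope sesquilinear_scope.
Context (R : realType) (sigma : {finite_measure set (measurableTypeR R) -> \bar R}).
Variables (M C : R).
Hypotheses (M0 : 0 <= M) (C0 : 0 <= C).
Hypothesis sigmaM : sigma `[- M, M]%classic = (C ^+ 2)%:E.

Let D : set (measurableTypeR R) := `[- M, M]%classic.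

Let mD : measurable D.
Proof. exact: measurable_itv. Qed.

Let D_norm (t : R) : D t -> `|t| <= M.
Proof. by rewrite /D/= in_itv/= ler_norml. Qed.

Let integrable_bounded (f : measurableTypeR R -> R[i]) (K : R) : cmeasurable f ->
  (forall t, D t -> cabs (f t) <= K) -> cintegrable sigma D f.
Proof.
move=> mf fK; apply: (cintegrable_le (g := fun=> K)) => //.
exact: finite_measure_integrable_cst.
Qed.

Let cm_pow n : cmeasurable (fun t : measurableTypeR R => ((t : R) ^+ n)%:C).
Proof. by apply: cmeasurable_real; apply: measurable_funX; exact: measurable_id. Qed.

Let cm_expi : cmeasurable (fun t : measurableTypeR R => expi (t : R)).
Proof. by apply: cmeasurable_expi; exact: measurable_id. Qed.

Let cabs_pow n (t : R) : D t -> cabs (t ^+ n)%:C <= M ^+ n.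
Proof.
move=> /D_norm tM; rewrite cabs_real normrX.
by rewrite lerXn2r ?nnegrE ?normr_ge0.
Qed.

Let int_pow n : cintegrable sigma D (fun t => ((t : R) ^+ n)%:C).
Proof. exact: (integrable_bounded (cm_pow n) (fun t => @cabs_pow n t)). Qed.

Let int_pow_expi n : cintegrable sigma D (fun t => ((t : R) ^+ n)%:C * expi (t : R)).
Proof.
apply: (@integrable_bounded _ (M ^+ n)); first exact: cmeasurableM.
by move=> t Dt; rewrite cabsM cabs_expi mulr1 cabs_pow.
Qed.

Definition coef_poly_of N (d : 'cV[R[i]]_N) : {poly R[i]} := \sum_(k < N) d k 0 *: 'X^k.

Let horner_coef_poly_of N (d : 'cV[R[i]]_N) (t : R) :
  (coef_poly_of d).[t%:C] = \sum_(k < N) d k 0 * (t ^+ k)%:C.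
Proof.
rewrite horner_sum; apply: eq_bigr => k _.
by rewrite hornerZ hornerXn rmorphXn.
Qed.

Lemma measurable_approx_integrand (P : {poly R[i]}) :
  cmeasurable (fun t : measurableTypeR R => expi (t : R) - P.[(t : R)%:C]).
Proof.
apply: cmeasurableB => //; under eq_fun do rewrite horner_coef.
apply: cmeasurable_sum => k; apply: cmeasurableM; first exact: cmeasurable_cst.
by under eq_fun do rewrite -rmorphXn/=.
Qed.

Lemma approx_error_sqr (P : {poly R[i]}) : approx_error sigma M P ^+ 2 =
  \int[sigma]_(t in `[- M, M]%classic) cabs (expi (t : R) - P.[(t : R)%:C]) ^+ 2.
Proof. by rewrite sqr_sqrtr// Rintegral_ge0// => t _; exact: sqr_ge0. Qed.

Lemma integral_approx_error (P : {poly R[i]}) :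
  (\int[sigma]_(t in `[(- M)%R, M]%classic)
     (cabs (expi (t : R) - P.[(t : R)%:C]) ^+ 2)%:E = (approx_error sigma M P ^+ 2)%:E)%E.
Proof.
rewrite approx_error_sqr /Rintegral fineK//; apply: integrable_fin_num => //.
pose B := 1 + \sum_(i < size P) cabs P`_i * M ^+ i.
have mP := measurable_approx_integrand P.
have [| |iP _] := @integrable_bounded
  (fun t => (cabs (expi (t : R) - P.[(t : R)%:C]) ^+ 2)%:C) (B ^+ 2).
  exact/cmeasurable_real/measurable_cabs_sqr.
  move=> t Dt; rewrite cabs_real ger0_norm ?sqr_ge0// lerXn2r ?nnegrE ?cabs_ge0//.
    by rewrite addr_ge0// sumr_ge0// => i _; rewrite mulr_ge0 ?cabs_ge0 ?exprn_ge0.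
  apply: le_trans (cabsD _ _) _; rewrite cabs_expi cabsN lerD2l horner_coef.
  apply: le_trans (cabs_sum _ _ _) _; apply: ler_sum => i _.
  by rewrite cabsM ler_wpM2l ?cabs_ge0// -rmorphXn cabs_pow.
exact: iP.
Qed.

(** Expansion of |e - P|^2 with |e| = 1: the constant term integrates to the mass C^2, the cross
    terms to moments against exp(it), the square to the Gram form. It is the shape that
    [least_squares] expects. *)
Lemma approx_error_expand N (d : 'cV[R[i]]_N) :
  (approx_error sigma M (coef_poly_of d) ^+ 2)%:C =
  (C ^+ 2)%:C - dotc d (moment_vec sigma M N) -
  conjc (dotc d (moment_vec sigma M N)) + dotc d (moment_mx sigma M N *m d).
Proof.
rewrite approx_error_sqr -cintegral_real.
pose eP (t : measurableTypeR R) : R[i] :=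
  \sum_(k < N) conjc (d k 0) * (((t : R) ^+ k)%:C * expi (t : R)).
pose PP (t : measurableTypeR R) : R[i] :=
  \sum_(j < N) \sum_(k < N) (conjc (d j 0) * d k 0) * ((t : R) ^+ (j + k))%:C.
have ieP : cintegrable sigma D eP.
  by apply: cintegrable_sum => // k; exact: cintegrableZ.
have iPP : cintegrable sigma D PP.
  apply: cintegrable_sum => // j; apply: cintegrable_sum => // k.
  exact: cintegrableZ.
have i1 : cintegrable sigma D (fun=> 1).
  apply: (@integrable_bounded _ 1); first exact: cmeasurable_cst.
  by move=> t _; rewrite (cabs_real 1) normr1.
transitivity (cintegral sigma D (fun t => 1 - eP t - conjc (eP t) + PP t)).
  apply: eq_cintegral => t _; rewrite -mulc_conjc horner_coef_poly_of.
  set e := expi t; have e1 : e * conjc e = 1 by rewrite mulc_conjc cabs_expi expr1n.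
  set P := \sum_(k < N) _.
  have -> : eP t = e * conjc P.
    rewrite /P (big_morph _ (@conjcD R) (conjc0 R)) mulr_sumr; apply: eq_bigr => k _.
    by rewrite conjcM conjc_real /e; ring.
  have -> : PP t = P * conjc P.
    rewrite /P (big_morph _ (@conjcD R) (conjc0 R)) mulrC mulr_suml.
    apply: eq_bigr => j _; rewrite mulr_sumr; apply: eq_bigr => k _.
    by rewrite conjcM conjc_real exprD rmorphM/=; ring.
  by rewrite conjcM conjcK conjcD conjcN -e1; ring.
have ieP' := cintegrable_conjc mD ieP.
have sub (f g : measurableTypeR R -> R[i]) : cintegrable sigma D f -> cintegrable sigma D g ->
    cintegrable sigma D (fun t => f t - g t) /\
    cintegral sigma D (fun t => f t - g t) = cintegral sigma D f - cintegral sigma D g.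
  move=> fi gi; under eq_fun do rewrite -mulN1r.
  have gi' := cintegrableZ (-1) mD gi; split; first exact: cintegrableD.
  by rewrite cintegralD// cintegralZ// mulN1r.
have [i2 _] := sub _ _ i1 ieP.
have [i3 _] := sub _ _ i2 ieP'.
rewrite cintegralD// (sub _ _ i2 ieP').2 (sub _ _ i1 ieP).2 cintegral_conjc//.
have -> : cintegral sigma D (fun=> 1) = (C ^+ 2)%:C.
  rewrite (cintegral_real sigma D (fun=> 1)); congr (_%:C).
  by rewrite Rintegral_cst// mul1r; exact: (congr1 fine sigmaM).
have -> : cintegral sigma D eP = dotc d (moment_vec sigma M N).
  rewrite cintegral_sum//; last by move=> k; exact: cintegrableZ.
  by rewrite dotcE; apply: eq_bigr => k _; rewrite cintegralZ// !mxE.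
congr (_ + _); rewrite cintegral_sum//; last first.
  by move=> j; apply: cintegrable_sum => // k; exact: cintegrableZ.
rewrite dotcE; apply: eq_bigr => j _; rewrite cintegral_sum//; last first.
  by move=> k; exact: cintegrableZ.
rewrite mxE mulr_sumr; apply: eq_bigr => k _.
by rewrite cintegralZ// cintegral_real !mxE; ring.
Qed.

Lemma moment_mx_herm N : (moment_mx sigma M N) ^t* = moment_mx sigma M N.
Proof.
apply/matrixP => j k; rewrite !mxE addnC.
exact: conjc_real.
Qed.

Lemma approx_error_ge0 P : 0 <= approx_error sigma M P.
Proof. exact: sqrtr_ge0. Qed.

Lemma best_approximation N : (0 < N)%N ->
  let c := mpinv (moment_mx sigma M N) *m moment_vec sigma M N in
  [/\ (size (coef_poly_of c) <= N)%N,
      approx_error sigma M (coef_poly_of c) = Ebest sigma M C N,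
      (forall P : {poly R[i]}, (size P <= N)%N ->
        Ebest sigma M C N <= approx_error sigma M P) &
      (Ebest sigma M C N ^+ 2)%:C = (C ^+ 2)%:C - dotc (moment_vec sigma M N) c].
Proof.
case: N => // N _ c.
have [cmin cE] := least_squares (moment_mx_herm N.+1)
  (fun d => sqr_ge0 (approx_error sigma M (coef_poly_of d)))
  (@approx_error_expand N.+1).
have sz (d : 'cV[R[i]]_N.+1) : (size (coef_poly_of d) <= N.+1)%N.
  rewrite (leq_trans (size_sum _ _ _))//; apply/bigmax_leqP => k _.
  by rewrite (leq_trans (size_scale_leq _ _))// size_polyXn.
have le (P : {poly R[i]}) : (size P <= N.+1)%N ->
    approx_error sigma M (coef_poly_of c) <= approx_error sigma M P.
  move=> sP; have -> : P = coef_poly_of (\col_(k < N.+1) P`_k).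
    apply/polyP => i; rewrite coef_sum; have [iN|Ni] := ltnP i N.+1.
      rewrite (bigD1 (Ordinal iN))//= mxE coefZ coefXn eqxx mulr1 big1 ?addr0// => k ki.
      rewrite coefZ coefXn (_ : (i == k) = false) ?mulr0//.
      by apply/negbTE; apply: contraNneq ki => ik; exact/eqP/val_inj/esym.
    rewrite nth_default ?(leq_trans sP)// big1// => k _.
    by rewrite coefZ coefXn gtn_eqF ?mulr0// (leq_trans _ Ni).
  rewrite -(@ler_pXn2r _ 2)// ?nnegrE ?approx_error_ge0//; exact: cmin.
have EE : approx_error sigma M (coef_poly_of c) = Ebest sigma M C N.+1.
  rewrite /Ebest; apply/eqP; rewrite eq_le; apply/andP; split.
    apply: lb_le_inf; first by exists (approx_error sigma M (coef_poly_of c)), (coef_poly_of c) => //; exact: sz.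
    by move=> _ [P sP <-]; exact: le.
  apply: ge_inf; last by exists (coef_poly_of c) => //; exact: sz.
  by exists 0 => _ [P _ <-]; exact: approx_error_ge0.
split => //; first by move=> P sP; rewrite -EE le.
by rewrite -EE cE.
Qed.

End moments.

(** * Singular values and spectral projections under finite-rank approximation *)

Section bounded_operators.
Context d1 (X : measurableType d1) d2 (Y : measurableType d2) (R : realType).
Variables (mu : {measure set X -> \bar R}) (nu : {measure set Y -> \bar R}).
Variable A : (X -> R[i]) -> (Y -> R[i]).
Hypothesis bA : bounded_op mu nu A.

Lemma bounded_op_null h : L2 mu h -> h = cst 0 %[ae mu] -> A h = cst 0 %[ae nu].
Proof.
move=> L2h h0; have [AL2 _ [k Ak]] := bA; have mAh := L2_meas (AL2 _ L2h).
apply: (@nsq_eq0 _ _ _ nu _ mAh).1.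
have := Ak _ L2h; rewrite [L2norm mu h]L2normE.
rewrite ((@nsq_eq0 _ _ _ mu _ (L2_meas L2h)).2 h0) poweR0r ?invr_eq0// mule0.
move=> Ah0; rewrite -sqr_L2norm (_ : L2norm nu (A h) = 0%E) ?expeS ?mul0e//.
by apply/eqP; rewrite eq_le Ah0 L2normE poweR_ge0.
Qed.

(** Meant for spectral projections: they are known only abstractly and are linear only up to null
    sets, unlike kernel operators. *)
Lemma bounded_op_sum n (c : 'I_n -> R[i]) (f : 'I_n -> X -> R[i]) :
  (forall i, L2 mu (f i)) ->
  A (fun x => \sum_i c i * f i x) = (fun y => \sum_i c i * A (f i) y) %[ae nu].
Proof.
move=> L2f; have [_ Alin _] := bA; elim: (index_enum _) => [|i s ih].
  have -> : (fun x => \sum_(i <- [::]) c i * f i x) = (fun=> 0).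
    by apply/funext => x; rewrite big_nil.
  have := bounded_op_null (L20 mu) (ae_eq_refl _ _ _).
  by apply: filterS => y /= + yT => ->//; rewrite big_nil.
have -> : (fun x => \sum_(j <- i :: s) c j * f j x) =
    (fun x => c i * f i x + \sum_(j <- s) c j * f j x).
  by apply/funext => x; rewrite big_cons.
have L2s : L2 mu (fun x => \sum_(j <- s) c j * f j x) by apply: L2_sum => j; exact: L2Z.
apply: filterS2 ih (Alin (c i) (f i) _ (L2f i) L2s) => y /= + + yT.
by move=> /(_ yT) ih /(_ yT) ->; rewrite ih big_cons.
Qed.

End bounded_operators.

Section gram.
Context d (T : measurableType d) (R : realType) (mu : {measure set T -> \bar R}).

(** Applied twice with the same coefficients: to eigenvectors, where [l] is 1, and to their images,
    where [l] is the eigenvalue. *)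
Lemma rsq_orthogonal_sum n (c : 'I_n -> R[i]) (u : 'I_n -> T -> R[i]) (l : 'I_n -> R) :
  (forall i, L2 mu (u i)) ->
  (forall i j, L2inner mu (u i) (u j) = (l j)%:C * (i == j)%:R) ->
  rsq mu (fun x => \sum_i c i * u i x) = \sum_i cabs (c i) ^+ 2 * l i.
Proof.
move=> L2u uu; apply: complexI; rewrite -inner_self.
have L2cu i : L2 mu (fun x => c i * u i x) by exact: L2Z.
have L2S : L2 mu (fun x => \sum_i c i * u i x) by exact: L2_sum.
rewrite inner_suml// rmorph_sum/=; apply: eq_bigr => i _.
rewrite innerZl// inner_conj// inner_suml// (bigD1 i)//= big1 ?addr0; last first.
  by move=> j ji; rewrite innerZl// uu (negbTE ji) !mulr0.
rewrite innerZl// uu eqxx mulr1 conjcM conjc_real mulrA mulc_conjc.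
by apply/eqP; rewrite eq_complex /= !mulr0 !mul0r subr0 addr0 !eqxx.
Qed.

End gram.

(** The function [g - a] is positive almost everywhere with integral at most 0, so it also vanishes
    almost everywhere; both hold together only if the whole space is null. *)
Lemma measure_eq0_of_lt_integral d (T : measurableType d) (R : realType)
    (m : {finite_measure set T -> \bar R}) (g : T -> R) (a : R) :
  m.-integrable setT (fun t => (g t)%:E) -> m (~` [set t | a < g t]) = 0%E ->
  \int[m]_(t in setT) g t <= a * fine (m setT) -> m setT = 0%E.
Proof.
move=> ig m0 le_a.
have mg : measurable_fun setT g by apply/measurable_EFinP; exact: measurable_int ig.
have fm : m setT \is a fin_num by exact: fin_num_measure.
have ia : m.-integrable setT (fun=> a%:E) by apply: finite_measure_integrable_cst.
have ib : m.-integrable setT (fun t => (g t - a)%:E).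
  by under eq_fun do rewrite EFinB; exact: integrableB.
have a_ae : \forall t \ae m, a < g t.
  exists (~` [set t | a < g t]); split => //; apply: measurableC.
  rewrite -[X in measurable X]setTI.
  rewrite (_ : [set t | a < g t] = g @^-1` `]a, +oo[%classic); last first.
    by rewrite set_itvoy.
  by apply: mg => //; exact: measurable_itv.
have int0 : (\int[m]_(t in setT) `|(g t - a)%:E| = 0)%E.
  apply/eqP; rewrite eq_le integral_ge0// andbT.
  rewrite (ae_eq_integral (fun t => (g t - a)%:E))//.
  - under eq_integral do rewrite EFinB.
    rewrite integralB//.
    have -> : (\int[m]_(t in setT) a%:E = (a * fine (m setT))%:E)%E.
      by rewrite integral_cst// EFinM; congr (_ * _)%E; rewrite fineK.
    have -> : (\int[m]_t (g t)%:E = (\int[m]_t g t)%:E)%E.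
      by rewrite /Rintegral fineK//; exact: integrable_fin_num.
    by rewrite -EFinB lee_fin subr_le0.
  - by apply: measurableT_comp => //; exact: (measurable_int _ ib).
  - exact: (measurable_int _ ib).
  - by apply: filterS a_ae => t lt_a _; rewrite gee0_abs// lee_fin subr_ge0 ltW.
have := (@ae_eq_integral_abs _ _ _ m setT measurableT _ (measurable_int _ ib)).1 int0.
move=> eq_a; apply/eqP; rewrite -measure_le0.
have : \forall t \ae m, False.
  apply: filterS2 a_ae eq_a => t lt_a /= /(_ Logic.I) [] /eqP.
  by rewrite subr_eq0 => /eqP ta; rewrite ta ltxx in lt_a.
move=> [N [mN N0 sN]]; rewrite -N0; apply: le_measure; rewrite ?inE//.
by move=> t _; apply: sN.
Qed.

(** * Singular values and spectral rank *)

Section spectral_consequences.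
Context d1 (X : measurableType d1) d2 (Y : measurableType d2) (R : realType).
Variables (mu : {measure set X -> \bar R}) (nu : {measure set Y -> \bar R}).
Variables (K KN : (X -> R[i]) -> (Y -> R[i])) (r : nat) (e : R).
Hypothesis L2K : forall f, L2 mu f -> L2 nu (K f).
Hypothesis L2KN : forall f, L2 mu f -> L2 nu (KN f).
Hypothesis Ksum : forall n (c : 'I_n -> R[i]) (f : 'I_n -> X -> R[i]),
  (forall i, L2 mu (f i)) ->
  K (fun x => \sum_i c i * f i x) = (fun y => \sum_i c i * K (f i) y).
Hypothesis KNsum : forall n (c : 'I_n -> R[i]) (f : 'I_n -> X -> R[i]),
  (forall i, L2 mu (f i)) ->
  KN (fun x => \sum_i c i * f i x) = (fun y => \sum_i c i * KN (f i) y).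
Hypothesis Kadj : exists B, is_adjoint mu nu K B.
Hypothesis rankKN : (op_rank mu nu KN <= r%:R%:E)%E.
Hypothesis KNerr : forall f, L2 mu f ->
  rsq nu (fun y => K f y - KN f y) <= e ^+ 2 * rsq mu f.

Let adjP : is_adjoint mu nu K (adjoint mu nu K).
Proof. exact: (xgetPex _ Kadj). Qed.

Lemma small_combination (f : 'I_r.+1 -> X -> R[i]) : (forall i, L2 mu (f i)) ->
  exists2 c : 'I_r.+1 -> R[i], exists i, c i != 0 &
    rsq nu (K (fun x => \sum_i c i * f i x)) <=
    e ^+ 2 * rsq mu (fun x => \sum_i c i * f i x).
Proof.
move=> L2f; have [c c0 KNc] := op_rank_kernel rankKN L2f; exists c => //.
have L2S : L2 mu (fun x => \sum_i c i * f i x) by apply: L2_sum => i; exact: L2Z.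
apply: le_trans (KNerr L2S).
rewrite /rsq (@ae_eq_nsq _ _ _ nu (K (fun x => \sum_i c i * f i x))
  (fun y => K (fun x => \sum_i c i * f i x) y - KN (fun x => \sum_i c i * f i x) y))//.
- exact: L2_meas (L2K L2S).
- exact: L2_meas (L2B (L2K L2S) (L2KN L2S)).
- by apply: filterS KNc => y /= + yT => /(_ yT); rewrite KNsum// => ->; rewrite subr0.
Qed.

Lemma singular_value_le : 0 <= e -> (singular_value mu nu K r.+1 <= e%:E)%E.
Proof.
move=> e0; apply: ub_ereal_sup => _ [s /= [->|[s0 [u [l [[L2u ou] ul]]]]] <-].
  by rewrite lee_fin.
rewrite lee_fin.
have [c [i0 ci0] Kc] := small_combination L2u.
(* Images of orthonormal eigenvectors are orthogonal with squared norm [l j], at least s^2, so [K]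
   stretches every combination of them by at least [s]. *)
have uK i j : L2inner nu (K (u i)) (K (u j)) = (l j)%:C * (i == j)%:R.
  rewrite (adjP.2 _ _ (L2u i) (L2K (L2u j))).
  have [_ ulj] := ul j.
  rewrite inner_conj//; last by have [[+ _ _] _] := adjP; apply; exact: L2K.
  rewrite (ae_eq_innerl _ _ _ ulj); last 3 first.
  - by apply: (@L2_meas _ _ _ mu); have [[+ _ _] _] := adjP; apply; exact: L2K.
  - exact: L2_meas (L2Z _ (L2u j)).
  - exact: L2_meas (L2u i).
  by rewrite innerZl// ou conjcM conjc_real conjc_nat eq_sym.
move: Kc; rewrite Ksum// (rsq_orthogonal_sum c (fun i => L2K (L2u i)) uK).
rewrite (@rsq_orthogonal_sum _ _ _ _ _ c u (fun=> 1))//; last first.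
  by move=> i j; rewrite ou mul1r.
under [in X in _ <= X -> _]eq_bigr do rewrite mulr1.
set S := \sum_i cabs (c i) ^+ 2 => KS.
have Sp : 0 < S.
  rewrite /S (bigD1 i0)//= ltr_pwDl ?sumr_ge0//; last by move=> i _; exact: sqr_ge0.
  by rewrite lt_def sqr_ge0 sqrf_eq0 cabs_eq0 ci0.
rewrite -(@ler_pXn2r _ 2)// ?nnegrE// -(ler_pM2r Sp); apply: le_trans KS.
rewrite mulrC /S mulr_suml; apply: ler_sum => i _.
by rewrite ler_wpM2l ?sqr_ge0//; have [] := ul i.
Qed.

Lemma Lambda_le (eps : R) : 0 < eps -> e ^+ 2 <= eps ->
  (Lambda mu eps (fun f => adjoint mu nu K (K f)) <= r%:R%:E)%E.
Proof.
move=> eps0 e2; rewrite /Lambda /spectral_projection.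
pose S f := adjoint mu nu K (K f); rewrite -/S; set I := [set` _] : set R.
(* Without a spectral measure the chosen projection is the default zero map: its range contains no
   free family but the empty one. *)
have [[E0 SE0]|nE] := pselect (exists E, spectral_measure mu S E); last first.
  rewrite (_ : xget _ _ = fun=> fun=> fun=> 0); last first.
    by apply: xgetPN => E SE; apply: nE; exists E.
  apply: L2dim_le => n g gi fg; rewrite lee_fin ler_nat leqNgt; apply/negP => rn.
  have /eqP : (1 : R[i]) = 0.
    apply: (fg (fun=> 1) _ (Ordinal (leq_ltn_trans (leq0n _) rn))).
    apply: aeW => x _ /=; apply: big1 => i _; have [f _ ->] := gi i.
    by rewrite mulr0.
  by rewrite oner_eq0.
have [EP ET Em] := xgetPex (fun _ _ _ => 0) (ex_intro _ E0 SE0).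
set E := xget _ _ in EP ET Em *.
have mI : measurable (I : set (measurableTypeR R)) by exact: measurable_itv.
have [bE EE _] := EP _ mI.
apply: L2dim_le => n g gi fg; rewrite lee_fin ler_nat leqNgt; apply/negP => rn.
have /choice[f fP] i : exists f, L2 mu f /\ g i = E I f by have [f ? ?] := gi i; exists f.
have L2g i : L2 mu (g i) by rewrite (fP i).2; have [+ _ _] := bE; apply; exact: (fP i).1.
pose w (i : 'I_r.+1) := g (widen_ord rn i).
have L2w i : L2 mu (w i) by exact: L2g.
have [c [i0 ci0] Kc] := small_combination L2w.
set h := (fun x => \sum_i c i * w i x) in Kc *.
have L2h : L2 mu h by apply: L2_sum => i; exact: L2Z.
have hn0 : ~ (h = cst 0 %[ae mu]).
  move=> h0; move/negP: ci0; apply.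
  (* Extension of [c] by 0 to all [n] indices, so that the freeness of the whole family [g]
     applies. *)
  pose c' (i : 'I_n) := if insub (i : nat) is Some j then c j else 0.
  have c'w j : c' (widen_ord rn j) = c j.
    by rewrite /c' insubT//= => lt; congr c; exact: val_inj.
  apply/eqP; rewrite -c'w; apply: fg; apply: filterS h0 => x /= + xT => /(_ xT) hx0.
  transitivity (h x) => //.
  rewrite (bigID (fun i : 'I_n => (i < r.+1)%N))/= [X in _ + X]big1 ?addr0; last first.
    by move=> i /negbTE ri; rewrite /c' insubF ?mul0r.
  by rewrite (big_ord_narrow rn); apply: eq_bigr => i _; rewrite c'w.
have rh : 0 < rsq mu h.
  rewrite lt_def rsq_ge0 andbT; apply/eqP => rh0; apply: hn0.
  by apply: (@nsq_eq0 _ _ _ mu _ (L2_meas L2h)).1; rewrite (L2_nsq L2h) rh0.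
(* Every [w i] lies in the range of the idempotent [E I], so their combination is fixed. *)
have Eh : E I h = h %[ae mu].
  have Ew : \forall x \ae mu, forall i, E I (w i) x = w i x.
    apply: filter_forall => i; rewrite /w; have [L2f ->] := fP (widen_ord rn i).
    by apply: filterS (EE _ L2f) => x; exact.
  apply: filterS2 Ew (bounded_op_sum bE c L2w) => x Ewx /= + xT => /(_ xT) ->.
  by apply: eq_bigr => i _; rewrite Ewx.
have [m [mE im Sm]] := Em _ L2h.
have inner_mass B : measurable (B : set (measurableTypeR R)) -> E B h = h %[ae mu] ->
    fine (m B) = rsq mu h.
  move=> mB EBh; apply: complexI; rewrite -mE// -inner_self.
  apply: ae_eq_innerl EBh; try exact: L2_meas L2h.
  have [[+ _ _] _ _] := EP _ mB => /(_ _ L2h); exact: L2_meas.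
(* Both [I] and the whole line have mass |h|^2, hence [m] is carried by [I], where [t > eps]. *)
have mIh := inner_mass _ mI Eh.
have mTh := inner_mass _ measurableT (ET _ L2h).
have Kint : rsq nu (K h) = \int[m]_(t in setT) (t : R).
  apply: complexI; rewrite -Sm -inner_self (adjP.2 _ _ L2h (L2K L2h)).
  have L2S : L2 mu (S h) by have [[+ _ _] _] := adjP; apply; exact: L2K.
  by rewrite inner_conj// -/(S h) Sm conjc_real.
have m0 : m (~` [set t | eps < (t : R)]) = 0%E.
  have fI : m I \is a fin_num by exact: fin_num_measure.
  have fT : m setT \is a fin_num by exact: fin_num_measure.
  have mIC : m (~` I) = 0%E.
    have := @measureD _ _ _ m setT I measurableT mI; rewrite setTD setTI => ->.
      transitivity ((rsq mu h)%:E - (rsq mu h)%:E)%E; last by rewrite subee.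
      congr (_ - _)%E; first by rewrite -mTh fineK.
      by rewrite -mIh fineK.
    by rewrite ltey_eq fT.
  have mgt : measurable ([set t | eps < (t : R)] : set (measurableTypeR R)).
    by rewrite -set_itvoy; exact: measurable_itv.
  apply/eqP; rewrite -measure_le0 -mIC; apply: le_measure; rewrite ?inE.
  - exact: measurableC.
  - exact: measurableC.
  - by apply: subsetC => t /=; rewrite /I/= in_itv/= => /andP[].
have := measure_eq0_of_lt_integral im m0; rewrite -Kint mTh => mT.
have := le_trans Kc (ler_wpM2r (ltW rh) e2) => /mT /(congr1 fine).
by rewrite mTh => rh0; rewrite rh0 ltxx in rh.
Qed.

End spectral_consequences.

(** * The operator with separated interactions *)

Section product_ae.
Context d1 (X : measurableType d1) d2 (Y : measurableType d2) (R : realType).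
Variables (mu : {sigma_finite_measure set X -> \bar R})
          (nu : {sigma_finite_measure set Y -> \bar R}).

(** A cylinder over a null set is null even if the other factor has infinite measure, by 0 * oo =
    0. *)
Lemma ae_fst (P : X -> Prop) : (\forall x \ae mu, P x) ->
  \forall z \ae (mu \x nu)%E, P z.1.
Proof.
move=> [N [mN N0 PN]]; exists (N `*` setT); split.
- exact: measurableX.
- apply: (eq_trans (product_measure1E _ _ mN measurableT)).
  by transitivity (0 * nu setT)%E; [congr (_ * _)%E|rewrite mul0e].
- by move=> [x y] /= nP; split => //; apply: PN.
Qed.

Lemma ae_snd (P : Y -> Prop) : (\forall y \ae nu, P y) ->
  \forall z \ae (mu \x nu)%E, P z.2.
Proof.
move=> [N [mN N0 PN]]; exists (setT `*` N); split.
- exact: measurableX.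
- apply: (eq_trans (product_measure1E _ _ measurableT mN)).
  by transitivity (mu setT * 0)%E; [congr (_ * _)%E|rewrite mule0].
- by move=> [x y] /= nP; split => //; apply: PN.
Qed.

Lemma product_setT_gt0 : (0 < (mu \x nu)%E setT)%E ->
  (0 < mu setT)%E /\ (0 < nu setT)%E.
Proof.
have gt0 (a b : \bar R) : (0 <= a)%E -> (0 <= b)%E -> (0 < a * b)%E ->
    (0 < a)%E /\ (0 < b)%E.
  by move=> a0 b0 ab; rewrite !lt0e a0 b0 !andbT; split; apply/negP => /eqP e0;
    rewrite e0 ?mul0e ?mule0 ltxx in ab.
by rewrite -setXTT product_measure1E//; apply: gt0.
Qed.

End product_ae.

(** On a null space the essential supremum would be -oo; positive mass makes it nonnegative, so with
    the upper bound [fine] returns its true value. *)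
Lemma ess_sup_norm_fine d (T : measurableType d) (R : realType)
    (mu : {measure set T -> \bar R}) (f : T -> R) :
  (0 < mu setT)%E -> (ess_sup mu (fun x => `|f x|%:E) < +oo)%E ->
  0 <= fine (ess_sup mu (fun x => `|f x|%:E)) /\
  \forall x \ae mu, `|f x| <= fine (ess_sup mu (fun x => `|f x|%:E)).
Proof.
move=> mu0 foo.
have s0 : (0 <= ess_sup mu (fun x => `|f x|%:E))%E.
  by apply: ess_sup_gee => //; apply: aeW => x; rewrite lee_fin.
split; first exact: fine_ge0.
apply: filterS (ess_sup_ge mu (fun x => `|f x|%:E)) => x.
by rewrite -{1}(@fineK _ (ess_sup _ _)) ?lee_fin// ge0_fin_numE.
Qed.

Lemma ess_bounds_fine d (T : measurableType d) (R : realType)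
    (mu : {measure set T -> \bar R}) (f : T -> R) (b : R) :
  (0 < mu setT)%E -> (\forall x \ae mu, `|f x| <= b) ->
  let s := fine (ess_sup mu (fun x => (f x)%:E)) in
  let i := fine (ess_inf mu (fun x => (f x)%:E)) in
  [/\ \forall x \ae mu, i <= f x <= s, i <= s, s <= b & - b <= i].
Proof.
move=> mu0 fb s i.
have sb : (ess_sup mu (fun x => (f x)%:E) <= b%:E)%E.
  by apply/ess_supP; apply: filterS fb => x; rewrite lee_fin ler_norml => /andP[].
have ib : ((- b)%:E <= ess_inf mu (fun x => (f x)%:E))%E.
  by apply/ess_infP; apply: filterS fb => x; rewrite lee_fin ler_norml => /andP[].
have bs : ((- b)%:E <= ess_sup mu (fun x => (f x)%:E))%E.
  apply: ess_sup_gee => //.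
  by apply: filterS fb => x; rewrite lee_fin ler_norml => /andP[].
have s_fin : ess_sup mu (fun x => (f x)%:E) = s%:E.
  by rewrite fineK// fin_real// (lt_le_trans _ bs) ?ltNyr// (le_lt_trans sb) ?ltry.
have is_ : (ess_inf mu (fun x => (f x)%:E) <= s%:E)%E.
  rewrite -s_fin; apply: ub_ereal_sup => y /= yf; apply: ess_sup_gee => //.
have i_fin : ess_inf mu (fun x => (f x)%:E) = i%:E.
  by rewrite fineK// fin_real// (lt_le_trans _ ib) ?ltNyr// (le_lt_trans is_) ?ltry.
rewrite s_fin lee_fin in sb; rewrite i_fin lee_fin in ib.
rewrite i_fin lee_fin in is_; split => //.
apply: filterS2 (ess_sup_ge mu (fun x => (f x)%:E)) (ess_inf_le mu (fun x => (f x)%:E)).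
by move=> x; rewrite s_fin i_fin !lee_fin => -> ->.
Qed.

Section interaction_bounds.
Context d1 (X : measurableType d1) d2 (Y : measurableType d2) (R : realType).
Variables (mu : {sigma_finite_measure set X -> \bar R})
          (nu : {sigma_finite_measure set Y -> \bar R}).
Variables (p r : nat) (D : interaction R X Y p r).
Hypothesis radX_fin : forall l, (ess_sup mu (fun x => `|tX D l x|%:E) < +oo)%E.
Hypothesis radY_fin : forall l, (ess_sup nu (fun y => `|tY D l y|%:E) < +oo)%E.
Hypothesis pos : (0 < (mu \x nu)%E setT)%E.

Lemma radX_ge l : \forall x \ae mu, `|tX D l x| <= radX mu D l.
Proof. by have [m0 _] := product_setT_gt0 pos; have [] := ess_sup_norm_fine m0 (radX_fin l). Qed.

Lemma radY_ge l : \forall y \ae nu, `|tY D l y| <= radY nu D l.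
Proof. by have [_ m0] := product_setT_gt0 pos; have [] := ess_sup_norm_fine m0 (radY_fin l). Qed.

Lemma theta_le_zeta : \forall z \ae (mu \x nu)%E, `|theta D z| <= zeta mu nu D.
Proof.
have hX : \forall z \ae (mu \x nu)%E, forall l, `|tX D l z.1| <= radX mu D l.
  by apply: filter_forall => l; exact: ae_fst (radX_ge l).
have hY : \forall z \ae (mu \x nu)%E, forall l, `|tY D l z.2| <= radY nu D l.
  by apply: filter_forall => l; exact: ae_snd (radY_ge l).
apply: filterS2 hX hY => z zX zY.
apply: le_trans (ler_norm_sum _ _ _) _; apply: ler_sum => l _.
by rewrite normrM ler_pM.
Qed.

Lemma halfwidth_bounds :
  [/\ \forall z \ae (mu \x nu)%E, `|ucent mu nu D z| <= halfwidth mu nu D,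
      0 <= halfwidth mu nu D & halfwidth mu nu D <= zeta mu nu D].
Proof.
have [th is_ sb ib] := ess_bounds_fine pos theta_le_zeta.
rewrite -/(theta_plus mu nu D) -/(theta_minus mu nu D) in th is_ sb ib.
split; rewrite /halfwidth; last 2 first.
- by rewrite divr_ge0// subr_ge0.
- by rewrite ler_pdivrMr//; lra.
by apply: filterS th => z /andP[lo hi]; rewrite /ucent /theta0 ler_norml; lra.
Qed.

End interaction_bounds.

Lemma L2_ae_bounded_mul d (T : measurableType d) (R : realType)
    (mu : {measure set T -> \bar R}) (f g : T -> R[i]) (b : R) :
  L2 mu f -> cmeasurable g -> (\forall x \ae mu, cabs (g x) <= b) ->
  L2 mu (fun x => f x * g x).
Proof.
move=> L2f mg gb; apply: (@L2_le _ _ _ mu _ (fun x => b%:C * f x)).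
- exact: cmeasurableM (L2_meas L2f) mg.
- exact: L2Z.
apply: filterS gb => x gx; rewrite !cabsM cabs_real mulrC.
by rewrite ler_wpM2r ?cabs_ge0// (le_trans gx)// ler_norm.
Qed.

(** The power of a sum is expanded over words [f] rather than multi-indices, which avoids
    multinomial coefficients: the multi-index of a word is given by the sizes of its fibres. *)
Lemma prod_finfun_fibres (R : comPzRingType) (n r : nat) (F : 'I_r -> R)
    (f : {ffun 'I_n -> 'I_r}) :
  \prod_(i < n) F (f i) = \prod_(l < r) F l ^+ #|[pred i | f i == l]|.
Proof.
rewrite (partition_big f xpredT)//=; apply: eq_bigr => l _.
by rewrite -prodr_const; apply: eq_bigr => i /eqP ->.
Qed.

Lemma sum_finfun_fibres (n r : nat) (f : {ffun 'I_n -> 'I_r}) :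
  (\sum_(l < r) #|[pred i | f i == l]|)%N = n.
Proof.
rewrite -[RHS]card_ord -sum1_card (partition_big f xpredT)//=.
by apply: eq_bigr => l _; rewrite sum1_card.
Qed.

(** * The kernel and its polynomial approximations *)

Section interaction_kernel.
Context d1 (X : measurableType d1) d2 (Y : measurableType d2) (R : realType).
Variables (mu : {sigma_finite_measure set X -> \bar R})
          (nu : {sigma_finite_measure set Y -> \bar R}).
Variables (p r : nat) (D : interaction R X Y p r).
Hypothesis mwX : cmeasurable (wX D).
Hypothesis mwY : cmeasurable (wY D).
Hypothesis ma : forall q, cmeasurable (aX D q).
Hypothesis mb : forall q, cmeasurable (bY D q).
Hypothesis L2a : forall q, L2 mu (fun x => wX D x * aX D q x).
Hypothesis L2b : forall q, L2 nu (fun y => wY D y * bY D q y).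
Hypothesis mphi : measurable_fun setT (phiX D).
Hypothesis mpsi : measurable_fun setT (psiY D).
Hypothesis mcX : forall l, measurable_fun setT (coordX D l).
Hypothesis mcY : forall l, measurable_fun setT (coordY D l).
Hypothesis radX_fin : forall l, (ess_sup mu (fun x => `|tX D l x|%:E) < +oo)%E.
Hypothesis radY_fin : forall l, (ess_sup nu (fun y => `|tY D l y|%:E) < +oo)%E.
Hypothesis C_fin : (L2norm (mu \x nu)%E (Hfun D) < +oo)%E.
Hypothesis pos : (0 < (mu \x nu)%E setT)%E.

Let mtX l : measurable_fun setT (tX D l).
Proof. by apply: measurable_funB => //; exact: measurable_cst. Qed.

Let mtY l : measurable_fun setT (tY D l).
Proof. by apply: measurable_funB => //; exact: measurable_cst. Qed.

Let mphi0 : measurable_fun setT (phi0 D).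
Proof.
apply: measurable_funB; last exact: measurable_cst.
apply: measurable_funD => //; apply: measurable_sum => l.
by apply: measurable_funM => //; exact: measurable_cst.
Qed.

Let mpsi0 : measurable_fun setT (psi0 D).
Proof.
apply: measurable_funD => //; apply: measurable_sum => l.
by apply: measurable_funM => //; exact: measurable_cst.
Qed.

Let mtheta : measurable_fun setT (theta D).
Proof.
apply: measurable_sum => l; apply: measurable_funM.
- exact: measurableT_comp (mtX l) measurable_fst.
- exact: measurableT_comp (mtY l) measurable_snd.
Qed.

Lemma measurable_ucent : measurable_fun setT (ucent mu nu D).
Proof. by apply: measurable_funB => //; exact: measurable_cst. Qed.

Let cm_fst (f : X -> R[i]) : cmeasurable f -> cmeasurable (fun z : X * Y => f z.1).
Proof. by apply: cmeasurable_comp; exact: measurable_fst. Qed.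

Let cm_snd (f : Y -> R[i]) : cmeasurable f -> cmeasurable (fun z : X * Y => f z.2).
Proof. by apply: cmeasurable_comp; exact: measurable_snd. Qed.

Lemma cmeasurable_Hfun : cmeasurable (Hfun D).
Proof.
apply: cmeasurableM.
- by apply: cmeasurableM; [exact: cm_fst|exact: cm_snd].
apply: cmeasurable_sum => q.
by apply: cmeasurableM; [exact: cm_fst|exact: cm_snd].
Qed.

Let mH := cmeasurable_Hfun.

Definition genX q (k : 'I_r -> nat) x : R[i] :=
  wX D x * aX D q x * expi (phi0 D x) * (\prod_(l < r) tX D l x ^+ k l)%:C.

Definition genY q (k : 'I_r -> nat) y : R[i] :=
  wY D y * bY D q y * expi (psi0 D y) * (\prod_(l < r) tY D l y ^+ k l)%:C.

Lemma L2_unimodular d (T : measurableType d) (m : {measure set T -> \bar R})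
    (f : T -> R[i]) (t : T -> R) :
  L2 m f -> measurable_fun setT t -> L2 m (fun x => f x * expi (t x)).
Proof.
move=> L2f mt; apply: (@L2_ae_bounded_mul _ _ _ _ _ _ 1) => //.
- exact: cmeasurable_expi.
- by apply: aeW => x; rewrite cabs_expi.
Qed.

Let L2_monomial d (T : measurableType d) (m : {measure set T -> \bar R})
    (f : T -> R[i]) (t : 'I_r -> T -> R) (b : 'I_r -> R) (k : 'I_r -> nat) :
  L2 m f -> (forall l, measurable_fun setT (t l)) ->
  (forall l, \forall x \ae m, `|t l x| <= b l) ->
  L2 m (fun x => f x * (\prod_(l < r) t l x ^+ k l)%:C).
Proof.
move=> L2f mt tb.
apply: (@L2_ae_bounded_mul _ _ _ _ _ _ (\prod_(l < r) b l ^+ k l)) => //.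
- apply: cmeasurable_real; apply: measurable_prod => l _.
  exact: measurable_funX.
apply: filterS (@filter_forall _ _ _ _ _ tb) => x tbx.
rewrite cabs_real normr_prod; apply: ler_prod => l _.
by rewrite normr_ge0 normrX lerXn2r ?nnegrE// (le_trans (normr_ge0 _) (tbx l)).
Qed.

Lemma L2_genX q k : L2 mu (genX q k).
Proof.
apply: (L2_monomial (b := radX mu D)) => //.
- exact: L2_unimodular.
- exact: (radX_ge radX_fin pos).
Qed.

Lemma L2_genY q k : L2 nu (genY q k).
Proof.
apply: (L2_monomial (b := radY nu D)) => //.
- exact: L2_unimodular.
- exact: (radY_ge radY_fin pos).
Qed.

(** Each product has its first factor in U_N and its second in V_N, so one and the same expansion
    gives both rank bounds. The L^2 conditions let it serve as a separated approximation as well. *)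
Definition expands N (v : X * Y -> R[i]) := exists t : seq ((X -> R[i]) * (Y -> R[i])),
  (forall gh, gh \in t -> [/\ L2 mu gh.1, L2 nu gh.2,
     Uspace D N gh.1 & Vspace D N gh.2]) /\
  v = separated t.

Lemma expandsD N v w : expands N v -> expands N w -> expands N (fun z => v z + w z).
Proof.
move=> [t [Pt ->]] [s [Ps ->]]; exists (t ++ s); split.
  by move=> gh; rewrite mem_cat => /orP[/Pt|/Ps].
by apply/funext => z; rewrite /separated big_cat.
Qed.

Lemma expandsZ N c v : expands N v -> expands N (fun z => c * v z).
Proof.
move=> [t [Pt ->]]; exists [seq ((fun x => c * gh.1 x), gh.2) | gh <- t]; split.
  move=> _ /mapP[gh /Pt[L1 L2' U V] ->]; split => //=; first exact: L2Z.
  exact: lin_spanZ.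
apply/funext => z; rewrite /separated big_map mulr_sumr.
by apply: eq_bigr => gh _; rewrite mulrA.
Qed.

Lemma expands_sum N (I : Type) (s : seq I) (v : I -> X * Y -> R[i]) :
  (forall i, expands N (v i)) -> expands N (fun z => \sum_(i <- s) v i z).
Proof.
move=> ev; elim: s => [|i s ih].
  by exists [::]; split=> //; apply/funext => z; rewrite /separated !big_nil.
rewrite (_ : (fun z => _) = (fun z => v i z + \sum_(j <- s) v j z)); first exact: expandsD.
by apply/funext => z; rewrite big_cons.
Qed.

Let base z : R[i] := Hfun D z * expi (phi0 D z.1 + psi0 D z.2).

Lemma expands_theta N n : (n < N)%N ->
  expands N (fun z => base z * (theta D z ^+ n)%:C).
Proof.
move=> nN; pose k (f : {ffun 'I_n -> 'I_r}) l := #|[pred i | f i == l]|.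
exists [seq (genX qf.1 (k qf.2), genY qf.1 (k qf.2)) |
  qf : 'I_p * {ffun 'I_n -> 'I_r}]; split.
  move=> _ /mapP[[q f] _ ->] /=; split; [exact: L2_genX|exact: L2_genY| |];
    by apply: lin_span_gen; exists q, (k f); rewrite sum_finfun_fibres.
apply/funext => z; rewrite /separated big_image/=.
rewrite -(pair_bigA _ (fun q f => genX q (k f) z.1 * genY q (k f) z.2))/=.
rewrite /base /Hfun /amplitude mulr_sumr !mulr_suml; apply: eq_bigr => q _.
have -> : theta D z ^+ n = \sum_(f : {ffun 'I_n -> 'I_r})
    (\prod_(l < r) tX D l z.1 ^+ k f l) * (\prod_(l < r) tY D l z.2 ^+ k f l).
  rewrite -[n in LHS]card_ord -prodr_const bigA_distr_bigA/=.
  by apply: eq_bigr => f _; rewrite big_split/= (prod_finfun_fibres (fun l => tX D l z.1))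
    (prod_finfun_fibres (fun l => tY D l z.2)).
rewrite rmorph_sum/= mulr_sumr; apply: eq_bigr => f _.
by rewrite expiD rmorphM/= /genX /genY; ring.
Qed.

Definition phase_kernel z : R[i] :=
  Hfun D z * expi (phi0 D z.1 + psi0 D z.2 + theta0 mu nu D).

Definition poly_kernel (P : {poly R[i]}) z := phase_kernel z * P.[(ucent mu nu D z)%:C].

Definition full_kernel z := phase_kernel z * expi (ucent mu nu D z).

Lemma expands_poly N (P : {poly R[i]}) : (size P <= N)%N -> expands N (poly_kernel P).
Proof.
move=> PN; pose Q := P \Po ('X - (theta0 mu nu D)%:C%:P).
have sQ : size Q = size P by rewrite size_comp_poly2// size_XsubC.
rewrite (_ : poly_kernel P = fun z => \sum_(i < size Q)
    (expi (theta0 mu nu D) * Q`_i) * (base z * (theta D z ^+ i)%:C)).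
  apply: expands_sum => i; apply: expandsZ; apply: expands_theta.
  by rewrite (leq_trans (ltn_ord i))// sQ.
apply/funext => z; rewrite /poly_kernel /phase_kernel expiD.
have -> : P.[(ucent mu nu D z)%:C] = Q.[(theta D z)%:C].
  by rewrite horner_comp !hornerE /ucent rmorphB.
rewrite horner_coef mulr_sumr; apply: eq_bigr => i _.
by rewrite rmorphXn/= /base; ring.
Qed.

(** Expanding the centred products shows that the shifts put into [phi0] and [psi0] cancel those in
    [theta]; the constant subtracted in [phi0] accounts for the products of centers, and [theta0]
    cancels against [ucent]. *)
Lemma full_kernelE x y : full_kernel (x, y) = wX D x * wY D y * amplitude D x y *
  expi (phiX D x + psiY D y + \sum_(l < r) coordX D l x * coordY D l y).
Proof.
rewrite /full_kernel /phase_kernel -mulrA -expiD /Hfun/=; congr (_ * expi _).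
rewrite /ucent /phi0 /psi0 /theta/=.
have -> : \sum_(l < r) tX D l x * tY D l y = \sum_(l < r) coordX D l x * coordY D l y
    - \sum_(l < r) etaY D l * coordX D l x - \sum_(l < r) xiX D l * coordY D l y
    + \sum_(l < r) xiX D l * etaY D l.
  rewrite -!sumrB -big_split/=; apply: eq_bigr => l _; rewrite /tX /tY; ring.
ring.
Qed.


Lemma cmeasurable_horner_ucent (P : {poly R[i]}) :
  cmeasurable (fun z => P.[(ucent mu nu D z)%:C]).
Proof.
rewrite (_ : (fun z => _) =
  (fun z => \sum_(i < size P) P`_i * (ucent mu nu D z ^+ i)%:C)).
  apply: cmeasurable_sum => i; apply: cmeasurableM; first exact: cmeasurable_cst.
  by apply: cmeasurable_real; apply: measurable_funX; exact: measurable_ucent.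
by apply/funext => z; rewrite horner_coef; apply: eq_bigr => i _; rewrite rmorphXn.
Qed.

Let cm_phase : cmeasurable phase_kernel.
Proof.
apply: cmeasurableM => //; apply: cmeasurable_expi.
apply: measurable_funD; last exact: measurable_cst.
apply: measurable_funD.
- exact: measurableT_comp mphi0 measurable_fst.
- exact: measurableT_comp mpsi0 measurable_snd.
Qed.

Let cm_full : cmeasurable full_kernel.
Proof. by apply: cmeasurableM => //; apply: cmeasurable_expi; exact: measurable_ucent. Qed.

Let cm_poly P : cmeasurable (poly_kernel P).
Proof. by apply: cmeasurableM => //; exact: cmeasurable_horner_ucent. Qed.

Lemma cabs_phase_kernel z : cabs (phase_kernel z) = cabs (Hfun D z).
Proof. by rewrite cabsM cabs_expi mulr1. Qed.

Lemma nsq_Hfun : nsq (mu \x nu)%E (Hfun D) = (Hnorm mu nu D ^+ 2)%:E.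
Proof.
rewrite -sqr_L2norm /Hnorm EFin_expe fineK// ge0_fin_numE//.
by rewrite L2normE poweR_ge0.
Qed.

Lemma L2_full_kernel : L2 (mu \x nu)%E full_kernel.
Proof.
apply: (@L2_le _ _ _ _ _ (Hfun D)) => //.
by apply: aeW => z; rewrite /full_kernel cabsM cabs_expi mulr1 cabs_phase_kernel.
Qed.

Let mphase_full x y : full_kernel (x, y) = \sum_(q < p)
  (wX D x * aX D q x) * (wY D y * bY D q y) *
  expi (phiX D x + psiY D y + \sum_(l < r) coordX D l x * coordY D l y).
Proof.
rewrite full_kernelE /amplitude mulr_sumr mulr_suml; apply: eq_bigr => q _; ring.
Qed.

Let mphase_fst y : measurable_fun setT
  (fun x => phiX D x + psiY D y + \sum_(l < r) coordX D l x * coordY D l y).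
Proof.
apply: measurable_funD; first by apply: measurable_funD => //; exact: measurable_cst.
by apply: measurable_sum => l; apply: measurable_funM => //; exact: measurable_cst.
Qed.

Let mphase_snd x : measurable_fun setT
  (fun y => phiX D x + psiY D y + \sum_(l < r) coordX D l x * coordY D l y).
Proof.
apply: measurable_funD; first by apply: measurable_funD => //; exact: measurable_cst.
by apply: measurable_sum => l; apply: measurable_funM => //; exact: measurable_cst.
Qed.

(** For fixed [y] the kernel is a finite combination of the functions w_X a_q with unimodular
    factors, hence the result at every [y]. *)
Lemma L2_full_kernel_fst y : L2 mu (fun x => full_kernel (x, y)).
Proof.
under eq_fun do rewrite mphase_full.
apply: L2_sum => q; apply: L2_unimodular => //.
by under eq_fun do rewrite mulrC; exact: L2Z.
Qed.

Lemma L2_full_kernel_snd x : L2 nu (fun y => full_kernel (x, y)).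
Proof.
under eq_fun do rewrite mphase_full.
by apply: L2_sum => q; apply: L2_unimodular => //; exact: L2Z.
Qed.

(** Read off from the separated expansion, which is an exact identity; a bound on [ucent], available
    only almost everywhere, would not reach every [y]. *)
Lemma L2_poly_kernel_fst P y : L2 mu (fun x => poly_kernel P (x, y)).
Proof.
have [t [Pt ->]] := expands_poly (leqnn (size P)).
by apply: L2_separated_fst => gh /Pt[].
Qed.

Lemma Kop_kop f : L2 mu f -> Kop mu D f = kop mu full_kernel f.
Proof.
move=> L2f; apply/funext => y; rewrite /Kop /kop -cintegralZ//.
  by apply: eq_cintegral => x _; rewrite full_kernelE; ring.
rewrite (_ : (fun x => _) = (fun x => (\sum_(q < p) bY D q y * (wX D x * aX D q x *
  expi (phiX D x + psiY D y + \sum_(l < r) coordX D l x * coordY D l y))) * f x)).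
  apply: L2M_integrable => //; apply: L2_sum => q.
  by apply: L2Z; exact: L2_unimodular.
apply/funext => x; rewrite /amplitude mulr_sumr !mulr_suml; apply: eq_bigr => q _.
ring.
Qed.

(** * The measure sigma and the approximation errors *)

Variable sigma : {finite_measure set (measurableTypeR R) -> \bar R}.
Hypothesis sigmaE : forall B : set (measurableTypeR R), measurable B ->
  sigma B = (\int[mu \x nu]_z
    (\1_B (ucent mu nu D z) * cabs (Hfun D z) ^+ 2)%:E)%E.

Let M := halfwidth mu nu D.
Let C := Hnorm mu nu D.
Let I : set (measurableTypeR R) := `[- M, M]%classic.

Let mI : measurable I.
Proof. exact: measurable_itv. Qed.

Let M0 : 0 <= M.
Proof. by have [] := halfwidth_bounds radX_fin radY_fin pos. Qed.

Let C0 : 0 <= C.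
Proof. by apply: fine_ge0; rewrite L2normE poweR_ge0. Qed.

Let ucent_I : \forall z \ae (mu \x nu)%E, I (ucent mu nu D z).
Proof.
have [uM _ _] := halfwidth_bounds radX_fin radY_fin pos.
by apply: filterS uM => z; rewrite /I /= in_itv/= ler_norml.
Qed.

Let mu' : measurable_fun setT (ucent mu nu D : X * Y -> measurableTypeR R).
Proof. exact: measurable_ucent. Qed.

Lemma sigma_itv : sigma `[- M, M]%classic = (C ^+ 2)%:E.
Proof.
rewrite sigmaE// -nsq_Hfun /nsq; apply: ae_eq_integral => //.
- apply/measurable_EFinP/measurable_funM; last exact: measurable_cabs_sqr.
  exact: measurableT_comp (measurable_indic mI) mu'.
- exact: measurable_nsq.
- apply: filterS ucent_I => z uI _; rewrite indicE mem_set// mul1r//.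
Qed.

Lemma nsq_error P : nsq (mu \x nu)%E (fun z => full_kernel z - poly_kernel P z) =
  (approx_error sigma M P ^+ 2)%:E.
Proof.
rewrite -(integral_approx_error sigma M0).
pose g (t : measurableTypeR R) := cabs (expi (t : R) - P.[(t : R)%:C]) ^+ 2.
have mg : measurable_fun setT g.
  exact/measurable_cabs_sqr/measurable_approx_integrand.
rewrite integral_mkcond.
have mgI : measurable_fun setT (fun t => \1_I t * g t).
  by apply: measurable_funM => //; exact: measurable_indic.
(* The change of variables is over the whole line, the error over [-M, M]; the indicator bridges the
   two and equals 1 at almost every [ucent z]. *)
transitivity (\int[sigma]_t (\1_I t * g t)%:E)%E; last first.
  apply: eq_integral => t _; rewrite patchE indicE /I.
  by case: ifP => _; rewrite ?mul1r ?mul0r.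
rewrite (ge0_integral_weighted_pushforward (measurable_cabs_sqr mH)
  (fun z => sqr_ge0 _) mu' sigmaE mgI); last by move=> t; rewrite mulr_ge0 ?sqr_ge0.
apply: ae_eq_integral => //.
- apply: measurable_nsq; apply: cmeasurableB => //.
- apply/measurable_EFinP/measurable_funM; last exact: measurable_cabs_sqr.
  exact: measurableT_comp mgI mu'.
apply: filterS ucent_I => z uI _; rewrite indicE mem_set// mul1r.
rewrite /full_kernel /poly_kernel -mulrBr cabsM exprMn mulrC cabs_phase_kernel//.
Qed.


Lemma L2_error P : L2 (mu \x nu)%E (fun z => full_kernel z - poly_kernel P z).
Proof. by apply/L2P; rewrite nsq_error ltry; split; first exact: cmeasurableB. Qed.

Lemma L2_error_fst P y : L2 mu (fun x => full_kernel (x, y) - poly_kernel P (x, y)).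
Proof. exact: L2B (L2_full_kernel_fst y) (L2_poly_kernel_fst P y). Qed.

Lemma L2_poly_kernel P : L2 (mu \x nu)%E (poly_kernel P).
Proof.
have := L2B L2_full_kernel (L2_error P); congr L2; apply/funext => z.
by rewrite subKr.
Qed.

Lemma L2norm_error P : L2norm (mu \x nu)%E (fun z => full_kernel z - poly_kernel P z) =
  (approx_error sigma M P)%:E.
Proof.
rewrite L2normE nsq_error poweR_EFin powR12_sqrt ?sqr_ge0// sqrtr_sqr.
by rewrite ger0_norm// sqrtr_ge0.
Qed.

Lemma approx_error_taylor m :
  approx_error sigma M (taylor_expi m) <= C * (M ^+ m / m`!%:R).
Proof.
have c0 : 0 <= M ^+ m / m`!%:R :> R by rewrite divr_ge0 ?exprn_ge0.
rewrite -(@ler_pXn2r _ 2)// ?nnegrE ?sqrtr_ge0 ?mulr_ge0// -lee_fin.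
rewrite -(integral_approx_error sigma M0) exprMn mulrC EFinM -sigma_itv.
rewrite -integral_cst//; apply: ge0_le_integral => //.
- by move=> t _; rewrite lee_fin exprn_ge0 ?cabs_ge0.
- apply/measurable_EFinP; apply: measurable_funTS.
  exact/measurable_cabs_sqr/measurable_approx_integrand.
  move=> t /=; rewrite in_itv/= -ler_norml => tM; rewrite lee_fin.
  rewrite lerXn2r ?nnegrE ?cabs_ge0// (le_trans (taylor_expi_le m t))//.
  by rewrite ler_wpM2r ?invr_ge0// lerXn2r ?nnegrE.
by rewrite lee_fin exprn_ge0.
Qed.

Lemma hs_norm_error P :
  hs_norm mu nu (kop mu (fun z => full_kernel z - poly_kernel P z)) =
  (approx_error sigma M P)%:E.
Proof.
rewrite -L2norm_error; apply: hs_norm_kop; [exact: L2_error|exact: L2_error_fst|].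
move=> dlt dlt0.
have [m Cm] : exists m, (C * (M ^+ m / m`!%:R)) ^+ 2 <= dlt.
  have : (fun m => (C * (M ^+ m / m`!%:R)) ^+ 2) @ \oo --> (C * 0) ^+ 2.
    have h : (fun m => C * (M ^+ m / m`!%:R)) @ \oo --> C * 0.
      by apply: cvgMr; apply: cvg_series_cvg_0; exact: is_cvg_series_exp_coeff.
    by under eq_fun do rewrite expr2; rewrite expr2; exact: cvgM.
  rewrite mulr0 expr0n/= => /cvgrPdist_le /(_ _ dlt0)[m _ /(_ m (leqnn m))].
  by rewrite sub0r normrN ger0_norm ?sqr_ge0// => ?; exists m.
(* With [t] the expansion of the kernel of T_m - P, the error kernel minus [separated t] is the
   Taylor error kernel, small for large [m]. *)
pose Q := taylor_expi m - P; have [t [Pt Qt]] := expands_poly (leqnn (size Q)).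
exists t; split; [by move=> gh /Pt[]|by move=> gh /Pt[]|].
rewrite (_ : (fun z => _) = (fun z => full_kernel z - poly_kernel (taylor_expi m) z)).
  rewrite nsq_error lee_fin (le_trans _ Cm)// lerXn2r ?nnegrE ?sqrtr_ge0//.
    by rewrite mulr_ge0// divr_ge0// exprn_ge0.
  exact: approx_error_taylor.
apply/funext => z; rewrite -Qt /poly_kernel /Q !hornerE; ring.
Qed.

Lemma kop_error P f : L2 mu f ->
  kop mu (fun z => full_kernel z - poly_kernel P z) f =
  (fun y => Kop mu D f y - kop mu (poly_kernel P) f y).
Proof.
move=> L2f; rewrite Kop_kop//; apply/funext => y; rewrite !kop_inner.
apply: innerBl; [exact: L2_full_kernel_fst|exact: L2_poly_kernel_fst|].
exact: L2_conjc.
Qed.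

Lemma rsq_error_le P f : L2 mu f ->
  rsq nu (fun y => Kop mu D f y - kop mu (poly_kernel P) f y) <=
  approx_error sigma M P ^+ 2 * rsq mu f.
Proof.
move=> L2f; rewrite -kop_error// -lee_fin EFinM -nsq_error -(L2_nsq L2f) -L2_nsq.
  by apply: nsq_kop_le; [exact: L2_error|exact: L2_error_fst|exact: L2f].
by apply: L2_kop; [exact: L2_error|exact: L2_error_fst|exact: L2f].
Qed.

Lemma best_polynomial N : exists P : {poly R[i]},
  (size P <= N)%N /\ approx_error sigma M P = Ebest sigma M C N.
Proof.
case: N => [|N]; last first.
  have [] := @best_approximation _ _ _ _ M0 sigma_itv N.+1 isT.
  by move=> sP PE _ _; eexists; split; [exact: sP|].
(* For N = 0 only the zero polynomial is allowed, and its error is |H| in norm, in agreement with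
   the separate clause of [Ebest]. *)
exists 0; rewrite size_poly0; split => //=.
apply/eqP; rewrite -(@eqrXn2 _ 2)// ?sqrtr_ge0//; apply/eqP.
apply: EFin_inj; rewrite -nsq_error -nsq_Hfun; apply: eq_integral => z _.
rewrite /poly_kernel horner0 mulr0 subr0 /full_kernel cabsM cabs_expi mulr1.
by rewrite cabs_phase_kernel.
Qed.

Lemma op_rank_poly_kernel N (P : {poly R[i]}) : (size P <= N)%N ->
  (op_rank mu nu (kop mu (poly_kernel P)) <=
   Order.min (L2dim mu (Uspace D N)) (L2dim nu (Vspace D N)))%E.
Proof.
move=> PN; have [t [Pt Qt]] := expands_poly PN.
pose g i := (tnth (in_tuple t) i).1; pose h i := (tnth (in_tuple t) i).2.
have gh i : [/\ L2 mu (g i), L2 nu (h i), Uspace D N (g i) & Vspace D N (h i)].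
  by apply: Pt; exact: mem_tnth.
have -> : op_rank mu nu (kop mu (poly_kernel P)) = op_rank mu nu (separated_op mu g h).
  rewrite /op_rank; congr L2dim; apply/seteqP.
  have kE f : L2 mu f -> kop mu (poly_kernel P) f = separated_op mu g h f.
    move=> L2f; apply/funext => y; rewrite Qt /kop /separated /separated_op.
    transitivity (cintegral mu setT (fun x => \sum_i h i y * (g i x * f x))).
      apply: eq_cintegral => x _; rewrite mulr_suml big_tnth.
      by apply: eq_bigr => i _; rewrite /g /h; ring.
    have igf i : cintegrable mu setT (fun x => g i x * f x).
      by apply: L2M_integrable => //; have [] := gh i.
    rewrite cintegral_sum//; last by move=> i; exact: cintegrableZ.
    by apply: eq_bigr => i _; rewrite cintegralZ// mulrC.
  by split=> _ [f L2f ->]; exists f => //; rewrite kE.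
rewrite le_min; apply/andP; split.
- by apply: op_rank_le_left => i; have [] := gh i.
- by apply: op_rank_le_right => i; have [] := gh i.
Qed.

Lemma L2dim_Uspace N : exists n : nat, L2dim mu (Uspace D N) = n%:R%:E.
Proof.
pose gam (qf : 'I_p * {ffun 'I_r -> 'I_N.+1}) := genX qf.1 (fun l => qf.2 l).
apply: L2dim_nat; apply: (@L2dim_lin_span_le _ _ _ mu _ gam) => g [q [k [kN ->]]].
exists (q, [ffun l => inord (k l)]).
rewrite /gam /genX/=; apply/funext => x; congr (_ * _%:C); apply: eq_bigr => l _.
rewrite ffunE inordK// ltnS (leq_trans _ (ltnW kN))//.
by rewrite (bigD1 l)//= leq_addr.
Qed.

Lemma L2dim_Vspace N : exists n : nat, L2dim nu (Vspace D N) = n%:R%:E.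
Proof.
pose gam (qf : 'I_p * {ffun 'I_r -> 'I_N.+1}) := genY qf.1 (fun l => qf.2 l).
apply: L2dim_nat; apply: (@L2dim_lin_span_le _ _ _ nu _ gam) => g [q [k [kN ->]]].
exists (q, [ffun l => inord (k l)]).
rewrite /gam /genY/=; apply/funext => y; congr (_ * _%:C); apply: eq_bigr => l _.
rewrite ffunE inordK// ltnS (leq_trans _ (ltnW kN))//.
by rewrite (bigD1 l)//= leq_addr.
Qed.

Lemma min_L2dim_le N :
  (Order.min (L2dim mu (Uspace D N)) (L2dim nu (Vspace D N)) <= (dN mu nu D N)%:R%:E)%E.
Proof.
case: N => [|N].
  (* U_0 has no generators, so its dimension is bounded by the cardinality of the empty index type,
     matching [dN] at 0. *)
  rewrite /dN ge_min; apply/orP; left.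
  have -> : 0%N = #|{: 'I_0}| by rewrite card_ord.
  by apply: (@L2dim_lin_span_le _ _ _ mu _ (fun=> fun=> 0)) => g [q [k []]]; rewrite card_ord.
rewrite /dN; have [m ->] := L2dim_Uspace N.+1; have [n ->] := L2dim_Vspace N.+1.
by rewrite -EFin_min/= minEle; case: ifP => _; rewrite natrK.
Qed.

End interaction_kernel.

(** [Kop] and its kernel form are only shown to agree on [L2], which is all that either norm
    sees. *)
Lemma op_norms_ext d1 (X : measurableType d1) d2 (Y : measurableType d2) (R : realType)
    (mu : {measure set X -> \bar R}) (nu : {measure set Y -> \bar R})
    (A B : (X -> R[i]) -> (Y -> R[i])) :
  (forall f, L2 mu f -> A f = B f) ->
  opnorm mu nu A = opnorm mu nu B /\ hs_norm mu nu A = hs_norm mu nu B.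
Proof.
move=> AB; split; congr ereal_sup; apply/seteqP; split.
- by move=> _ [f [L2f f1] <-]; exists f => //; rewrite AB.
- by move=> _ [f [L2f f1] <-]; exists f => //; rewrite AB.
- move=> _ [U oU <-]; exists U => //; congr (_ `^ _)%E; apply: eq_esum => e Ue.
  by rewrite AB//; have [L2U _ _] := oU; exact: L2U.
- move=> _ [U oU <-]; exists U => //; congr (_ `^ _)%E; apply: eq_esum => e Ue.
  by rewrite AB//; have [L2U _ _] := oU; exact: L2U.
Qed.

Local Open Scope sesquilinear_scope.

Theorem theorem7p5 (R : realType)
    (d1 : measure_display) (X : measurableType d1)
    (d2 : measure_display) (Y : measurableType d2)
    (mu : {sigma_finite_measure set X -> \bar R})
    (nu : {sigma_finite_measure set Y -> \bar R})
    (p r : nat) (hp : (1 <= p)%N) (hr : (1 <= r)%N)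
    (D : interaction R X Y p r)
    (mwX : cmeasurable (wX D)) (mwY : cmeasurable (wY D))
    (ma : forall q, cmeasurable (aX D q)) (mb : forall q, cmeasurable (bY D q))
    (L2a : forall q, L2 mu (fun x => wX D x * aX D q x))
    (L2b : forall q, L2 nu (fun y => wY D y * bY D q y))
    (mphi : measurable_fun setT (phiX D)) (mpsi : measurable_fun setT (psiY D))
    (mcX : forall l, measurable_fun setT (coordX D l))
    (mcY : forall l, measurable_fun setT (coordY D l))
    (radX_fin : forall l, (ess_sup mu (fun x => `|tX D l x|%:E) < +oo)%E)
    (radY_fin : forall l, (ess_sup nu (fun y => `|tY D l y|%:E) < +oo)%E)
    (C_fin : (L2norm (mu \x nu)%E (Hfun D) < +oo)%E)
    (pos : (0 < (mu \x nu) setT)%E) :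
  let C := Hnorm mu nu D in
  let M := halfwidth mu nu D in
  let K := Kop mu D in
  let d := dN mu nu D in
  exists sigma : {finite_measure set (measurableTypeR R) -> \bar R},
  (forall B : set (measurableTypeR R), measurable B ->
     sigma B = (\int[mu \x nu]_z
       (\1_B (ucent mu nu D z) * cabs (Hfun D z) ^+ 2)%:E)%E) /\
  sigma `[- M, M]%classic = (C ^+ 2)%:E /\
  let E := Ebest sigma M C in
  (forall N, (1 <= N)%N ->
     exists P : {poly R[i]}, (size P <= N)%N /\ approx_error sigma M P = E N) /\
  (forall N : nat, exists KN : (X -> R[i]) -> (Y -> R[i]),
     let err := fun f y => K f y - KN f y in
     [/\ bounded_op mu nu KN,
         (op_rank mu nu KN <= (d N)%:R%:E)%E,
         (opnorm mu nu err <= hs_norm mu nu err)%E &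
         hs_norm mu nu err = (E N)%:E]) /\
  (forall N, (1 <= N)%N ->
     [/\ (singular_value mu nu K (d N).+1 <= (E N)%:E)%E,
         E N <= C * (M ^+ N / N`!%:R) &
         C * (M ^+ N / N`!%:R) <= C * (zeta mu nu D ^+ N / N`!%:R)]) /\
  (forall (N : nat) (eps : R), (opnorm mu nu K <= 1)%E -> 0 < eps < 1 / 2 ->
     E N <= Num.sqrt eps ->
     (Lambda mu eps (fun f => adjoint mu nu K (K f)) <= (d N)%:R%:E)%E) /\
  (forall N, (1 <= N)%N ->
     let G := moment_mx sigma M N in
     let b := moment_vec sigma M N in
     let c := mpinv G *m b in
     approx_error sigma M (\sum_(k < N) c k 0 *: 'X^k) = E N /\
     (E N ^+ 2)%:C = (C ^+ 2)%:C - (b ^t* *m mpinv G *m b) 0 0).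

Proof.
move=> C M K d.
have M0 : 0 <= M by have [] := halfwidth_bounds radX_fin radY_fin pos.
have Mz : M <= zeta mu nu D by have [] := halfwidth_bounds radX_fin radY_fin pos.
have C0 : 0 <= C by apply: fine_ge0; rewrite L2normE poweR_ge0.
have [|sigma sigmaE] := weighted_pushforward_exists (mu := (mu \x nu)%E)
  (U := measurableTypeR R) (u := ucent mu nu D)
  (measurable_cabs_sqr (cmeasurable_Hfun mwX mwY ma mb)) (fun z => sqr_ge0 _)
  (measurable_ucent mu nu mcX mcY).
  by have := nsq_Hfun C_fin; rewrite /nsq => ->; rewrite ltry.
have sigmaC := sigma_itv mwX mwY ma mb mcX mcY radX_fin radY_fin C_fin pos sigmaE.
exists sigma; split=> //; split=> // E.
have best N : exists P : {poly R[i]}, (size P <= N)%N /\ approx_error sigma M P = E N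
  := best_polynomial mwX mwY ma mb mphi mpsi mcX mcY radX_fin radY_fin
  C_fin pos sigmaE N.
have E0 N : 0 <= E N by have [P [_ <-]] := best N; exact: approx_error_ge0.
have L2k := L2_full_kernel mwX mwY ma mb mphi mpsi mcX mcY C_fin.
have L2ky := L2_full_kernel_fst nu L2a mphi mcX.
have L2kx := L2_full_kernel_snd mu L2b mpsi mcY.
have KE f (L2f : L2 mu f) := Kop_kop nu L2a mphi mcX L2f.
have L2K f : L2 mu f -> L2 nu (K f) by move=> L2f; rewrite /K KE//; exact: L2_kop.
have Ksum n (c : 'I_n -> R[i]) (f : 'I_n -> X -> R[i]) : (forall i, L2 mu (f i)) ->
    K (fun x => \sum_i c i * f i x) = (fun y => \sum_i c i * K (f i) y).
  move=> L2f; rewrite /K KE; last by apply: L2_sum => i; exact: L2Z.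
  by rewrite (kop_sum L2ky)//; apply/funext => y; apply: eq_bigr => i _; rewrite KE.
(* The explicit adjoint guarantees that the chosen [adjoint] satisfies the adjoint identity. *)
have Kadj : exists B, is_adjoint mu nu K B.
  have [bB adjB] := kop_is_adjoint L2k L2ky L2kx.
  by eexists; split; [exact: bB|move=> f g L2f L2g; rewrite /K KE//; exact: adjB].
have L2q (P : {poly R[i]}) := L2_poly_kernel mwX mwY ma mb mphi mpsi mcX mcY radX_fin radY_fin
  C_fin pos sigmaE P.
have L2qy (P : {poly R[i]}) := L2_poly_kernel_fst L2a L2b mphi mpsi mcX mcY radX_fin radY_fin pos P.
pose KP (P : {poly R[i]}) := kop mu (poly_kernel mu nu D P).
have rankKP N (P : {poly R[i]}) : (size P <= N)%N -> (op_rank mu nu (KP P) <= (d N)%:R%:E)%E.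
  move=> PN; apply: le_trans (min_L2dim_le mu nu D N).
  exact: op_rank_poly_kernel.
have L2KP (P : {poly R[i]}) f : L2 mu f -> L2 nu (KP P f) by exact: L2_kop.
have KPsum (P : {poly R[i]}) := kop_sum (L2qy P).
have KPerr (P : {poly R[i]}) f : L2 mu f ->
    rsq nu (fun y => K f y - KP P f y) <= approx_error sigma M P ^+ 2 * rsq mu f.
  exact: rsq_error_le.
have Etaylor N : (1 <= N)%N -> E N <= C * (M ^+ N / N`!%:R).
  move=> N1; have [_ _ minE _] := best_approximation M0 sigmaC N1.
  apply: le_trans (approx_error_taylor mwX mwY ma mb mcX mcY radX_fin radY_fin
    C_fin pos sigmaE N).
  by apply: minE; exact: size_poly.
split; first by move=> N _; exact: best.
split.
  move=> N; have [P [PN PE]] := best N; exists (KP P) => err.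
  have [opE hsE] := op_norms_ext nu (fun f (L2f : L2 mu f) => esym
    (kop_error L2a L2b mphi mpsi mcX mcY radX_fin radY_fin pos P L2f)).
  have hsP := hs_norm_error mwX mwY ma mb L2a L2b mphi mpsi mcX mcY radX_fin radY_fin
    C_fin pos sigmaE P.
  split.
  - exact: bounded_kop.
  - exact: rankKP.
  - rewrite /err opE hsE hsP -(L2norm_error mwX mwY ma mb mphi mpsi mcX mcY radX_fin radY_fin pos sigmaE).
    apply: opnorm_kop_le.
    + exact: (L2_error mwX mwY ma mb mphi mpsi mcX mcY radX_fin radY_fin pos sigmaE).
    + exact: (L2_error_fst L2a L2b mphi mpsi mcX mcY radX_fin radY_fin pos).
  - by rewrite /err hsE hsP PE.
split.
  move=> N N1; split; last 2 first.
  - exact: Etaylor.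
  - by rewrite ler_wpM2l// ler_wpM2r ?invr_ge0// lerXn2r ?nnegrE// (le_trans M0).
  have [P [PN PE]] := best N.
  have err := KPerr P; rewrite PE in err.
  exact: (singular_value_le L2K (L2KP P) Ksum (KPsum P) Kadj (rankKP N P PN) err (E0 N)).
split.
  move=> N eps _ /andP[eps0 _] Eeps; have [P [PN PE]] := best N.
  have err := KPerr P; rewrite PE in err.
  apply: (Lambda_le L2K (L2KP P) (KPsum P) Kadj (rankKP N P PN) err eps0).
  by rewrite -(sqr_sqrtr (ltW eps0)) lerXn2r ?nnegrE ?sqrtr_ge0.
move=> N N1 G b c; have [_ cE _ E2] := best_approximation M0 sigmaC N1.
by split; [exact: cE|rewrite E2 /dotc mulmxA].
Qed.
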